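(* The Palm probability distribution of $H_{\mathcal I}$ with respect to $\mathcal V_{\mathcal I}$ is a Nakagami distribution with parameters $\left(\frac52,\frac{5}{2\lambda\pi}\right)$.
   Context: Model. Let $\lambda,v>0$. $\Phi=\sum_i\delta_{X_i}$ is a homogeneous Poisson point process of intensity $\lambda$ on $\mathbb R^2$ and $(\Theta_i)$ are i.i.d. uniform angles on $[-\pi,\pi)$, independent of $\Phi$. Base station (BS) $i$ is at $X_i^t=X_i+vt(\cos\Theta_i,\sin\Theta_i)$ at time $t\in\mathbb R$; $d_i(t)=\|X_i^t\|$ is its distance to the user at the origin. The tropical interference handover point process $\mathcal V_{\mathcal I}$ on $\mathbb R$ consists of the times $s$ for which there is a pair $i\neq j$ with $d_i(s)=d_j(s)=h$ and exactly one BS $l$ with $d_l(s)<h$. At such a time, $H_{\mathcal I}=h$. Palm expectation: for a stationary point process $N$ on $\mathbb R$ with intensity $\lambda_N\in(0,\infty)$, built time-shift-compatibly from the moving configuration, $\mathbb E^0_N[f]=\lambda_N^{-1}\,\mathbb E\big[\sum_{t\in N\cap[0,1]}f_t\big]$, where $f_t$ is the quantity $f$ observed at time $t$. The Nakagami distribution with parameters $(m,\omega)$ has density $\frac{2m^m}{\Gamma(m)\omega^m}x^{2m-1}e^{-mx^2/\omega}$, $x\ge0$. *)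

(* Defs.v *)
From HB Require Import structures.
From mathcomp Require Import all_boot all_order all_algebra finmap.
From mathcomp Require Import all_classical all_reals all_analysis.

Set Implicit Arguments.
Unset Strict Implicit.
Unset Printing Implicit Defensive.

Import Order.TTheory GRing.Theory Num.Theory.
Import numFieldNormedType.Exports.

Local Open Scope classical_set_scope.
Local Open Scope ring_scope.

Section independence.
Context {d : measure_display} {Omega : measurableType d} {R : realType}.
Variable P : probability Omega R.

Definition mutually_independent (I : choiceType) d1 (T1 : measurableType d1)
    (Y : I -> {RV P >-> T1}) : Prop :=
  forall (J : {fset I}) (C : I -> set T1), (forall i, measurable (C i)) ->
    P (\bigcap_(i in [set` J]) (Y i @^-1` C i)) =
    (\prod_(i <- J) P (Y i @^-1` C i))%E.

(* Independence of the sigma-algebras generated by two whole families, stated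
   on the generating pi-systems of finite-dimensional rectangles. *)
Definition independent_families (I1 I2 : choiceType)
    d1 (T1 : measurableType d1) (Y : I1 -> {RV P >-> T1})
    d2 (T2 : measurableType d2) (Z : I2 -> {RV P >-> T2}) : Prop :=
  forall (J : {fset I1}) (K : {fset I2}) (B : I1 -> set T1) (C : I2 -> set T2),
    (forall i, measurable (B i)) -> (forall k, measurable (C k)) ->
    P (\bigcap_(i in [set` J]) (Y i @^-1` B i) `&`
       \bigcap_(k in [set` K]) (Z k @^-1` C k)) =
    (P (\bigcap_(i in [set` J]) (Y i @^-1` B i)) *
     P (\bigcap_(k in [set` K]) (Z k @^-1` C k)))%E.

End independence.

Lemma ltNpipi {R : realType} : - pi < pi :> R.
Proof. by rewrite gtrN// pi_gt0. Qed.

Section network.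
Context {d : measure_display} {Omega : measurableType d} {R : realType}.
Variable P : probability Omega R.

Definition leb2 : set (R * R) -> \bar R :=
  (@lebesgue_measure R \x @lebesgue_measure R)%E.

(* Points are enumerated by nat: a homogeneous Poisson process of positive
   intensity on the plane has infinitely many points almost surely. *)
Definition point_process (X : nat -> {RV P >-> (R * R)%type}) (w : Omega) :
    {measure set (R * R) -> \bar R} :=
  mseries (fun i => \d_(X i w)) 0.

(* The second argument of [poisson_prob] is a dummy. *)
Definition homogeneous_poisson (lambda : R)
    (X : nat -> {RV P >-> (R * R)%type}) : Prop :=
  forall (n : nat) (A : 'I_n -> set (R * R)) (k : 'I_n -> nat),
    (forall i, measurable (A i)) -> (forall i, (leb2 (A i) < +oo)%E) ->
    trivIset setT A ->
    P [set w | forall i, point_process X w (A i) = (k i)%:R%:E] =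
    (\prod_(i < n) poisson_prob (lambda * fine (leb2 (A i))) 0 [set k i])%E.

Definition uniform_angle (Theta : {RV P >-> R}) : Prop :=
  forall C : set R, measurable C ->
    distribution P Theta C = uniform_prob (@ltNpipi R) C.

Variables (X : nat -> {RV P >-> (R * R)%type}) (Theta : nat -> {RV P >-> R}).
Variable v : R.

Definition bs_position (i : nat) (t : R) (w : Omega) : R * R :=
  ((X i w).1 + v * t * cos (Theta i w), (X i w).2 + v * t * sin (Theta i w)).

Definition bs_distance (i : nat) (t : R) (w : Omega) : R :=
  Num.sqrt ((bs_position i t w).1 ^+ 2 + (bs_position i t w).2 ^+ 2).

Definition interference_handover (w : Omega) (s h : R) : Prop :=
  (exists i j : nat,
     [/\ i <> j, bs_distance i s w = h & bs_distance j s w = h]) /\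
  (exists! l : nat, bs_distance l s w < h).

Definition V_I (w : Omega) : set R := [set s | exists h, interference_handover w s h].

(* At s in V_I w the distance h is unique: the pair at a smaller such distance
   would give two base stations nearer than h. The default 0 is used only
   outside V_I w. *)
Definition H_I (s : R) (w : Omega) : R := xget 0 [set h | interference_handover w s h].

End network.

Section palm.
Context {d : measure_display} {Omega : measurableType d} {R : realType}.
Variables (P : probability Omega R) (N : Omega -> set R).

Definition intensity : \bar R :=
  (\int[P]_w \esum_(t in N w `&` `[0%R, 1%R]) 1)%E.

(* Meaningful for nonnegative f, when 0 < intensity < +oo. *)
Definition palm_expectation (f : R -> Omega -> \bar R) : \bar R :=
  (((fine intensity)^-1)%:E *
   \int[P]_w \esum_(t in N w `&` `[0%R, 1%R]) f t w)%E.

Definition palm_distribution (H : R -> Omega -> R) (B : set R) : \bar R :=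
  palm_expectation (fun t w => (\1_B (H t w))%:E).

End palm.

Section nakagami.
Context {R : realType}.

Definition Gamma (a : R) : R :=
  \int[lebesgue_measure]_(x in `]0, +oo[) (x `^ (a - 1) * expR (- x)).

Definition nakagami_pdf (m omega x : R) : R :=
  if 0 <= x then
    2 * m `^ m / (Gamma m * omega `^ m) * x `^ (2 * m - 1) *
    expR (- (m * x ^+ 2 / omega))
  else 0.

Definition nakagami_prob (m omega : R) (B : set R) : \bar R :=
  (\int[lebesgue_measure]_(x in B) (nakagami_pdf m omega x)%:E)%E.

End nakagami.

(* Main.v *)
Require Import Defs.
From HB Require Import structures.
From mathcomp Require Import all_boot all_order all_algebra finmap ring lra.
From mathcomp Require Import all_classical all_reals all_analysis.
From mathcomp Require Import measurable_realfun.
Import Order.TTheory GRing.Theory Num.Theory.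
Import numFieldNormedType.Exports.
Local Open Scope classical_set_scope.
Local Open Scope ring_scope.

(** Why the Palm law of the handover distance is a Nakagami law.

A station is described by its mark z = (angle, initial point); its distance
to the user at time s is [dist v z s], and the square of that distance is a
quadratic polynomial in s with leading coefficient v^2 for every station and
with linear coefficient 2v [radial z].  Hence two stations whose linear
coefficients differ are equidistant from the user at exactly one time [ctime],
at the distance [cdist].  Almost surely all these coefficients differ and no
three stations are equidistant at a time in [0, 1]
([ae_crossing], [ae_no_triple]), so the handovers in the time interval [0, 1]
correspond to the unordered pairs of stations whose crossing time is in
[0, 1] and for which exactly one further station is nearer at that time
([pair_count_handovers]).

The marks form a Poisson process with intensity lambda times the measure
[muZ] (uniform angle times Lebesgue measure).  By the two-point Mecke formula
([expectation_lonely]), the mean number of ordered pairs of this kind with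
crossing distance in B is the integral of
lambda^2 * P(Poisson(lambda * pi * cdist^2) = 1) over the pairs of marks with
crossing time in [0, 1] and crossing distance in B: at any fixed time the
stations nearer than h are those of a disc of area pi h^2 ([muZ_ball]), and
conditioning on two of the points leaves the others Poisson.

It remains to integrate over the crossing distance.  The image of the measure
[muZZ] on pairs of marks under (ctime, cdist) is found by symmetry: it is
invariant under time translations, because moving every station along its own
trajectory preserves [muZ], and a dilation of the plane by c multiplies ctime
and cdist by c and the measure by c^4.  So the pairs with crossing time in
[0, 1] and distance less than r have measure proportional to r^3, i.e. the
crossing distance has density K h^2 ([tie_intensity]).  The mean number of
handovers per unit time with distance in dh is therefore proportional to
h^2 * (lambda pi h^2) * exp(- lambda pi h^2), that is to
h^4 exp(- lambda pi h^2) ([expectation_handovers]), which is the Nakagami density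
with parameters 5/2 and 5/(2 lambda pi) up to a constant.  The constant K is
positive and finite, and it cancels in the Palm normalisation; the substitution
y = lambda pi h^2 identifies the normalising constant with Gamma(5/2)
([gamma_integral_substitution]).

The Mecke formula is obtained from the finite-dimensional Poisson laws as
follows.  The void-type functionals E prod_l g(z_l) are computed first for
the points, by approximating g by simple functions ([laplace_points]), and then
for the marks, by averaging the angles one at a time ([laplace_marked]).
Differentiating the resulting generating functions gives the second factorial
moment measure, also on an event which depends only on the points outside the
pairs under consideration ([decoupled_pairs]).  Finally the random disc of
nearer stations is discretised, so that on each cell of a countable partition
the event of finding one nearer station is such an event. *)

Set Implicit Arguments.
Unset Strict Implicit.
Unset Printing Implicit Defensive.

(** * Lebesgue, uniform and product measures *)

Lemma sigma_finite_product d1 d2 (T1 : measurableType d1) (T2 : measurableType d2)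
    (R : realType) (m1 : {sigma_finite_measure set T1 -> \bar R})
    (m2 : {sigma_finite_measure set T2 -> \bar R}) :
  sigma_finite setT (m1 \x m2)%E.
Proof.
have [F TF Ffin] := sigma_finiteT m1; have [G TG Gfin] := sigma_finiteT m2.
pose H n : set (T1 * T2) :=
  if @choice.unpickle (nat * nat)%type n is Some (i, j) then F i `*` G j else set0.
exists H => [|n].
  apply/esym/seteqP; split => // -[x y] _.
  have [i _ Fx] : (\bigcup_i F i) x by rewrite -TF.
  have [j _ Gy] : (\bigcup_i G i) y by rewrite -TG.
  by exists (choice.pickle (i, j)) => //; rewrite /H choice.pickleK.
rewrite /H; case: (@choice.unpickle (nat * nat)%type n) => [[i j]|]; last by rewrite measure0.
have [mF fF] := Ffin i; have [mG fG] := Gfin j; split; first exact: measurableX.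
by rewrite product_measure1E// lte_mul_pinfty// ge0_fin_numE.
Qed.

Section real_measures.
Context {R : realType}.

(** A copy of Lebesgue measure, and below of the uniform law, carried by the
type R itself: their products are then measures on the products of R, where
the random points and angles take their values. *)
Definition lebR : set R -> \bar R := fun A => @lebesgue_measure R A.

Let lebR0 : lebR set0 = 0%E. Proof. exact: (@measure0 _ (measurableTypeR R)). Qed.
Let lebR_ge0 A : (0 <= lebR A)%E. Proof. exact: (@measure_ge0 _ (measurableTypeR R)). Qed.
Let lebR_sigma_additive : semi_sigma_additive lebR.
Proof. exact: (@measure_semi_sigma_additive _ (measurableTypeR R) R (@lebesgue_measure R)). Qed.

HB.instance Definition _ := isMeasure.Build _ R R lebR lebR0 lebR_ge0 lebR_sigma_additive.

Let lebR_sigma_finite : sigma_finite setT lebR.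
Proof. exact: (@sigma_finiteT _ (measurableTypeR R) R (@lebesgue_measure R)). Qed.

HB.instance Definition _ := @Measure_isSigmaFinite.Build _ R R lebR lebR_sigma_finite.

Definition unifR : set R -> \bar R := fun A => uniform_prob (@ltNpipi R) A.
Let unifR0 : unifR set0 = 0%E. Proof. exact: (@measure0 _ (measurableTypeR R)). Qed.
Let unifR_ge0 A : (0 <= unifR A)%E. Proof. exact: (@measure_ge0 _ (measurableTypeR R)). Qed.
Let unifR_sigma_additive : semi_sigma_additive unifR.
Proof. exact: (@measure_semi_sigma_additive _ (measurableTypeR R) R (uniform_prob (@ltNpipi R))). Qed.

HB.instance Definition _ := isMeasure.Build _ R R unifR unifR0 unifR_ge0 unifR_sigma_additive.

Let unifR_setT : unifR setT = 1%E.
Proof. exact: (@probability_setT _ (measurableTypeR R) R (uniform_prob (@ltNpipi R))). Qed.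

HB.instance Definition _ := @Measure_isProbability.Build _ R R unifR unifR_setT.

Definition mu2_def : set (R * R)%type -> \bar R := (lebR \x lebR)%E.
HB.instance Definition _ := Measure.on mu2_def.
HB.instance Definition _ := @Measure_isSigmaFinite.Build _ (R * R)%type R mu2_def
  (sigma_finite_product lebR lebR).

(** The products are sealed behind their values on sets, so that unification never
unfolds a product measure. *)
Fact mu2_key : {m : {sigma_finite_measure set (R * R)%type -> \bar R} |
  forall A, m A = (lebR \x lebR)%E A}.
Proof. by exists mu2_def. Qed.
Definition mu2 := sval mu2_key.

Definition muZ_def : set (R * (R * R))%type -> \bar R := (unifR \x mu2)%E.
HB.instance Definition _ := Measure.on muZ_def.
HB.instance Definition _ := @Measure_isSigmaFinite.Build _ (R * (R * R))%type R muZ_def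
  (sigma_finite_product unifR mu2).

Fact muZ_key : {m : {sigma_finite_measure set (R * (R * R))%type -> \bar R} |
  forall A, m A = (unifR \x mu2)%E A}.
Proof. by exists muZ_def. Qed.
Definition muZ := sval muZ_key.

Definition muZZ_def : set ((R * (R * R)) * (R * (R * R)))%type -> \bar R := (muZ \x muZ)%E.
HB.instance Definition _ := Measure.on muZZ_def.
HB.instance Definition _ :=
  @Measure_isSigmaFinite.Build _ ((R * (R * R)) * (R * (R * R)))%type R muZZ_def
  (sigma_finite_product muZ muZ).

Fact muZZ_key : {m : {sigma_finite_measure set ((R * (R * R)) * (R * (R * R)))%type -> \bar R} |
  forall A, m A = (muZ \x muZ)%E A}.
Proof. by exists muZZ_def. Qed.
Definition muZZ := sval muZZ_key.

Lemma mu2X A B : measurable A -> measurable B -> mu2 (A `*` B) = (lebR A * lebR B)%E.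
Proof. by move=> mA mB; rewrite (svalP mu2_key) product_measure1E. Qed.

Lemma muZX A B : measurable A -> measurable B -> muZ (A `*` B) = (unifR A * mu2 B)%E.
Proof. by move=> mA mB; rewrite (svalP muZ_key) product_measure1E. Qed.

Lemma muZZX A B : measurable A -> measurable B -> muZZ (A `*` B) = (muZ A * muZ B)%E.
Proof. by move=> mA mB; rewrite (svalP muZZ_key) product_measure1E. Qed.

Lemma mu2_unique (m : {measure set (R * R)%type -> \bar R}) :
  (forall A B, measurable A -> measurable B -> m (A `*` B) = (lebR A * lebR B)%E) ->
  forall A, measurable A -> mu2 A = m A.
Proof. by move=> h A mA; rewrite (svalP mu2_key); exact: product_measure_unique. Qed.

Lemma muZZ_unique (m : {measure set ((R * (R * R)) * (R * (R * R)))%type -> \bar R}) :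
  (forall A B, measurable A -> measurable B -> m (A `*` B) = (muZ A * muZ B)%E) ->
  forall A, measurable A -> muZZ A = m A.
Proof. by move=> h A mA; rewrite (svalP muZZ_key); exact: product_measure_unique. Qed.

Lemma mu2_section A : mu2 A = (\int[lebR]_x lebR (xsection A x))%E.
Proof. exact: (svalP mu2_key). Qed.

Lemma muZ_section A : muZ A = (\int[unifR]_t mu2 (xsection A t))%E.
Proof. exact: (svalP muZ_key). Qed.

Lemma muZZ_section A : muZZ A = (\int[muZ]_z muZ (xsection A z))%E.
Proof. exact: (svalP muZZ_key). Qed.

Lemma integral_muZ (f : R * (R * R) -> \bar R) : measurable_fun setT f ->
  (forall z, 0 <= f z)%E ->
  (\int[muZ]_z f z = \int[mu2]_x \int[unifR]_t f (t, x))%E.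
Proof.
move=> mf f0; rewrite -(@fubini_tonelli2 _ _ R _ R unifR mu2)//.
by apply: eq_measure_integral => A _ _; exact: (svalP muZ_key).
Qed.

Lemma lebRE A : lebR A = @lebesgue_measure R A. Proof. by []. Qed.

Lemma unifRE A : unifR A = uniform_prob (@ltNpipi R) A. Proof. by []. Qed.

Lemma unifR_T : unifR setT = 1%E. Proof. exact: unifR_setT. Qed.

Lemma ge0_integral_lebR (f : R -> \bar R) (D : set R) : measurable D ->
  measurable_fun D f -> (forall x, D x -> (0 <= f x)%E) ->
  (\int[lebR]_(x in D) f x = \int[lebesgue_measure]_(x in D) f x)%E.
Proof.
move=> mD mf f0.
pose idm := (id : measurableTypeR R -> R).
have mid : measurable_fun [set: measurableTypeR R] idm by move=> _ A mA; rewrite setTI.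
transitivity (\int[pushforward (@lebesgue_measure R) idm]_(x in D) f x)%E.
  by apply: eq_measure_integral.
rewrite ge0_integral_pushforward//.
by move=> y /set_mem; exact: f0.
Qed.

Lemma leb2E (A : set (R * R)) : measurable A -> leb2 A = mu2 A.
Proof.
move=> mA.
pose idm := (id : R * R -> measurableTypeR R * measurableTypeR R).
have mid : measurable_fun [set: R * R] idm by move=> _ B mB; rewrite setTI.
have := @product_measure_unique _ _ (measurableTypeR R) (measurableTypeR R) R
  (@lebesgue_measure R) (@lebesgue_measure R) (pushforward mu2 idm).
apply => // B C mB mC.
exact: mu2X.
Qed.

End real_measures.
#[global] Opaque lebR unifR.
Arguments lebR R : clear implicits.
Arguments unifR R : clear implicits.
Arguments mu2 R : clear implicits.
Arguments muZ R : clear implicits.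
Arguments muZZ R : clear implicits.

(** * The Laplace functional of the Poisson points *)

Local Open Scope ereal_scope.

Lemma ge0_nneseriesZl {R : realType} (c : \bar R) (f : nat -> \bar R) :
  0 <= c -> (forall k, 0 <= f k) ->
  \sum_(k <oo) (c * f k) = c * \sum_(k <oo) f k.
Proof.
move=> c0 f0; rewrite -!ge0_integral_count//; last by move=> k; rewrite mule_ge0.
by rewrite ge0_integralZl.
Qed.

Lemma emeasurable_prod d (T : measurableType d) (R : realType) (D : set T)
    (I : Type) (s : seq I) (h : I -> T -> \bar R) :
  measurable D -> (forall i, measurable_fun D (h i)) ->
  measurable_fun D (fun x => (\prod_(i <- s) h i x)%E : \bar R).
Proof.
move=> mD mh; elim: s => [|i s IH].
  by under eq_fun do rewrite big_nil; exact: measurable_cst.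
by under eq_fun do rewrite big_cons; exact: emeasurable_funM.
Qed.

Section fidi.
Context {d : measure_display} {Omega : measurableType d} {R : realType}.
Variable P : probability Omega R.

Definition hits (N : Omega -> \bar R) (k : nat) : set Omega :=
  [set w | N w = k%:R%:E].

Lemma measurable_hits (N : Omega -> \bar R) (k : nat) : measurable_fun setT N -> measurable (hits N k).
Proof.
move=> mN; have := mN measurableT [set k%:R%:E] (emeasurable_set1 _).
by rewrite setTI.
Qed.

(** Independence of integer counts, given by their joint mass function, turned into
the product rule for expectations of functions of the counts.  The functions are
introduced one factor at a time: after j steps the first j indicators have been
summed against their weights. *)
Lemma expectation_of_independent_counts n (N : 'I_n -> Omega -> \bar R)
    (p f : 'I_n -> nat -> \bar R) :
  (forall i, measurable_fun setT (N i)) ->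
  (forall i k, 0 <= p i k) -> (forall i k, 0 <= f i k) ->
  (forall k : 'I_n -> nat,
     P [set w | forall i, N i w = (k i)%:R%:E] = \prod_(i < n) p i (k i)) ->
  \int[P]_w \prod_(i < n) \sum_(k <oo) (f i k * (\1_(hits (N i) k) w)%:E) =
  \prod_(i < n) \sum_(k <oo) (f i k * p i k).
Proof.
move=> mN p0 f0 PN.
have mI i k : measurable_fun setT (fun w => (\1_(hits (N i) k) w)%:E : \bar R).
  by apply/measurable_EFinP; apply: measurable_indic; exact: measurable_hits.
have I0 i k w : 0 <= (\1_(hits (N i) k) w)%:E :> \bar R by rewrite lee_fin.
pose S (i : 'I_n) (w : Omega) : \bar R := \sum_(k <oo) (f i k * (\1_(hits (N i) k) w)%:E).
have S0 i w : 0 <= S i w by apply: nneseries_ge0 => k _ _; rewrite mule_ge0.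
have mS i : measurable_fun setT (S i).
  by apply: ge0_emeasurable_sum => [k w _ _|k _]; [rewrite mule_ge0|exact: measurable_funeM].
pose F (j : nat) (k : 'I_n -> nat) (i : 'I_n) (w : Omega) : \bar R :=
  if (i < j)%N then S i w else (\1_(hits (N i) (k i)) w)%:E.
pose G (j : nat) (k : 'I_n -> nat) (i : 'I_n) : \bar R :=
  if (i < j)%N then \sum_(k <oo) (f i k * p i k) else p i (k i).
have F0 j k i w : 0 <= F j k i w by rewrite /F; case: ifP.
have G0 j k i : 0 <= G j k i.
  by rewrite /G; case: ifP => // _; apply: nneseries_ge0 => m _ _; rewrite mule_ge0.
have mF j k i : measurable_fun setT (F j k i).
  by rewrite /F; case: (i < j)%N; [exact: mS|exact: mI].
suff claim j : (j <= n)%N ->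
    forall k, \int[P]_w \prod_(i < n) F j k i w = \prod_(i < n) G j k i.
  have := claim n (leqnn n) (fun=> 0%N).
  under eq_integral do under eq_bigr do rewrite /F ltn_ord.
  by under [in RHS]eq_bigr do rewrite /G ltn_ord.
elim: j => [_ k|j IH jn k].
  under [RHS]eq_bigr do rewrite /G ltn0.
  rewrite -PN -[X in P X]setIT -integral_indic //; last first.
    rewrite (_ : [set _ | _] = \bigcap_(i in [set: 'I_n]) hits (N i) (k i)); last first.
      by apply/seteqP; split => w /= h; [move=> i _; exact: h|move=> i; exact: (h i)].
    by apply: fin_bigcap_measurable => // i _; exact: measurable_hits.
  apply: eq_integral => w _.
  under eq_bigr do rewrite /F ltn0.
  rewrite indicE /=; case: (boolP (_ \in _)) => [/set_mem h|/negP h].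
    by rewrite big1// => i _; rewrite indicE mem_set//; exact: h.
  have [i hi] : exists i, N i w <> (k i)%:R%:E.
    by apply/existsNP => h'; apply: h; exact: mem_set.
  by rewrite (bigD1 i)//= indicE memNset// mul0e.
have jn' : (j < n)%N by [].
pose j0 := Ordinal jn'.
pose upd m i := if i == j0 then m else k i.
have neq_j (i : 'I_n) : i != j0 -> (i < j.+1)%N = (i < j)%N.
  by rewrite ltnS leq_eqVlt -(inj_eq val_inj) /= => /negPf ->.
have FS m i w : i != j0 -> F j.+1 k i w = F j (upd m) i w.
  by move=> ij; rewrite /F neq_j// /upd (negPf ij).
have F_j0 m w : F j (upd m) j0 w = (\1_(hits (N j0) m) w)%:E.
  by rewrite /F /= ltnn /upd eqxx.
have GS m i : i != j0 -> G j.+1 k i = G j (upd m) i.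
  by move=> ij; rewrite /G neq_j// /upd (negPf ij).
have G_j0 m : G j (upd m) j0 = p j0 m by rewrite /G /= ltnn /upd eqxx.
transitivity (\int[P]_w \sum_(m <oo) (f j0 m * \prod_(i < n) F j (upd m) i w)).
  apply: eq_integral => w _.
  rewrite (bigD1 j0)//= {1}/F /= ltnSn muleC /S -ge0_nneseriesZl; last 2 first.
  - by rewrite prode_ge0.
  - by move=> m; rewrite mule_ge0.
  apply: eq_eseriesr => m _; rewrite [in RHS](bigD1 j0)//= F_j0.
  rewrite muleC muleA; congr (_ * _).
  by apply: eq_bigr => i ij; exact: FS.
have m_prod m : measurable_fun setT (fun w => \prod_(i < n) F j (upd m) i w).
  exact: emeasurable_prod.
rewrite integral_nneseries//; last 2 first.
  by move=> m; apply: measurable_funeM.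
  by move=> m w _; rewrite mule_ge0// prode_ge0.
rewrite [RHS](bigD1 j0)//= {1}/G /= ltnSn muleC -ge0_nneseriesZl; last 2 first.
- by rewrite prode_ge0.
- by move=> m; rewrite mule_ge0.
apply: eq_eseriesr => m _.
rewrite ge0_integralZl//; last by move=> w _; rewrite prode_ge0.
rewrite (IH (ltnW jn)) (bigD1 j0)//= G_j0 muleA [RHS]muleC; congr (_ * _).
by apply: eq_bigr => i ij; rewrite (GS m).
Qed.
End fidi.

Section ncount.
Context {R : realType} {T : Type}.
Implicit Types (z : nat -> T) (C : set T).

(** Counting along a sequence, with values in the extended reals: the number of
indices l, not of distinct points, for which z l lies in C. *)
Definition ncount z C : \bar R := \sum_(0 <= l <oo) (\1_C (z l))%:E.

Lemma ncount_ge0 z C : 0 <= ncount z C.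
Proof. by apply: nneseries_ge0 => l _ _; rewrite lee_fin. Qed.

Lemma ncount_fin_eventually_notin z C : ncount z C < +oo ->
  exists M, forall l, (M <= l)%N -> ~ C (z l).
Proof.
move=> zC; have f0 l : 0 <= (\1_C (z l))%:E :> \bar R by rewrite lee_fin.
have /cvg_lim h := @nneseries_tail_cvg R (fun l => (\1_C (z l))%:E) xpredT zC (fun l _ => f0 l).
apply: contrapT => /forallNP H.
suff : (1 : \bar R) <= 0 by rewrite lee_fin ler10.
rewrite -(h (@ereal_hausdorff R)); apply: lime_ge.
  by apply/cvg_ex; eexists; apply: nneseries_tail_cvg.
apply: nearW => M.
have /existsNP[l /not_implyP[Ml /contrapT Cl]] := H M.
apply: le_trans (nneseries_lim_ge l.+1 _) => //.
rewrite big_nat_recr//= indicE mem_set// leeDr// sume_ge0// => i _.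
Qed.

Lemma ncount_tail z C M : (forall l, (M <= l)%N -> ~ C (z l)) ->
  ncount z C = (\sum_(l < M) (`[< C (z l) >] : nat))%:R%:E.
Proof.
move=> h; rewrite /ncount (nneseries_split 0 M); last by move=> l _; rewrite lee_fin.
rewrite add0n.
rewrite [X in _ + X]eseries0 ?adde0; last first.
  by move=> l Ml _; rewrite indicE memNset//; exact: h.
rewrite big_mkord natr_sum -sumEFin; apply: eq_bigr => l _.
by rewrite indicE.
Qed.
End ncount.
Arguments ncount R {T} z C.

Lemma measurable_ncount d (Omega : measurableType d) d' (T : measurableType d')
    (R : realType) (Z : nat -> Omega -> T) (C : set T) :
  (forall l, measurable_fun setT (Z l)) -> measurable C ->
  measurable_fun setT (fun w => ncount R (Z ^~ w) C : \bar R).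
Proof.
move=> mZ mC; rewrite /ncount; apply: ge0_emeasurable_sum => [l w _ _|l _].
  by rewrite lee_fin.
apply/measurable_EFinP/(measurableT_comp (f := \1_C : T -> R)) => //.
Qed.

(** For r = 0 the mass function degenerates to a Dirac mass at 0, and the formula
still holds. *)
Lemma poisson_generating_function (R : realType) (r c : R) : (0 <= r)%R -> (0 <= c)%R ->
  \sum_(k <oo) ((c ^+ k)%:E * poisson_prob r 0 [set k]) =
  (expR (- (r * (1 - c))))%:E.
Proof.
move=> r0 c0; rewrite /poisson_prob; case: (ltP 0%R r) => [rpos|r0']; last first.
  have {r0 r0'}-> : r = 0%R by apply/eqP; rewrite eq_le r0 r0'.
  rewrite mul0r oppr0 expR0 (nneseries_split 0 1)/=; last first.
    by move=> k _; rewrite mule_ge0// lee_fin exprn_ge0.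
  rewrite add0n big_nat1 expr0 mul1e diracE mem_set// eseries0 ?adde0//.
  by move=> k k1 _; rewrite diracE memNset ?mule0//= => k0; move: k1; rewrite -k0.
have -> : expR (- (r * (1 - c))) = (expR (- r) * expR (c * r))%R.
  by rewrite -expRD; congr expR; ring.
have -> : (expR (- r) * expR (c * r))%:E =
    (expR (- r))%:E * \sum_(k <oo) ((c * r) ^+ k * k`!%:R^-1)%R%:E.
  rewrite EFinM; congr *%E; rewrite expRE -EFin_lim; last first.
    rewrite /pseries/=; under eq_fun do rewrite mulrC.
    exact: is_cvg_series_exp_coeff.
  apply/congr_lim/funext => n/=; rewrite /pseries/= /series/= -sumEFin//.
  by apply: eq_bigr => k _; rewrite mulrC.
rewrite -ge0_nneseriesZl ?lee_fin ?expR_ge0//; last first.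
  by move=> k; rewrite lee_fin divr_ge0// exprn_ge0// mulr_ge0.
apply: eq_eseriesr => k _; rewrite esum_set1; last by rewrite lee_fin poisson_pmf_ge0.
rewrite /poisson_pmf rpos -!EFinM exprMn; congr EFin; ring.
Qed.

Section fprod.
Local Open Scope ring_scope.
Context {R : realType} {T : Type}.
Implicit Types (g : T -> R) (z : nat -> T).

(** The infinite product of g along z; for g with values in [0, 1] the partial products
decrease, so the limit exists. *)
Definition fprod g z : R := limn (fun n => \prod_(l < n) g (z l)).

Lemma fprodE g z M : (forall l, (M <= l)%N -> g (z l) = 1) ->
  fprod g z = \prod_(l < M) g (z l).
Proof.
move=> h; apply/lim_near_cst => //; exists M => // n /= Mn.
rewrite -(subnKC Mn) big_split_ord/= [X in _ * X]big1 ?mulr1// => i _.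
by rewrite h// leq_addr.
Qed.

Lemma prod_itv g z n : (forall x, 0 <= g x <= 1) -> 0 <= \prod_(l < n) g (z l) <= 1.
Proof.
move=> g01; rewrite prodr_ge0/= => [|i _]; last by have /andP[] := g01 (z i).
by apply: prodr_ile1 => i _; exact: g01.
Qed.

Lemma prod_nonincreasing g z : (forall x, 0 <= g x <= 1) ->
  nonincreasing_seq (fun n => \prod_(l < n) g (z l)).
Proof.
move=> g01; apply/nonincreasing_seqP => n; rewrite big_ord_recr/=.
have /andP[p0 p1] := prod_itv z n g01; have /andP[q0 q1] := g01 (z n).
by rewrite -[leRHS]mulr1 ler_wpM2l.
Qed.

Lemma is_cvg_prod g z : (forall x, 0 <= g x <= 1) ->
  cvgn (fun n => \prod_(l < n) g (z l)).
Proof.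
move=> g01; apply: (nonincreasing_is_cvgn (prod_nonincreasing z g01)).
by exists 0 => _ [n _ <-]; have /andP[] := prod_itv z n g01.
Qed.

Lemma fprod_itv g z : (forall x, 0 <= g x <= 1) -> 0 <= fprod g z <= 1.
Proof.
move=> g01; have cv := @is_cvg_prod g z g01; rewrite /fprod; apply/andP; split.
  apply: limr_ge => //.
  by apply: nearW => n; have /andP[] := prod_itv z n g01.
apply: limr_le => //.
by apply: nearW => n; have /andP[] := prod_itv z n g01.
Qed.

End fprod.

Section fprod_measurable.
Context {R : realType} d (Omega : measurableType d) d' (T : measurableType d').

Lemma measurable_fprod (g : T -> R) (Z : nat -> Omega -> T) :
  (forall l, measurable_fun setT (Z l)) -> measurable_fun setT g ->
  (forall x, (0 <= g x <= 1)%R) ->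
  measurable_fun setT (fun w => fprod g (Z ^~ w)).
Proof.
move=> mZ mg g01.
apply: (@measurable_fun_cvg _ _ R setT (fun n w => \prod_(l < n) g (Z l w))%R).
  move=> n; apply: measurable_prod => i _.
  exact: measurableT_comp.
by move=> w _; exact: (@is_cvg_prod _ _ g (Z ^~ w) g01).
Qed.
End fprod_measurable.

Section window.
Local Open Scope ring_scope.
Context {R : realType}.

(** Bounded squares exhausting the plane; they localise all the arguments below to
finitely many points. *)
Definition window (m : nat) : set (R * R) :=
  [set x | (`|x.1| <= m%:R)%R /\ (`|x.2| <= m%:R)%R].

Lemma windowE m : window m = `[- m%:R, m%:R]%classic `*` `[- m%:R, m%:R]%classic.
Proof. by apply/seteqP; split => x /=; rewrite !in_itv/= -!ler_norml. Qed.

Lemma measurable_window m : measurable (window m).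
Proof. by rewrite windowE; exact: measurableX. Qed.

Lemma mu2_window m : (mu2 R (window m) < +oo)%E.
Proof.
rewrite windowE mu2X//= !lebRE !lebesgue_measure_itv/=.
by case: ifP => _; rewrite ?mul0e// -EFinD -EFinM ltry.
Qed.

Lemma window_exhaust x : exists m, window m x.
Proof.
exists (maxn (Num.truncn `|x.1|).+1 (Num.truncn `|x.2|).+1); split.
  by rewrite (le_trans (ltW (truncnS_gt _)))// ler_nat leq_maxl.
by rewrite (le_trans (ltW (truncnS_gt _)))// ler_nat leq_maxr.
Qed.

Lemma window_nd m n : (m <= n)%N -> window m `<=` window n.
Proof.
by move=> mn x [h1 h2]; split; [apply: le_trans h1 _|apply: le_trans h2 _]; rewrite ler_nat.
Qed.
End window.

Section laplace_functional.
Context {d : measure_display} {Omega : measurableType d} {R : realType}.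
Variables (P : probability Omega R) (lambda : R) (X : nat -> {RV P >-> (R * R)%type}).
Hypotheses (lambda_ge0 : (0 <= lambda)%R) (Phi_poisson : homogeneous_poisson lambda X).

Definition points (w : Omega) : nat -> R * R := fun l => X l w.

Lemma measurable_count A : measurable A ->
  measurable_fun setT (fun w => ncount R (points w) A : \bar R).
Proof. by move=> mA; apply: (@measurable_ncount _ _ _ _ R (fun l => X l)). Qed.

Lemma count_distribution A k : measurable A -> mu2 R A < +oo ->
  P (hits (fun w => ncount R (points w) A) k) =
  poisson_prob (lambda * fine (mu2 R A)) 0 [set k].
Proof.
move=> mA fA; have fA' : leb2 A < +oo by rewrite leb2E.
have := @Phi_poisson 1%N (fun=> A) (fun=> k) (fun=> mA) (fun=> fA').
rewrite big_ord1 leb2E// => <-; last by move=> i j _ _ _; rewrite !ord1.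
congr (P _); apply/seteqP; split => w /=; first by move=> h _.
by move/(_ ord0).
Qed.

Definition locally_finite : set Omega :=
  \bigcap_m [set w | ncount R (points w) (window m) < +oo].

Lemma measurable_finite_count A : measurable A ->
  measurable [set w | ncount R (points w) A < +oo].
Proof.
move=> mA; rewrite -[X in measurable X]setTI.
by apply: emeasurable_fun_infty_o => //; exact: measurable_count.
Qed.

Lemma measurable_locally_finite : measurable locally_finite.
Proof.
apply: bigcap_measurable; first by exists 0%N.
by move=> m _; apply: measurable_finite_count; exact: measurable_window.
Qed.

Lemma fine_rate_ge0 A : (0 <= lambda * fine (mu2 R A))%R.
Proof. by rewrite mulr_ge0// fine_ge0. Qed.

Lemma finite_count_as A : measurable A -> mu2 R A < +oo ->
  P [set w | ncount R (points w) A < +oo] = 1.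
Proof.
move=> mA fA; apply/eqP; rewrite eq_le probability_le1/=; last exact: measurable_finite_count.
pose H := hits (fun w => ncount R (points w) A).
have mH k : measurable (H k) by apply: measurable_hits; exact: measurable_count.
have <- : P (\bigcup_k H k) = 1.
  rewrite measure_semi_bigcup//=; last 2 first.
  - move=> i j _ _ [w [Hi Hj]]; apply/eqP.
    by rewrite -(@eqr_nat R) -eqe -(Hi : _ = _) -(Hj : _ = _).
  - by apply: bigcup_measurable.
  rewrite (eq_eseriesr (fun k _ => count_distribution k mA fA)).
  have := poisson_generating_function (fine_rate_ge0 A) (ler01 : 0 <= 1 :> R)%R.
  by rewrite subrr mulr0 oppr0 expR0 => <-; apply: eq_eseriesr => k _; rewrite expr1n mul1e.
apply: le_measure; rewrite ?inE//; first exact: bigcup_measurable.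
  exact: measurable_finite_count.
by move=> w [k _ /= ->]; rewrite ltry.
Qed.

(** A Poisson variable is finite, and countably many windows suffice. *)
Lemma locally_finite_as : P locally_finite = 1.
Proof.
have mW m := measurable_finite_count (measurable_window m).
have : P (~` locally_finite) = 0.
  rewrite setC_bigcap; apply/eqP; rewrite eq_le measure_ge0 andbT.
  apply: le_trans (measure_sigma_subadditive _ _ _ (@subset_refl _ _)) _.
  - by move=> m; apply: measurableC.
  - by apply: bigcup_measurable => m _; apply: measurableC.
  rewrite eseries0// => m _ _.
  have := probability_setC P (mW m).
  by rewrite finite_count_as ?subee//; [exact: measurable_window|exact: mu2_window].
move=> h; rewrite -[LHS](@adde0 _) -h -measureU//.
- by rewrite setUv; exact: probability_setT.
- exact: measurable_locally_finite.
- by apply: measurableC; exact: measurable_locally_finite.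
- exact: setICr.
Qed.

Lemma hits_series (N : Omega -> \bar R) (f : nat -> \bar R) c w :
  (forall k, 0 <= f k) -> N w = c%:R%:E ->
  \sum_(k <oo) (f k * (\1_(hits N k) w)%:E) = f c.
Proof.
move=> f0 Nc; have g0 k : true -> 0 <= f k * (\1_(hits N k) w)%:E.
  by move=> _; rewrite mule_ge0// lee_fin.
rewrite (@nneseriesD1 _ _ c xpredT g0)//.
rewrite indicE mem_set//= mule1 eseries0 ?adde0// => k _ /= kc.
rewrite indicE memNset ?mule0// /hits/= Nc => /eqP.
by rewrite eqe eqr_nat eq_sym (negPf kc).
Qed.

Lemma integral_locally_finite (f : Omega -> \bar R) :
  measurable_fun setT f -> (forall w, 0 <= f w) ->
  \int[P]_(w in locally_finite) f w = \int[P]_w f w.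
Proof.
move=> mf f0; rewrite [RHS](@ge0_negligible_integral _ _ _ P _ (~` locally_finite))//.
- by rewrite setDE setTI setCK.
- by apply: measurableC; exact: measurable_locally_finite.
- have := probability_setC P measurable_locally_finite.
  by rewrite locally_finite_as subee.
Qed.

Import HBNNSimple.

(** A simple function is constant on finitely many disjoint level sets, on which the
counts are independent Poisson variables; the product over the points becomes a
product of powers, whose mean is given by the Poisson generating function. *)
Lemma laplace_simple (phi : {nnsfun (R * R) >-> R}) m :
  (forall x, (phi x <= 1)%R) -> (forall x, ~ window m x -> phi x = 0%R) ->
  \int[P]_(w in locally_finite) (fprod (fun x => 1 - phi x)%R (points w))%:E =
  (expR (- (lambda * fine (\int[mu2 R]_x (phi x)%:E))))%:E.
Proof.
move=> phi1 phi0.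
pose s := [seq y <- fset_set (range phi) | y != 0%R].
pose A (i : 'I_(size s)) := phi @^-1` [set s`_i]%R.
have us : uniq s by apply: filter_uniq; exact: fset_uniq.
have s_mem (i : 'I_(size s)) : s`_i%R != 0%R /\ exists x, phi x = s`_i%R.
  have : s`_i%R \in s by rewrite mem_nth.
  rewrite mem_filter in_fset_set// => /andP[-> /set_mem[x _ <-]]; split => //.
  by exists x.
have mA i : measurable (A i) by exact: measurable_sfunP.
have AW i : A i `<=` window m.
  move=> x Ax; apply: contrapT => /phi0 x0.
  by have [/eqP] := s_mem i; rewrite -(Ax : phi x = _) x0.
have fA i : mu2 R (A i) < +oo.
  apply: le_lt_trans (mu2_window m); apply: le_measure; rewrite ?inE//.
  exact: measurable_window.
have tA : trivIset setT A.
  move=> i j _ _ [x [Ai Aj]]; apply/val_inj/eqP.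
  have : s`_i%R == s`_j%R by apply/eqP; transitivity (phi x).
  by rewrite nth_uniq.
have s01 i : (0 <= 1 - s`_(i : 'I_(size s)))%R.
  by have [_ [x <-]] := s_mem i; rewrite subr_ge0.
have point x : (1 - phi x = \prod_(i < size s) (1 - s`_i) ^+ (`[< A i x >] : nat))%R.
  have [x0|x0] := eqVneq (phi x) 0%R.
    rewrite x0 subr0 big1// => i _; case: asboolP => // Ai.
    by have [/eqP] := s_mem i; rewrite -(Ai : phi x = _) x0.
  have xs : phi x \in s by rewrite mem_filter x0 in_fset_set// mem_set//; exists x.
  have hi : (index (phi x) s < size s)%N by rewrite index_mem.
  rewrite (bigD1 (Ordinal hi))//= big1 ?mulr1.
    by rewrite asboolT ?expr1/= /A/= nth_index.
  move=> i ii; case: asboolP => // Ai; exfalso; move/eqP: ii; apply; apply: val_inj => /=.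
  by rewrite (Ai : phi x = _) index_uniq.
pose N i w := ncount R (points w) (A i).
transitivity (\int[P]_(w in locally_finite) \prod_(i < size s)
    \sum_(k <oo) (((1 - s`_i) ^+ k)%R%:E * (\1_(hits (N i) k) w)%:E)).
  apply: eq_integral => w /set_mem lfw.
  have [M HM] := ncount_fin_eventually_notin (lfw m I).
  have gM l : (M <= l)%N -> (1 - phi (points w l) = 1)%R.
    by move=> Ml; rewrite phi0 ?subr0//; exact: HM.
  rewrite (@fprodE _ _ (fun x => 1 - phi x)%R _ M gM).
  under eq_bigr do rewrite point.
  rewrite exchange_big/= -prodEFin; apply: eq_bigr => i _.
  rewrite -expr_sum (hits_series (c := \sum_(l < M) (`[< A i (points w l) >] : nat)))//.
    by move=> k; rewrite lee_fin exprn_ge0.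
  by rewrite /N (ncount_tail (M := M))// => l Ml /AW; exact: HM.
rewrite integral_locally_finite; last 2 first.
- apply: emeasurable_prod => // i; apply: ge0_emeasurable_sum => [k w _ _|k _].
    by rewrite mule_ge0// lee_fin// exprn_ge0.
  apply: measurable_funeM; apply/measurable_EFinP; apply: measurable_indic.
  by apply: measurable_hits; exact: measurable_count.
- move=> w; apply: prode_ge0 => i _; apply: nneseries_ge0 => k _ _.
  by rewrite mule_ge0// lee_fin// exprn_ge0.
rewrite (@expectation_of_independent_counts _ _ _ P _ N
  (fun i k => poisson_prob (lambda * fine (mu2 R (A i))) 0 [set k])
  (fun i k => ((1 - s`_i) ^+ k)%R%:E)); last 4 first.
- by move=> i; exact: measurable_count.
- by move=> i k; exact: measure_ge0.
- by move=> i k; rewrite lee_fin exprn_ge0.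
- move=> k; rewrite (Phi_poisson k mA)//; last by move=> i; rewrite leb2E//; exact: fA.
  by apply: eq_bigr => i _; rewrite leb2E//; exact: mA.
under eq_bigr => i _ do rewrite poisson_generating_function ?fine_rate_ge0// subKr.
rewrite prodEFin -expR_sum; congr (expR _)%:E.
have -> : \int[mu2 R]_x (phi x)%:E =
    \sum_(y <- fset_set (range phi)) y%:E * mu2 R (phi @^-1` [set y]).
  by rewrite integralT_nnsfun sintegralE fsbig_finite.
have -> : (\sum_(y <- fset_set (range phi)) y%:E * mu2 R (phi @^-1` [set y]))%E =
    (\sum_(i < size s) (s`_i * fine (mu2 R (A i))))%R%:E.
  transitivity (\sum_(y <- s) y%:E * mu2 R (phi @^-1` [set y]))%E.
    rewrite big_filter [RHS]big_mkcond/=; apply: eq_bigr => y _.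
    by case: eqP => // ->; rewrite mul0e.
  rewrite (big_nth 0%R) big_mkord -sumEFin; apply: eq_bigr => i _.
  by rewrite EFinM fineK// ge0_fin_numE//; exact: fA.
rewrite /= mulr_sumr -sumrN; apply: eq_bigr => i _.
by rewrite -mulrA [(_ * s`_i)%R]mulrC.
Qed.

Lemma locally_finite_tail w m : locally_finite w ->
  exists M, forall l, (M <= l)%N -> ~ window m (points w l).
Proof. by move=> lfw; apply: ncount_fin_eventually_notin; exact: (lfw m I). Qed.

Lemma cvg_prod_ord (a_ : nat -> nat -> R) (a : nat -> R) M :
  (forall l, a_ n l @[n --> \oo] --> a l) ->
  (\prod_(l < M) a_ n l)%R @[n --> \oo] --> (\prod_(l < M) a l)%R.
Proof.
move=> h; elim: M => [|M IH].
  under eq_fun do rewrite big_ord0.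
  by rewrite big_ord0; exact: cvg_cst.
under eq_fun do rewrite big_ord_recr/=.
by rewrite big_ord_recr/=; apply: cvgM.
Qed.

(** On a locally finite configuration the products have a fixed finite number of
factors different from 1, so pointwise convergence passes through them. *)
Lemma cvg_fprod (g_ : nat -> R * R -> R) (g : R * R -> R) m w :
  locally_finite w ->
  (forall n x, ~ window m x -> g_ n x = 1%R) -> (forall x, ~ window m x -> g x = 1%R) ->
  (forall x, g_ n x @[n --> \oo] --> g x) ->
  fprod (g_ n) (points w) @[n --> \oo] --> fprod g (points w).
Proof.
move=> lfw gn1 g1 gng; have [M HM] := locally_finite_tail m lfw.
rewrite (@fprodE _ _ g _ M); last by move=> l Ml; apply: g1; exact: HM.
rewrite [X in X @ _](_ : _ = fun n => (\prod_(l < M) g_ n (points w l))%R).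
  by apply: (@cvg_prod_ord (fun n l => g_ n (points w l)) (fun l => g (points w l))) => l.
apply/funext => n; rewrite (@fprodE _ _ (g_ n) _ M)// => l Ml.
by apply: gn1; exact: HM.
Qed.

(** The Laplace functional of the Poisson process for a test function supported in a
window, from simple functions by dominated convergence. *)
Theorem laplace_points (phi : R * R -> R) m : measurable_fun setT phi ->
  (forall x, (0 <= phi x <= 1)%R) -> (forall x, ~ window m x -> phi x = 0%R) ->
  \int[P]_(w in locally_finite) (fprod (fun x => 1 - phi x)%R (points w))%:E =
  (expR (- (lambda * fine (\int[mu2 R]_x (phi x)%:E))))%:E.
Proof.
move=> mphi phi01 phi0.
have mphi' : measurable_fun setT (EFin \o phi) by exact/measurable_EFinP.
have phi_ge0 x : (0 <= phi x)%R by have /andP[] := phi01 x.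
pose f_ n := nnsfun_approx measurableT mphi' n.
have f_cvg x : f_ n x @[n --> \oo] --> phi x.
  apply: (@fine_cvg _ _ _ _ (fun n => (f_ n x)%:E)).
  by apply: cvg_nnsfun_approx => // y _; rewrite lee_fin.
have f_le n x : (f_ n x <= phi x)%R.
  rewrite /f_ nnsfun_approxE -lee_fin.
  by apply: (@le_approx _ _ _ setT (EFin \o phi)) => // y _; rewrite lee_fin.
have f_le1 n x : (f_ n x <= 1)%R.
  by rewrite (le_trans (f_le n x))//; have /andP[] := phi01 x.
have f_0 n x : ~ window m x -> f_ n x = 0%R.
  by move=> /phi0 x0; apply/eqP; rewrite eq_le -{1}x0 f_le/= fun_ge0.
have mlf := measurable_locally_finite.
have L n := laplace_simple (f_le1 n) (@f_0 n).
have int_fin : \int[mu2 R]_x (phi x)%:E \is a fin_num.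
  rewrite ge0_fin_numE; last by apply: integral_ge0 => x _; rewrite lee_fin.
  apply: le_lt_trans (mu2_window m); rewrite -[X in mu2 R X]setIT -integral_indic//; last exact: measurable_window.
  apply: ge0_le_integral => //.
  - by move=> x _; rewrite lee_fin.
  - by apply/measurable_EFinP; apply: measurable_indic; exact: measurable_window.
  - move=> x _; rewrite lee_fin indicE; case: (boolP (x \in _)) => [_|/negP xW].
      by have /andP[] := phi01 x.
    by rewrite phi0// => h; apply: xW; exact: mem_set.
have I_cvg : \int[mu2 R]_x (f_ n x)%:E @[n --> \oo] --> \int[mu2 R]_x (phi x)%:E.
  rewrite [X in _ --> X](_ : _ = \int[mu2 R]_x limn (fun n => (f_ n x)%:E)).
    apply: cvg_monotone_convergence => //.
    - by move=> n; apply/measurable_EFinP.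
    - by move=> n x _; rewrite lee_fin.
    - by move=> x _ a b ab; rewrite lee_fin; exact/lefP/nd_nnsfun_approx.
  apply: eq_integral => x _; apply/esym/cvg_lim => //.
  by apply: cvg_nnsfun_approx => // y _; rewrite lee_fin.
have g01 x : (0 <= 1 - phi x <= 1)%R by have := phi01 x; lra.
have g_01 n x : (0 <= 1 - f_ n x <= 1)%R.
  by have := f_le1 n x; have : (0 <= f_ n x)%R by []; lra.
have mfp (g : R * R -> R) : measurable_fun setT g -> (forall x, (0 <= g x <= 1)%R) ->
    measurable_fun locally_finite (fun w => (fprod g (points w))%:E).
  move=> mg gb; apply/measurable_EFinP/measurable_funTS.
  exact: (@measurable_fprod _ _ _ _ _ g (fun l => X l)).
have [] := @dominated_convergence _ _ _ P locally_finite mlf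
  (fun n w => (fprod (fun x => 1 - f_ n x)%R (points w))%:E)
  (fun w => (fprod (fun x => 1 - phi x)%R (points w))%:E)
  (cst 1).
- by move=> n; apply: mfp => //; apply: measurable_funB.
- by apply: mfp => //; apply: measurable_funB.
- apply: aeW => w lfw; apply: cvg_EFin; first exact: nearW.
  apply: (cvg_fprod lfw) => [n x xW|x xW|x].
  + by have -> : f_ n x = 0%R := @f_0 n x xW; exact: subr0.
  + by rewrite (phi0 x xW); exact: subr0.
  + by apply: cvgB => //; exact: cvg_cst.
- apply: (@integrableS _ _ _ P setT) => //; exact: (finite_measure_integrable_cst P 1%R).
- apply: aeW => w n _; rewrite lee_fin.
  by have /andP[? ?] := fprod_itv (points w) (g_01 n); rewrite ger0_norm.
move=> _ _ cvgL.
apply: (cvg_unique _ cvgL) => //.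
rewrite [X in X @ _](_ : _ = fun n => (expR (- (lambda * fine (\int[mu2 R]_x (f_ n x)%:E))))%:E).
  apply: cvg_EFin; first exact: nearW.
  have c1 : fine (\int[mu2 R]_x (f_ n x)%:E) @[n --> \oo] --> fine (\int[mu2 R]_x (phi x)%:E).
    by apply: (@fine_cvg _ _ _ _ (fun n => \int[mu2 R]_x (f_ n x)%:E)); rewrite fineK.
  apply: (@continuous_cvg _ _ _ _ _ _ expR); first exact: continuous_expR.
  by apply: cvgN; apply: cvgM => //; exact: cvg_cst.
by apply/funext => n; exact: L.
Qed.
End laplace_functional.

Local Close Scope ereal_scope.

(** * Independent marking by the angles *)

Section marking.
Context {d : measure_display} {Omega : measurableType d} {R : realType}.
Variables (P : probability Omega R) (X : nat -> {RV P >-> (R * R)%type})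
  (Theta : nat -> {RV P >-> R}).
Hypotheses (Theta_uniform : forall i, uniform_angle (Theta i))
  (Theta_indep : mutually_independent Theta)
  (X_Theta_indep : independent_families X Theta).

(** The cylinder events which do not look at the l-th angle.  They form a pi-system, and
the sigma-algebra they generate is independent of that angle. *)
Definition other_cylinders (l : nat) : set (set Omega) :=
  [set S | exists (n : nat) (B : nat -> set (R * R)) (C : nat -> set R),
    [/\ forall i, measurable (B i), forall i, measurable (C i),
        forall i, (n <= i)%N -> B i = setT /\ C i = setT &
        S = [set w | forall i, B i (X i w) /\ (i <> l -> C i (Theta i w))]]].

Lemma other_cylinders_setI l : setI_closed (other_cylinders l).
Proof.
move=> _ _ [n1 [B1 [C1 [mB1 mC1 h1 ->]]]] [n2 [B2 [C2 [mB2 mC2 h2 ->]]]].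
exists (maxn n1 n2), (fun i => B1 i `&` B2 i), (fun i => C1 i `&` C2 i); split.
- by move=> i; exact: measurableI.
- by move=> i; exact: measurableI.
- move=> i; rewrite geq_max => /andP[/h1[-> ->] /h2[-> ->]].
  by rewrite !setIT.
- apply/seteqP; split => w /=.
    move=> [H1 H2] i; have [? h] := H1 i; have [? h'] := H2 i; split => //.
    by move=> il; split; [exact: h|exact: h'].
  move=> H; split => i; have [[? ?] h] := H i; split => // /h[]//.
Qed.

Lemma other_cylinders_setT l : other_cylinders l setT.
Proof.
exists 0%N, (fun=> setT), (fun=> setT); split => //.
by apply/seteqP; split.
Qed.

Lemma cylinder_probability n (B : nat -> set (R * R)) (C : nat -> set R) :
  (forall i, measurable (B i)) -> (forall i, measurable (C i)) ->
  (forall i, (n <= i)%N -> B i = setT /\ C i = setT) ->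
  P [set w | forall i, B i (X i w) /\ C i (Theta i w)] =
  (P (\bigcap_(i in [set` [fset i | i in iota 0 n]%fset]) (X i @^-1` B i)) *
   \prod_(i <- [fset i | i in iota 0 n]%fset) P (Theta i @^-1` C i))%E.
Proof.
move=> mB mC h; set J := [fset i | i in iota 0 n]%fset.
rewrite -(Theta_indep J mC) -(X_Theta_indep J J mB mC); congr (P _).
apply/seteqP; split => w /=.
  by move=> H; split => i _; have [] := H i.
move=> [H1 H2] i; have [ni|ni] := leqP n i; first by have [-> ->] := h i ni.
have iJ : i \in J by rewrite !inE mem_iota.
by split; [exact: H1|exact: H2].
Qed.

Lemma unif_Theta l D : measurable D -> P (Theta l @^-1` D) = unifR R D.
Proof. by move=> mD; rewrite unifRE; exact: (Theta_uniform l mD). Qed.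

Lemma measurable_other_cylinders l : other_cylinders l `<=` measurable.
Proof.
move=> _ [n [B [C [mB mC h ->]]]].
rewrite (_ : [set _ | _] = \bigcap_i ((X i @^-1` B i) `&`
    (if i == l then setT else Theta i @^-1` C i))); last first.
  apply/seteqP; split => w /=.
    move=> H i _ /=; have [? h'] := H i; split => //.
    by case: eqP.
  move=> H i; have [? /=] := H i I; case: eqP => //.
apply: bigcap_measurable; first by exists 0%N.
move=> i _; apply: measurableI; first exact: measurable_sfunP.
by case: ifP => // _; exact: measurable_sfunP.
Qed.

(** Both sides are finite measures in S that agree on the pi-system of cylinders. *)
Lemma mark_independent l S D : <<s other_cylinders l >> S -> measurable D ->
  P (S `&` Theta l @^-1` D) = (P S * unifR R D)%E.
Proof.
move=> GS mD.
have mT : measurable (Theta l @^-1` D) by exact: measurable_sfunP.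
have u0 : 0 <= fine (unifR R D) by rewrite fine_ge0.
pose m1 := mrestr P mT.
pose m2 := mscale (NngNum u0) P.
have uE : unifR R D = (fine (unifR R D))%:E.
  by rewrite fineK// fin_num_measure.
suff : m1 S = m2 S by rewrite /m1 /m2 /mrestr /mscale /= muleC [in X in _ -> X]uE.
apply: (@g_sigma_algebra_measure_unique _ R Omega (other_cylinders l)
  (@measurable_other_cylinders l) (fun=> setT)) => //.
- by move=> _; exact: other_cylinders_setT.
- by rewrite bigcup_const//; exists 0%N.
- exact: other_cylinders_setI.
- move=> _ [n [B [C [mB mC h ->]]]].
  pose N := maxn n l.+1.
  pose C' D' i := if i == l then D' else C i.
  have cyl D' : measurable D' ->
      P ([set w | forall i, B i (X i w) /\ (i <> l -> C i (Theta i w))] `&`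
         Theta l @^-1` D') =
      (P (\bigcap_(i in [set` [fset i | i in iota 0 N]%fset]) (X i @^-1` B i)) *
       (unifR R D' * \prod_(i <- ([fset i | i in iota 0 N] `\ l)%fset) P (Theta i @^-1` C i)))%E.
    move=> mD'; have lN : l \in [fset i | i in iota 0 N]%fset.
      by rewrite !inE mem_iota /= add0n leq_maxr.
    rewrite (_ : _ `&` _ = [set w | forall i, B i (X i w) /\ C' D' i (Theta i w)]).
      rewrite (@cylinder_probability N)//.
      + rewrite (big_fsetD1 l lN)/=; congr (_ * (_ * _))%E.
          by rewrite /C' eqxx unif_Theta.
        rewrite [LHS]big_seq [RHS]big_seq.
        by apply: eq_bigr => i; rewrite !inE /C' => /andP[/negPf ->].
      + by move=> i; rewrite /C'; case: ifP.
      + move=> i; rewrite geq_max => /andP[/h[-> CT] li]; split => //.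
        by rewrite /C' gtn_eqF.
    apply/seteqP; split => w /=.
      move=> [H1 H2] i; have [? h'] := H1 i; split => //; rewrite /C'.
      by case: eqP => [->|].
    move=> H1; split => [i|]; last by have [_] := H1 l; rewrite /C' eqxx.
    by have [? h'] := H1 i; split => // /eqP/negPf il; move: h'; rewrite /C' il.
  have c2 := cyl setT measurableT.
  rewrite preimage_setT setIT (_ : unifR R setT = 1%E) ?mul1e in c2; last exact: probability_setT.
  apply: (etrans (cyl D mD)); apply/esym; apply: (etrans (congr1 (mule _) c2)).
  by rewrite /= -uE muleCA.
- by move=> k; rewrite /m1/= /mrestr setTI ltey_eq fin_num_measure.
Qed.

(** The sample space with the sigma-algebra generated by all the points and by all the
angles except the l-th one. *)
Definition other_algebra l := g_sigma_algebraType (other_cylinders l).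

Lemma measurable_other_X l i : measurable_fun setT (X i : other_algebra l -> R * R).
Proof.
move=> _ B mB; rewrite setTI; apply: sub_sigma_algebra.
exists i.+1, (fun j => if j == i then B else setT), (fun=> setT); split => //.
- by move=> j; case: ifP.
- by move=> j ij; rewrite gtn_eqF.
- apply/seteqP; split => w /=; first by move=> Bw j; split => //; case: eqP => [->|].
  by move=> /(_ i)[]; rewrite eqxx.
Qed.

Lemma measurable_other_Theta l i : i != l ->
  measurable_fun setT (Theta i : other_algebra l -> R).
Proof.
move=> il _ B mB; rewrite setTI; apply: sub_sigma_algebra.
exists i.+1, (fun=> setT), (fun j => if j == i then B else setT); split => //.
- by move=> j; case: ifP.
- by move=> j ij; rewrite gtn_eqF.
- apply/seteqP; split => w /=; first by move=> Bw j; split => // _; case: eqP => [->|].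
  by move=> /(_ i)[_]; rewrite eqxx; apply; exact/eqP.
Qed.

(** Since the l-th angle is independent of everything else, the joint law of
(everything else, l-th angle) is a product and the angle can be integrated out
first. *)
Lemma average_mark l (f : other_algebra l * R -> \bar R) :
  measurable_fun setT f -> (forall x, (0 <= f x)%E) ->
  (\int[P]_w f (w, Theta l w) = \int[P]_w \int[unifR R]_t f (w, t))%E.
Proof.
move=> mf f0.
pose idl := (id : Omega -> other_algebra l).
have midl : measurable_fun setT idl.
  move=> _ A mA; rewrite setTI.
  apply: (smallest_sub _ (@measurable_other_cylinders l)) mA.
  exact: sigma_algebra_measurable.
pose Y : {RV P >-> other_algebra l} := HB.pack idl (isMeasurableFun.Build _ _ _ _ idl midl).
have mW : measurable_fun setT (fun w => (idl w, Theta l w)).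
  exact: measurable_fun_pair.
pose W : {RV P >-> (other_algebra l * R)%type} :=
  HB.pack (fun w => (idl w, Theta l w)) (isMeasurableFun.Build _ _ _ _ _ mW).
transitivity (\int[distribution P W]_x f x)%E.
  by rewrite ge0_integral_pushforward// => x _; exact: f0.
transitivity (\int[(distribution P Y \x unifR R)%E]_x f x)%E.
  apply: eq_measure_integral => A mA _; apply/esym.
  apply: product_measure_unique => // B D mB mD.
  exact: (mark_independent mB mD).
rewrite fubini_tonelli1// /fubini_F.
rewrite ge0_integral_pushforward//.
- exact: (@measurable_fun_fubini_tonelli_F _ _ _ _ _ (unifR R)).
- by move=> x _; apply: integral_ge0.
Qed.

Definition marked (w : Omega) : nat -> R * (R * R) := fun l => (Theta l w, X l w).

Definition mark_average (g : R * (R * R) -> R) (x : R * R) : R :=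
  fine (\int[unifR R]_t (g (t, x))%:E).

Section averaging.
Variable g : R * (R * R) -> R.
Hypotheses (mg : measurable_fun setT g) (g01 : forall z, (0 <= g z <= 1)%R).

Let mg_x x : measurable_fun setT (fun t => (g (t, x))%:E).
Proof. by apply/measurable_EFinP; apply: measurableT_comp => //; exact: measurable_fun_pair. Qed.

Let int_g_le1 x : (\int[unifR R]_t (g (t, x))%:E <= 1)%E.
Proof.
rewrite -[leRHS](@probability_setT _ _ _ (unifR R)) -[leRHS]mul1e -integral_cst//.
apply: ge0_le_integral => //.
- by move=> t _; rewrite lee_fin; have /andP[] := g01 (t, x).
- by move=> t _; rewrite lee_fin; have /andP[] := g01 (t, x).
Qed.

Lemma mark_averageE x : (mark_average g x)%:E = (\int[unifR R]_t (g (t, x))%:E)%E.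
Proof.
rewrite fineK// ge0_fin_numE; first by rewrite (le_lt_trans (int_g_le1 x))// ltry.
by apply: integral_ge0 => t _; rewrite lee_fin; have /andP[] := g01 (t, x).
Qed.

Lemma mark_average_itv x : (0 <= mark_average g x <= 1)%R.
Proof.
rewrite -!lee_fin mark_averageE int_g_le1 andbT.
by apply: integral_ge0 => t _; rewrite lee_fin; have /andP[] := g01 (t, x).
Qed.

Lemma measurable_mark_average : measurable_fun setT (mark_average g).
Proof.
apply/measurable_EFinP.
rewrite (_ : EFin \o _ = fubini_G (unifR R) (EFin \o g)); last first.
  by apply/funext => x /=; rewrite mark_averageE.
apply: (@measurable_fun_fubini_tonelli_G _ _ _ _ _ (unifR R)).
  exact/measurable_EFinP.
by move=> z; rewrite lee_fin; have /andP[] := g01 z.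
Qed.

(** The angles are averaged one after the other: in the k-th stage the first k factors
are already averages, and the k-th angle occurs in a single factor. *)
Lemma average_marks n :
  (\int[P]_w (\prod_(l < n) g (marked w l))%:E =
   \int[P]_w (\prod_(l < n) mark_average g (points X w l))%:E)%E.
Proof.
pose F k l w := if (l < k)%N then mark_average g (X l w) else g (Theta l w, X l w).
suff claim k : (k <= n)%N ->
    (\int[P]_w (\prod_(l < n) g (marked w l))%:E =
     \int[P]_w (\prod_(l < n) F k l w)%:E)%E.
  rewrite (claim n)//; apply: eq_integral => w _; congr EFin.
  by apply: eq_bigr => l _; rewrite /F ltn_ord.
elim: k => [_|k IH kn].
  by apply: eq_integral => w _; congr EFin; apply: eq_bigr => l _; rewrite /F ltn0.
rewrite IH; last exact: ltnW.
pose H l (p : other_algebra k * R) : R :=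
  if (l < k)%N then mark_average g (X l p.1)
  else if l == k then g (p.2, X k p.1) else g (Theta l p.1, X l p.1).
have mX l : measurable_fun setT (fun p : other_algebra k * R => X l p.1).
  by apply: measurableT_comp => //; exact: measurable_other_X.
have mH l : measurable_fun setT (H l).
  rewrite /H; case: (ltnP l k) => lk.
    by apply: measurableT_comp => //; exact: measurable_mark_average.
  case: (eqVneq l k) => [_|lk'].
    by apply: (measurableT_comp mg (g := fun p : other_algebra k * R => (p.2, X k p.1))); exact: measurable_fun_pair.
  apply: (measurableT_comp mg (g := fun p : other_algebra k * R => (Theta l p.1, X l p.1))).
  apply: measurable_fun_pair => //.
  by apply: (measurableT_comp (measurable_other_Theta lk')).
have H01 l p : (0 <= H l p <= 1)%R.
  by rewrite /H; case: ifP => _; [exact: mark_average_itv|case: ifP].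
have := @average_mark k (fun p => (\prod_(l < n) H l p)%:E).
rewrite /=.
have -> : (\int[P]_w (\prod_(l < n) H l (w, Theta k w))%:E =
    \int[P]_w (\prod_(l < n) F k l w)%:E)%E.
  apply: eq_integral => w _; congr EFin; apply: eq_bigr => l _; rewrite /H /F /=.
  by case: ifP => // _; case: eqP => [->|].
move=> ->; last 2 first.
- by apply/measurable_EFinP; exact: measurable_prod.
- by move=> p; rewrite lee_fin prodr_ge0// => l _; have /andP[] := H01 l p.
apply: eq_integral => w _.
have knP : (k < n)%N by [].
under eq_integral do rewrite (bigD1 (Ordinal knP))//= mulrC EFinM.
rewrite [in RHS](bigD1 (Ordinal knP))//= {1}/F ltnSn.
transitivity (\int[unifR R]_t
   ((\prod_(i < n | i != Ordinal knP) F k.+1 i w)%:E * (g (t, X k w))%:E))%E.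
  apply: eq_integral => t _; congr (_%:E * _%:E)%E.
    apply: eq_bigr => i ik; have nk : (i : nat) != k.
      by apply: contra ik => /eqP ik; apply/eqP/val_inj.
    by rewrite /H /F /= (negPf nk) ltnS [in RHS]leq_eqVlt (negPf nk).
  by rewrite /H ltnn eqxx.
rewrite ge0_integralZl//; last 2 first.
- by move=> t _; rewrite lee_fin; have /andP[] := g01 (t, X k w).
- rewrite lee_fin prodr_ge0// => i _; rewrite /F; case: ifP => _.
    by have /andP[] := mark_average_itv (X i w).
  by have /andP[] := g01 (Theta i w, X i w).
by rewrite -mark_averageE -EFinM mulrC.
Qed.

Lemma average_fprod :
  (\int[P]_w (fprod g (marked w))%:E =
   \int[P]_w (fprod (mark_average g) (points X w))%:E)%E.
Proof.
have mZ l : measurable_fun setT (marked ^~ l) by exact: measurable_fun_pair.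
have key (T' : measurableType _) (h : T' -> R) (Z : nat -> Omega -> T') :
    (forall l, measurable_fun setT (Z l)) -> measurable_fun setT h ->
    (forall x, (0 <= h x <= 1)%R) ->
    (\int[P]_w (\prod_(l < n) h (Z l w))%:E @[n --> \oo] -->
     \int[P]_w (fprod h (Z ^~ w))%:E)%E.
  move=> mZ' mh h01.
  have [] := @dominated_convergence _ _ _ P setT measurableT
    (fun n w => (\prod_(l < n) h (Z l w))%:E) (fun w => (fprod h (Z ^~ w))%:E)
    (cst 1%E).
  - by move=> n; apply/measurable_EFinP; apply: measurable_prod => i _; exact: measurableT_comp.
  - by apply/measurable_EFinP; exact: measurable_fprod.
  - apply: aeW => w _; apply: cvg_EFin; first exact: nearW.
    exact: (@is_cvg_prod _ _ h (Z ^~ w)).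
  - exact: (finite_measure_integrable_cst P 1%R).
  - apply: aeW => w n _; rewrite lee_fin.
    by have /andP[? ?] := prod_itv (Z ^~ w) n h01; rewrite ger0_norm.
  by move=> _ _ /=.
have mX l : measurable_fun setT (X l) by [].
have c1 := key _ _ g (fun l w => marked w l) mZ mg g01.
have c2 := key _ _ (mark_average g) (fun l => X l) mX measurable_mark_average mark_average_itv.
apply: (cvg_unique _ c1) => //.
rewrite (_ : (fun n => _) = (fun n => \int[P]_w (\prod_(l < n) mark_average g (points X w l))%:E)%E)//.
by apply/funext => n; exact: average_marks.
Qed.

End averaging.

Lemma mark_average_onem (g : R * (R * R) -> R) x :
  measurable_fun setT g -> (forall z, (0 <= g z <= 1)%R) ->
  mark_average (fun z => 1 - g z) x = 1 - mark_average g x.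
Proof.
move=> mg g01.
have mg' : measurable_fun setT (fun z => 1 - g z) by exact: measurable_funB.
have g01' z : (0 <= 1 - g z <= 1)%R by have := g01 z; lra.
have g0 z : (0 <= g z)%R by have /andP[] := g01 z.
have g1 z : (0 <= 1 - g z)%R by have /andP[] := g01 z; rewrite subr_ge0.
apply: EFin_inj; rewrite EFinB (mark_averageE mg g01) (mark_averageE mg' g01').
have -> : 1%:E = (\int[unifR R]_t (cst 1%E t))%E.
  by rewrite integral_cst// mul1e; exact/esym/unifR_T.
have -> : (\int[unifR R]_t (cst 1%E t) =
    \int[unifR R]_t (1 - g (t, x))%:E + \int[unifR R]_t (g (t, x))%:E)%E.
  rewrite -ge0_integralD//.
  - by apply: eq_integral => t _; rewrite -EFinD subrK.
  - by move=> t _; rewrite lee_fin.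
  - by apply/measurable_EFinP/measurable_funB => //; apply: measurableT_comp => //; exact: measurable_fun_pair.
  - by move=> t _; rewrite lee_fin.
- by apply/measurable_EFinP; apply: measurableT_comp => //; exact: measurable_fun_pair.
by rewrite -(mark_averageE mg g01) addeK.
Qed.

Lemma integral_mark_average (g : R * (R * R) -> R) :
  measurable_fun setT g -> (forall z, (0 <= g z <= 1)%R) ->
  (\int[mu2 R]_x (mark_average g x)%:E = \int[muZ R]_z (g z)%:E)%E.
Proof.
move=> mg g01.
rewrite integral_muZ; last 2 first.
- exact/measurable_EFinP.
- by move=> z; rewrite lee_fin; have /andP[] := g01 z.
by apply: eq_integral => x _; rewrite mark_averageE.
Qed.

Variables (lambda : R).
Hypotheses (lambda_ge0 : 0 <= lambda) (Phi_poisson : homogeneous_poisson lambda X).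

(** Averaging the angles replaces g by its mean over the angle, so that the Laplace
functional of the points gives that of the marked process: the marks are Poisson with
intensity lambda times [muZ]. *)
Theorem laplace_marked (g : R * (R * R) -> R) m :
  measurable_fun setT g -> (forall z, (0 <= g z <= 1)%R) ->
  (forall z, ~ window m z.2 -> g z = 1) ->
  (\int[P]_(w in locally_finite X) (fprod g (marked w))%:E =
   (expR (- (lambda * fine (\int[muZ R]_z (1 - g z)%:E))))%:E)%E.
Proof.
move=> mg g01 gW.
have mZ l : measurable_fun setT (marked ^~ l) by exact: measurable_fun_pair.
have mavg := measurable_mark_average mg g01.
have avg01 := mark_average_itv mg g01.
rewrite (integral_locally_finite lambda_ge0 Phi_poisson); last 2 first.
- by apply/measurable_EFinP; exact: (@measurable_fprod _ _ _ _ _ g (fun l w => marked w l)).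
- by move=> w; rewrite lee_fin; have /andP[] := fprod_itv (marked w) g01.
rewrite average_fprod// -(integral_locally_finite lambda_ge0 Phi_poisson); last 2 first.
- by apply/measurable_EFinP; exact: (@measurable_fprod _ _ _ _ _ (mark_average g) (fun l => X l)).
- by move=> w; rewrite lee_fin; have /andP[] := fprod_itv (points X w) avg01.
have <- := integral_mark_average (g := fun z => 1 - g z).
rewrite (_ : mark_average g = fun x => 1 - (1 - mark_average g x)); last first.
  by apply/funext => x; rewrite subKr.
rewrite (@laplace_points _ _ _ _ _ _ lambda_ge0 Phi_poisson _ m)//.
- congr (expR (- (_ * fine _)))%:E; apply: eq_integral => x _.
  by rewrite mark_average_onem.
- exact: measurable_funB.
- by move=> x; have := avg01 x; lra.
- move=> x xW; apply: EFin_inj; rewrite EFinB mark_averageE//.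
  rewrite (eq_integral (cst 1%E)); last by move=> t _; rewrite gW.
  rewrite [X in (_ - X)%E](_ : _ = 1%E) ?subee//.
  by rewrite integral_cst// mul1e; exact: unifR_T.
- exact: measurable_funB.
- by move=> z; have := g01 z; lra.
Qed.

End marking.

(** * Moments and probabilities read off a generating function *)

Lemma cvg_sum_ord (R : realType) (a_ : nat -> nat -> R) (a : nat -> R) M :
  (forall l, a_ n l @[n --> \oo] --> a l) ->
  (\sum_(l < M) a_ n l) @[n --> \oo] --> (\sum_(l < M) a l).
Proof.
move=> h; elim: M => [|M IH].
  under eq_fun do rewrite big_ord0.
  by rewrite big_ord0; exact: cvg_cst.
under eq_fun do rewrite big_ord_recr/=.
by rewrite big_ord_recr/=; apply: cvgD.
Qed.

Lemma cvg_exprn (R : realType) (u : nat -> R) (l : R) k :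
  u n @[n --> \oo] --> l -> u n ^+ k @[n --> \oo] --> l ^+ k.
Proof.
move=> h; elim: k => [|k IH].
  under eq_fun do rewrite expr0.
  by rewrite expr0; exact: cvg_cst.
by under eq_fun do rewrite exprS; rewrite exprS; apply: cvgM.
Qed.

(** Derivatives at 0 along the sequence 1/(n+1), the form used with the convergence theorems
for integrals. *)
Lemma cvg_difference_quotient (R : realType) (f : R -> R) (L : R) :
  is_derive (0 : R) (1 : R) f L ->
  (f (n.+1%:R^-1) - f 0) / n.+1%:R^-1 @[n --> \oo] --> L.
Proof.
move=> [df dL].
have /= c : h^-1 *: (f (h *: (1:R) + 0) - f 0) @[h --> 0^'] --> L.
  by rewrite -dL; exact: df.
have e : (n.+1%:R^-1 : R) @[n --> \oo] --> (0 : R)^'.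
  move=> A /=; rewrite /dnbhs /within /= => A0.
  have : (n.+1%:R^-1 : R) @[n --> \oo] --> (0 : R) by exact: cvg_harmonic.
  move=> /(_ _ A0) H; rewrite /nbhs/= in H *.
  apply: filterS H => n /=; apply.
  by rewrite invr_eq0 pnatr_eq0.
have := cvg_comp _ _ e c.
rewrite (_ : _ \o _ = (fun n => (f (n.+1%:R^-1) - f 0) / n.+1%:R^-1))//.
by apply/funext => n /=; rewrite /GRing.scale/= mulr1 addr0 mulrC.
Qed.

Section generating_functions.
Context {d : measure_display} {Omega : measurableType d} {R : realType}.
Variables (P : {measure set Omega -> \bar R}) (D : set Omega).
Hypothesis mD : measurable D.
Variables (Y : Omega -> R) (N : Omega -> nat).
Hypotheses (Y0 : forall w, 0 <= Y w) (mY : measurable_fun D Y)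
  (mN : measurable_fun D (fun w => (N w)%:R : R)).

Let eps (n : nat) : R := n.+1%:R^-1.

Lemma eps_itv n : 0 < eps n <= 1.
Proof. by rewrite /eps invr_gt0 ltr0n/= invf_le1 ?ltr0n// ler1n. Qed.

Lemma measurable_expn_count (x : R) : measurable_fun D (fun w => x ^+ N w).
Proof.
have mk k : measurable (D `&` [set w | N w = k]).
  have -> : D `&` [set w | N w = k] = D `&` (fun w => (N w)%:R : R) @^-1` [set k%:R].
    by apply/seteqP; split => w /= [? h]; split => //; [rewrite h|apply/eqP; rewrite -(@eqr_nat R); apply/eqP].
  exact: mN.
move=> _ B mB.
rewrite (_ : _ `&` _ = \bigcup_(k in [set k | B (x ^+ k)]) (D `&` [set w | N w = k])).
  by apply: bigcup_measurable => k _; exact: mk.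
apply/seteqP; split => w /=.
  by move=> [Dw Bw]; exists (N w).
by move=> [k Bk [Dw /= Nk]]; split => //; rewrite Nk.
Qed.

(** E[Y N] is minus the derivative at e = 0 of E[Y (1 - e)^N].  The quotients
(1 - (1 - e)^N) / e are the geometric sums of the powers of 1 - e, which increase
to N as e decreases to 0, so monotone convergence applies even when it is not known
in advance that Y N is integrable. *)
Lemma mean_of_generating_function (f : R -> R) (L : R) :
  (forall e, 0 <= e <= 1 -> (\int[P]_(w in D) (Y w * (1 - e) ^+ N w)%:E = (f e)%:E)%E) ->
  is_derive (0 : R) (1 : R) f (- L) ->
  (\int[P]_(w in D) (Y w * (N w)%:R)%:E = L%:E)%E.
Proof.
move=> fE /cvg_difference_quotient fd.
have fL : (f 0 - f (eps n)) / eps n @[n --> \oo] --> L.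
  rewrite (_ : (fun n => _) = (fun n => - ((f (eps n) - f 0) / eps n))).
    by rewrite -[X in _ --> X]opprK; exact: cvgN.
  by apply/funext => n; rewrite -mulNr opprB.
pose q n w := \sum_(k < N w) (1 - eps n) ^+ k.
have e01 n : 0 <= 1 - eps n <= 1 by have := eps_itv n; lra.
have qE n w : eps n * q n w = 1 - (1 - eps n) ^+ N w.
  have := subrX1 (1 - eps n) (N w); rewrite /q => h.
  by rewrite -[RHS]opprB h addrAC subrr add0r mulNr opprK.
have q0 n w : 0 <= q n w by apply: sumr_ge0 => k _; rewrite exprn_ge0//; have /andP[] := e01 n.
have en0 n : eps n != 0 by rewrite gt_eqF//; have /andP[] := eps_itv n.
have mq n : measurable_fun D (q n).
  have -> : q n = fun w => (1 - (1 - eps n) ^+ N w) / eps n.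
    by apply/funext => w; rewrite -qE mulrAC divff// mul1r.
  by apply: measurable_funM => //; apply: measurable_funB => //; exact: measurable_expn_count.
have int_q n : (\int[P]_(w in D) (Y w * q n w)%:E = ((f 0 - f (eps n)) / eps n)%:E)%E.
  have H0 := fE 0; rewrite lexx ler01 in H0; have {}H0 := H0 isT.
  have H1 := fE (eps n); rewrite (ltW (andP (eps_itv n)).1) (andP (eps_itv n)).2 in H1.
  have {}H1 := H1 isT.
  have : (\int[P]_(w in D) (Y w * (1 - 0) ^+ N w)%:E =
      \int[P]_(w in D) (Y w * (1 - eps n) ^+ N w)%:E +
      \int[P]_(w in D) ((eps n)%:E * (Y w * q n w)%:E))%E.
    rewrite -ge0_integralD//.
    - apply: eq_integral => w _; rewrite -EFinM -EFinD subr0 expr1n; congr EFin.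
      by rewrite mulrCA qE; ring.
    - by move=> w _; rewrite lee_fin mulr_ge0// exprn_ge0//; have /andP[] := e01 n.
    - by apply/measurable_EFinP/measurable_funM => //; exact: measurable_expn_count.
    - by move=> w _; rewrite -EFinM lee_fin !mulr_ge0//; have /andP[/ltW] := eps_itv n.
    - by apply: measurable_funeM; apply/measurable_EFinP/measurable_funM.
  rewrite H0 H1 ge0_integralZl//; last 3 first.
  - by apply/measurable_EFinP/measurable_funM.
  - by move=> w _; rewrite lee_fin mulr_ge0.
  - by rewrite lee_fin; have /andP[/ltW] := eps_itv n.
  move=> h; have I0 : (0 <= \int[P]_(w in D) (Y w * q n w)%:E)%E.
    by apply: integral_ge0 => w _; rewrite lee_fin mulr_ge0.
  move: h I0; case: (\int[P]_(w in D) (Y w * q n w)%:E)%E => [r| |]//.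
  - by rewrite -EFinM -EFinD => -[->] _; congr EFin; rewrite addrAC subrr add0r mulrAC divff// mul1r.
  - by rewrite gt0_muley// lte_fin; have /andP[] := eps_itv n.
have eps_cvg : eps n @[n --> \oo] --> 0 by exact: cvg_harmonic.
have q_cvg w : q n w @[n --> \oo] --> ((N w)%:R : R).
  rewrite /q -[X in _ --> X](_ : \sum_(k < N w) (1 - 0) ^+ k = _); last first.
    by under eq_bigr do rewrite subr0 expr1n; rewrite sumr_const card_ord.
  apply: (@cvg_sum_ord _ (fun n k => (1 - eps n) ^+ k) (fun k => (1 - 0) ^+ k)) => k.
  by apply: cvg_exprn; apply: cvgB => //; exact: cvg_cst.
have := @cvg_monotone_convergence _ _ _ P D mD (fun n w => (Y w * q n w)%:E).
move=> /(_ _ _ _)-c.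
have {}c : (\int[P]_(w in D) (Y w * q n w)%:E @[n --> \oo] -->
    \int[P]_(w in D) limn (fun n => (Y w * q n w)%:E))%E.
  apply: c.
  - by move=> n; apply/measurable_EFinP/measurable_funM.
  - by move=> n w _; rewrite lee_fin mulr_ge0.
  - move=> w _ m n mn; rewrite lee_fin ler_wpM2l//; apply: ler_sum => k _.
    apply: lerXn2r; rewrite ?nnegrE; [by have /andP[] := e01 m|by have /andP[] := e01 n|].
    by rewrite lerB// /eps lef_pV2 ?posrE ?ltr0n// ler_nat.
have -> : (\int[P]_(w in D) (Y w * (N w)%:R)%:E =
    \int[P]_(w in D) limn (fun n => (Y w * q n w)%:E))%E.
  apply: eq_integral => w _; apply/esym/cvg_lim => //; apply: cvg_EFin; first exact: nearW.
  by apply: cvgM => //; exact: cvg_cst.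
apply: (cvg_unique _ c) => //.
rewrite (_ : (fun n => _) = (fun n => ((f 0 - f (eps n)) / eps n)%:E)); last exact/funext.
by apply: cvg_EFin; first exact: nearW.
Qed.

(** E[Y 1_{N = 1}] is the derivative at t = 0 of E[Y t^N]: the quotients
(t^N - 0^N) / t are bounded by 1 and converge to the indicator of N = 1. *)
Lemma coefficients_of_generating_function (A tau : R) : (P D < +oo)%E -> (forall w, Y w <= 1) ->
  (forall t, 0 <= t <= 1 ->
    (\int[P]_(w in D) (Y w * t ^+ N w)%:E = (A * expR (- (tau * (1 - t))))%:E)%E) ->
  (\int[P]_(w in D) (Y w * (N w == 1%N)%:R)%:E = (A * (tau * expR (- tau)))%:E)%E.
Proof.
move=> PD Y1 fE.
have mexp := measurable_expn_count.
pose r n w := ((eps n) ^+ N w - 0 ^+ N w) / eps n.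
have en0 n : eps n != 0 by rewrite gt_eqF//; have /andP[] := eps_itv n.
have rE n w : r n w = if N w is k.+1 then eps n ^+ k else 0.
  rewrite /r; case: (N w) => [|k]; first by rewrite !expr0 subrr mul0r.
  by rewrite expr0n subr0 exprSr mulfK.
have r01 n w : 0 <= r n w <= 1.
  rewrite rE; case: (N w) => [|k]; first by rewrite lexx ler01.
  by have /andP[/ltW ? ?] := eps_itv n; rewrite exprn_ge0//= exprn_ile1.
have r_ge0 n w : 0 <= r n w by have /andP[] := r01 n w.
have eps_cvg : eps n @[n --> \oo] --> 0 by exact: cvg_harmonic.
have r_cvg w : r n w @[n --> \oo] --> ((N w == 1%N)%:R : R).
  under eq_fun do rewrite rE.
  case: (N w) => [|[|k]]/=; try exact: cvg_cst.
  by have := @cvg_exprn R eps 0 k.+1 eps_cvg; rewrite expr0n.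
have mr n : measurable_fun D (r n).
  by apply: measurable_funM => //; apply: measurable_funB; exact: mexp.
have int1 : P.-integrable D (cst 1%E).
  apply/integrableP; split => //; under eq_integral do rewrite abse1.
  by rewrite integral_cst// mul1e.
have [] := @dominated_convergence _ _ _ P D mD (fun n w => (Y w * r n w)%:E)
  (fun w => (Y w * (N w == 1%N)%:R)%:E) (cst 1%E).
- by move=> n; apply/measurable_EFinP/measurable_funM.
- apply/measurable_EFinP/(@measurable_fun_cvg _ _ _ _ (fun n w => Y w * r n w)).
    by move=> n; exact: measurable_funM.
  by move=> w _; apply: cvgM => //; exact: cvg_cst.
- apply: aeW => w _; apply: cvg_EFin; first exact: nearW.
  by apply: cvgM => //; exact: cvg_cst.
- exact: int1.
- apply: aeW => w n _; have /andP[ra rb] := r01 n w.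
  have yr : Y w * r n w <= 1 by apply: mulr_ile1.
  have yr0 : 0 <= Y w * r n w by apply: mulr_ge0.
  by rewrite abse_EFin ger0_norm.
move=> _ _ /= c.
have intn n : (\int[P]_(w in D) (Y w * r n w)%:E =
    ((A * expR (- (tau * (1 - eps n))) - A * expR (- (tau * (1 - 0)))) / eps n)%:E)%E.
  have H0 := fE 0; rewrite lexx ler01 in H0; have {}H0 := H0 isT.
  have H1 := fE (eps n); rewrite (ltW (andP (eps_itv n)).1) (andP (eps_itv n)).2 in H1.
  have {}H1 := H1 isT.
  have e0 : 0 < eps n by have /andP[] := eps_itv n.
  have : (\int[P]_(w in D) (Y w * (eps n) ^+ N w)%:E =
      \int[P]_(w in D) (Y w * 0 ^+ N w)%:E +
      \int[P]_(w in D) ((eps n)%:E * (Y w * r n w)%:E))%E.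
    rewrite -ge0_integralD//.
    - apply: eq_integral => w _; rewrite -EFinM -EFinD; congr EFin.
      by rewrite /r; field.
    - by move=> w _; rewrite lee_fin mulr_ge0// exprn_ge0.
    - by apply/measurable_EFinP/measurable_funM => //; exact: mexp.
    - move=> w _; rewrite -EFinM lee_fin; apply: mulr_ge0; first exact: ltW.
      exact: mulr_ge0.
    - by apply: measurable_funeM; apply/measurable_EFinP/measurable_funM.
  rewrite H0 H1 ge0_integralZl//; last 3 first.
  - by apply/measurable_EFinP/measurable_funM.
  - by move=> w _; rewrite lee_fin; apply: mulr_ge0.
  - by rewrite lee_fin ltW.
  move=> h; have I0 : (0 <= \int[P]_(w in D) (Y w * r n w)%:E)%E.
    by apply: integral_ge0 => w _; rewrite lee_fin; apply: mulr_ge0.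
  move: h I0; case: (\int[P]_(w in D) (Y w * r n w)%:E)%E => [x| |]//.
  - by rewrite -EFinM -EFinD => -[->] _; congr EFin; field.
  - by rewrite gt0_muley// lte_fin.
apply: (cvg_unique _ c) => //.
rewrite [X in X @ _](_ : _ = (fun n =>
    (A * ((expR (- (tau * (1 - eps n))) - expR (- (tau * (1 - 0)))) / eps n))%:E)); last first.
  by apply/funext => n; rewrite intn; congr EFin; rewrite mulrA -mulrBr.
apply: cvg_EFin; first exact: nearW.
apply: cvgM; first exact: cvg_cst.
apply: (@cvg_difference_quotient R (fun t => expR (- (tau * (1 - t))))).
apply: trigger_derive.
by rewrite /GRing.scale/=; rewrite !subr0 !mulr1; ring.
Qed.

End generating_functions.

(** * Second factorial moments of the marked process *)

Section counting.
Context {R : realType} {T : Type}.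
Implicit Types (z : nat -> T) (C : set T).

(** The same count as a natural number, for use as an exponent; it is meaningful when
the count is finite. *)
Definition cnt z C : nat := Num.truncn (fine (ncount R z C)).

Lemma cnt_tail z C M : (forall l, (M <= l)%N -> ~ C (z l)) ->
  cnt z C = (\sum_(l < M) `[< C (z l) >])%N.
Proof. by move=> h; rewrite /cnt (ncount_tail h)/= natrK. Qed.

Lemma ncount_cnt z C M : (forall l, (M <= l)%N -> ~ C (z l)) ->
  ncount R z C = (cnt z C)%:R%:E.
Proof. by move=> h; rewrite (cnt_tail h) (ncount_tail h). Qed.

(** The number of ordered pairs of distinct indices whose points form a pair in E. *)
Definition pair_count z (E : set (T * T)) : \bar R :=
  (\sum_(i <oo) \sum_(j <oo) (if i == j then 0 else (\1_E (z i, z j))%:E))%E.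

Lemma pair_count_ge0 z E : (0 <= pair_count z E)%E.
Proof.
by apply: nneseries_ge0 => i _ _; apply: nneseries_ge0 => j _ _; case: ifP => // _; rewrite lee_fin.
Qed.

(** On rectangles the pairs of distinct indices are all the pairs but the diagonal ones. *)
Lemma pair_count_rectangle z C C' :
  (pair_count z (C `*` C') + ncount R z (C `&` C') = ncount R z C * ncount R z C')%E.
Proof.
have i0 (U : Type) (A : set U) u : (0 <= (\1_A u)%:E :> \bar R)%E by rewrite lee_fin.
rewrite /ncount muleC -ge0_nneseriesZl//; last by apply: nneseries_ge0.
rewrite /pair_count -nneseriesD//; last first.
  by move=> i _ _; apply: nneseries_ge0 => j _ _; case: ifP.
apply: eq_eseriesr => i _; rewrite muleC -ge0_nneseriesZl//.
have g0 j : true -> (0 <= (\1_C (z i))%:E * (\1_C' (z j))%:E :> \bar R)%E.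
  by move=> _; rewrite mule_ge0.
rewrite [RHS](@nneseriesD1 _ _ i xpredT g0)//.
rewrite addeC -EFinM; congr (_%:E + _)%E.
  by rewrite !indicE in_setI -natrM mulnb.
rewrite [RHS]eseries_mkcond; apply: eq_eseriesr => j _ /=.
rewrite eq_sym; case: eqVneq => //= _.
by rewrite -EFinM !indicE in_setX -natrM mulnb.
Qed.

End counting.
#[global] Opaque cnt.
Arguments cnt R {T} z C.
Arguments pair_count R {T} z E.

Section second_moment.
Context {d : measure_display} {Omega : measurableType d} {R : realType}.
Variables (P : probability Omega R) (lambda : R) (X : nat -> {RV P >-> (R * R)%type})
  (Theta : nat -> {RV P >-> R}).
Hypotheses (lambda_ge0 : 0 <= lambda) (Phi_poisson : homogeneous_poisson lambda X)
  (Theta_uniform : forall i, uniform_angle (Theta i))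
  (Theta_indep : mutually_independent Theta)
  (X_Theta_indep : independent_families X Theta).

Local Notation lf := (locally_finite X).
Local Notation mk := (marked X Theta).

(** All angles are allowed; only the initial point is localised. *)
Definition cyl m : set (R * (R * R)) := [set z | window m z.2].

Lemma measurable_cyl m : measurable (cyl m).
Proof.
rewrite (_ : cyl m = setT `*` window m); last by apply/seteqP; split => z //= [].
by apply: measurableX => //; exact: measurable_window.
Qed.

Lemma muZ_cyl m : (muZ R (cyl m) < +oo)%E.
Proof.
rewrite (_ : cyl m = setT `*` window m); last by apply/seteqP; split => z //= [].
rewrite muZX//; last exact: measurable_window.
by rewrite unifR_T mul1e mu2_window.
Qed.

Lemma muZ_fin m C : measurable C -> C `<=` cyl m -> muZ R C \is a fin_num.
Proof.
move=> mC Cm; rewrite ge0_fin_numE//; apply: le_lt_trans (muZ_cyl m).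
by apply: le_measure; rewrite ?inE//; exact: measurable_cyl.
Qed.

Lemma measurable_marked l : measurable_fun setT (fun w => mk w l).
Proof. exact: measurable_fun_pair. Qed.

Lemma measurable_lf : measurable lf. Proof. exact: measurable_locally_finite. Qed.

Lemma measurable_ncount_marked C : measurable C ->
  measurable_fun setT (fun w => ncount R (mk w) C).
Proof. by move=> mC; apply: (@measurable_ncount _ _ _ _ R (fun l w => mk w l)) => // l; exact: measurable_marked. Qed.

Lemma lf_tail w m : lf w -> exists M, forall C, C `<=` cyl m ->
  forall l, (M <= l)%N -> ~ C (mk w l).
Proof.
move=> lfw; have [M HM] := locally_finite_tail m lfw.
by exists M => C Cm l Ml /Cm; exact: HM.
Qed.

Lemma ncount_lf w m C : lf w -> C `<=` cyl m -> ncount R (mk w) C = (cnt R (mk w) C)%:R%:E.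
Proof. by move=> lfw Cm; have [M /(_ C Cm)/ncount_cnt] := lf_tail m lfw. Qed.

Lemma measurable_cnt m C : measurable C -> C `<=` cyl m ->
  measurable_fun lf (fun w => (cnt R (mk w) C)%:R : R).
Proof.
move=> mC Cm; apply/measurable_EFinP.
apply: (eq_measurable_fun (fun w => ncount R (mk w) C)).
  by move=> w /set_mem lfw; rewrite /= (ncount_lf lfw Cm).
by apply: measurable_funTS; exact: measurable_ncount_marked.
Qed.

(** Multiplying the test function by 1 - e on C inserts the factor (1 - e)^N with N the
number of points in C.  This is how generating functions of counts are read off the Laplace
functional. *)
Lemma fprod_thin w m (g : R * (R * R) -> R) C e : lf w -> C `<=` cyl m ->
  (forall z, ~ cyl m z -> g z = 1) ->
  fprod (fun z => g z * (1 - e * \1_C z)) (mk w) =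
  fprod g (mk w) * (1 - e) ^+ cnt R (mk w) C.
Proof.
move=> lfw Cm gm; have [M HM] := lf_tail m lfw.
have tail_g l : (M <= l)%N -> g (mk w l) = 1 by move=> Ml; rewrite gm//; exact: (HM (cyl m)).
rewrite (@fprodE _ _ g _ M)// (@fprodE _ _ _ _ M); last first.
  move=> l Ml; rewrite tail_g// indicE memNset ?mulr0 ?subr0 ?mulr1//.
  exact: HM.
rewrite big_split/=; congr (_ * _).
rewrite (cnt_tail (HM C Cm)) expr_sum; apply: eq_bigr => l _.
rewrite indicE; case: asboolP => Cl; first by rewrite mem_set// mulr1 expr1.
by rewrite memNset// mulr0 subr0 expr0.
Qed.

Lemma integral_supported m (f : R * (R * R) -> R) : measurable_fun setT f ->
  (forall z, 0 <= f z <= 1) -> (forall z, ~ cyl m z -> f z = 0) ->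
  (\int[muZ R]_z (f z)%:E \is a fin_num)%E.
Proof.
move=> mf f01 f0; have f_ge0 z : 0 <= f z by have /andP[] := f01 z.
rewrite ge0_fin_numE; last by apply: integral_ge0 => z _; rewrite lee_fin.
apply: le_lt_trans (muZ_cyl m); rewrite -[X in muZ R X]setIT -integral_indic//; last exact: measurable_cyl.
apply: ge0_le_integral => //.
- by move=> z _; rewrite lee_fin.
- exact/measurable_EFinP.
- by apply/measurable_EFinP; apply: measurable_indic; exact: measurable_cyl.
- move=> z _; rewrite lee_fin indicE; case: (boolP (z \in _)) => [_|/negP zW].
    by have /andP[] := f01 z.
  by rewrite f0// => h; apply: zW; exact: mem_set.
Qed.

(** S has probability p and does not depend on the points in K, expressed through the
Laplace functional of the points in K: the form in which such independence is both
established and used. *)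
Definition decoupled (S : set Omega) (K : set (R * (R * R))) (p : R) :=
  measurable S /\
  forall g : R * (R * R) -> R, measurable_fun setT g ->
    (forall z, 0 <= g z <= 1) -> (forall z, ~ K z -> g z = 1) ->
    (\int[P]_(w in lf) (\1_S w * fprod g (mk w))%:E =
     (p * expR (- (lambda * fine (\int[muZ R]_z (1 - g z)%:E))))%:E)%E.

Lemma decoupled_setT m : decoupled setT (cyl m) 1.
Proof.
split => // g mg g01 gm; rewrite mul1r.
under eq_integral do rewrite indicT mul1r.
exact: (@laplace_marked _ _ _ P X Theta Theta_uniform Theta_indep X_Theta_indep lambda lambda_ge0 Phi_poisson _ m).
Qed.

Lemma thin_itv (g : R * (R * R) -> R) (C : set (R * (R * R))) e :
  (forall z, 0 <= g z <= 1) -> 0 <= e <= 1 ->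
  forall z, 0 <= g z * (1 - e * \1_C z) <= 1.
Proof.
move=> g01 e01 z; have := g01 z; rewrite indicE; case: (z \in C) => /=; last by rewrite mulr0 subr0 mulr1.
rewrite mulr1 => /andP[g0 g1]; have /andP[e0 e1] := e01; apply/andP; split.
  by rewrite mulr_ge0// subr_ge0.
by rewrite mulr_ile1// ?subr_ge0// lerBlDr lerDl.
Qed.

Lemma measurable_thin (g : R * (R * R) -> R) (C : set (R * (R * R))) (e : R) :
  measurable_fun setT g -> measurable C ->
  measurable_fun setT (fun z => g z * (1 - e * \1_C z)).
Proof.
move=> mg mC; apply: measurable_funM => //; apply: measurable_funB => //.
by apply: measurable_funM => //; exact: measurable_indic.
Qed.

Lemma measurable_fprod_lf (g : R * (R * R) -> R) : measurable_fun setT g ->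
  (forall z, 0 <= g z <= 1) -> measurable_fun lf (fun w => fprod g (mk w)).
Proof.
move=> mg g01; apply: measurable_funTS.
by apply: (@measurable_fprod _ _ _ _ _ g (fun l w => mk w l)) => // l; exact: measurable_marked.
Qed.

(** The event of exactly one point in D does not depend on the points outside D.  Its joint
Laplace functional is the coefficient of t in the Laplace functional for the test function
equal to t on D. *)
Lemma decoupled_one_point m D : measurable D -> D `<=` cyl m ->
  let tau := lambda * fine (muZ R D) in
  decoupled [set w | ncount R (mk w) D = 1%E] (cyl m `\` D) (tau * expR (- tau)).
Proof.
move=> mD Dm tau; split.
  rewrite -[X in measurable X]setTI.
  exact: (measurable_ncount_marked mD measurableT (emeasurable_set1 1%E)).
move=> g mg g01 gK.
have gm z : ~ cyl m z -> g z = 1 by move=> zm; apply: gK => -[].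
have gD z : D z -> g z = 1 by move=> zD; apply: gK => -[].
have onem01 z : 0 <= 1 - g z <= 1 by have := g01 z; lra.
have onem0 z : ~ cyl m z -> 1 - g z = 0 by move=> /gm->; rewrite subrr.
have monem : measurable_fun setT (fun z => 1 - g z) by exact: measurable_funB.
have intfin := integral_supported monem onem01 onem0.
set A := expR (- (lambda * _)).
have := @coefficients_of_generating_function _ _ _ P lf measurable_lf
  (fun w => fprod g (mk w)) (fun w => cnt R (mk w) D) _ (measurable_fprod_lf mg g01)
  (measurable_cnt mD Dm) A tau.
rewrite [tau * _ * A]mulrC => <-.
- apply: eq_integral => w /set_mem lfw; congr EFin; rewrite mulrC; congr (_ * _).
  rewrite indicE; congr (nat_of_bool _)%:R; apply/idP/eqP => [/set_mem/=|h].
    by rewrite (ncount_lf lfw Dm) => -[] /eqP; rewrite pnatr_eq1 => /eqP.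
  by apply: mem_set; rewrite /= (ncount_lf lfw Dm) h.
- by move=> w; have /andP[] := fprod_itv (mk w) g01.
- by rewrite (le_lt_trans (probability_le1 P measurable_lf))// ltry.
- by move=> w; have /andP[] := fprod_itv (mk w) g01.
move=> t t01; have t01' : 0 <= 1 - t <= 1 by move: t01; lra.
have := @laplace_marked _ _ _ P X Theta Theta_uniform Theta_indep X_Theta_indep lambda lambda_ge0 Phi_poisson
  (fun z => g z * (1 - (1 - t) * \1_D z)) m (measurable_thin _ mg mD) (thin_itv D g01 t01').
rewrite (_ : (\int[P]_(w in lf) _ = \int[P]_(w in lf) (fprod g (mk w) * t ^+ cnt R (mk w) D)%:E)%E); last first.
  by apply: eq_integral => w /set_mem lfw; rewrite (fprod_thin _ lfw Dm)// subKr.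
move=> -> //.
- rewrite /A -expRD; congr (expR _)%:E.
  have -> : (\int[muZ R]_z (1 - g z * (1 - (1 - t) * \1_D z))%:E =
      \int[muZ R]_z (1 - g z)%:E + (1 - t)%:E * muZ R D)%E.
    rewrite -[X in muZ R X]setIT -integral_indic// -ge0_integralZl//.
    + rewrite -ge0_integralD//.
      * apply: eq_integral => z _; rewrite -EFinM -EFinD; congr EFin.
        rewrite indicE; case: (boolP (z \in D)) => [/set_mem/gD->|_] /=; ring.
      * by move=> z _; rewrite lee_fin; have /andP[] := onem01 z.
      * exact/measurable_EFinP.
      * by move=> z _; rewrite -EFinM lee_fin mulr_ge0//; have /andP[] := t01'.
      * by apply: measurable_funeM; apply/measurable_EFinP; exact: measurable_indic.
    + by apply/measurable_EFinP; exact: measurable_indic.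
    + by rewrite lee_fin; have /andP[] := t01'.
  rewrite fineD//; last by rewrite fin_numM// (muZ_fin mD Dm).
  by rewrite fineM ?(muZ_fin mD Dm)//= /tau; ring.
- move=> z zm; rewrite gm// indicE memNset ?mulr0 ?subr0 ?mulr1//.
  by move=> /Dm.
Qed.

Section moments.
Variables (S : set Omega) (K : set (R * (R * R))) (p : R) (m : nat).
Hypotheses (SK : decoupled S K p) (mK : measurable K) (Km : K `<=` cyl m) (p0 : 0 <= p).

(** The joint generating function of the numbers of points in C and C', on S.  The cross term
comes from the points lying in both sets. *)
Lemma pair_generating_function C C' e n : measurable C -> measurable C' ->
  C `<=` K -> C' `<=` K -> 0 <= e <= 1 -> 0 <= n <= 1 ->
  (\int[P]_(w in lf)
     (\1_S w * (1 - n) ^+ cnt R (mk w) C' * (1 - e) ^+ cnt R (mk w) C)%:E =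
   (p * expR (- (lambda * fine (muZ R C) * e + lambda * fine (muZ R C') * n -
      lambda * fine (muZ R (C `&` C')) * (e * n))))%:E)%E.
Proof.
move=> mC mC' CK CK' e01 n01.
have mCC : measurable (C `&` C') by exact: measurableI.
have Cm : C `<=` cyl m by move=> z /CK; exact: Km.
have Cm' : C' `<=` cyl m by move=> z /CK'; exact: Km.
have CCm : C `&` C' `<=` cyl m by move=> z [/Cm].
pose g1 z : R := cst 1 z * (1 - n * \1_C' z).
pose g z : R := g1 z * (1 - e * \1_C z).
have mg1 : measurable_fun setT g1 by exact: measurable_thin.
have one01 (z : R * (R * R)) : 0 <= cst (1 : R) z <= 1 by rewrite /= ler01 lexx.
have g1_01 := thin_itv C' one01 n01.
have mg : measurable_fun setT g by exact: measurable_thin.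
have g01 := thin_itv C g1_01 e01.
have g1K z : ~ K z -> g1 z = 1.
  by move=> zK; rewrite /g1 indicE memNset ?mulr0 ?subr0 ?mulr1// => /CK'.
have gK z : ~ K z -> g z = 1.
  by move=> zK; rewrite /g g1K// indicE memNset ?mulr0 ?subr0 ?mulr1// => /CK.
have [_ /(_ g mg g01 gK)] := SK.
have eq_int : (\int[muZ R]_z (1 - g z)%:E + (e * n)%:E * muZ R (C `&` C') =
    e%:E * muZ R C + n%:E * muZ R C')%E.
  have mi (A : set (R * (R * R))) : measurable A ->
      measurable_fun setT (fun z => (\1_A z)%:E : \bar R).
    by move=> mA; apply/measurable_EFinP; exact: measurable_indic.
  have cI (c : R) (A : set (R * (R * R))) : 0 <= c -> measurable A ->
      (c%:E * muZ R A = \int[muZ R]_z (c%:E * (\1_A z)%:E))%E.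
    move=> c0 mA; rewrite -[X in muZ R X]setIT -integral_indic// ge0_integralZl//.
    exact: mi.
  have /andP[e0 e1] := e01; have /andP[n0 n1] := n01.
  rewrite !cI//; last by rewrite mulr_ge0.
  rewrite -!ge0_integralD//; try by move=> z _; rewrite -EFinM lee_fin !mulr_ge0.
  - apply: eq_integral => z _; rewrite -!EFinM -!EFinD; congr EFin.
    rewrite /g /g1 /= !indicE in_setI; case: (z \in C); case: (z \in C') => /=; ring.
  - by apply: measurable_funeM; exact: mi.
  - by apply: measurable_funeM; exact: mi.
  - by move=> z _; rewrite lee_fin subr_ge0; have /andP[] := g01 z.
  - by apply/measurable_EFinP; exact: measurable_funB.
  - by apply: measurable_funeM; exact: mi.
have fin1 : (\int[muZ R]_z (1 - g z)%:E \is a fin_num)%E.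
  apply: (@integral_supported m).
  - exact: measurable_funB.
  - by move=> z; have := g01 z; rewrite -/(g z); lra.
  - by move=> z zm; rewrite gK ?subrr// => /Km.
have -> : (\int[P]_(w in lf) (\1_S w * fprod g (mk w))%:E = \int[P]_(w in lf)
     (\1_S w * (1 - n) ^+ cnt R (mk w) C' * (1 - e) ^+ cnt R (mk w) C)%:E)%E.
  apply: eq_integral => w /set_mem lfw; congr EFin; rewrite -mulrA; congr (_ * _).
  rewrite (fprod_thin _ lfw Cm); last by move=> z zm; apply: g1K => /Km.
  congr (_ * _); rewrite (fprod_thin _ lfw Cm')//.
  by rewrite (@fprodE _ _ _ _ 0)// big_ord0 mul1r.
move=> ->; congr (_ * expR (- _))%:E.
move: eq_int fin1 (muZ_fin mC Cm) (muZ_fin mC' Cm') (muZ_fin mCC CCm).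
move: (\int[_]_z _)%E (muZ R C) (muZ R C') (muZ R (C `&` C')).
move=> [x| |]// [a| |]// [b| |]// [c| |]//.
rewrite -!EFinM -!EFinD => -[h] _ _ _ _ /=.
have -> : x = e * a + n * b - e * n * c by rewrite -h addrK.
ring.
Qed.

Lemma measurable_indicS : measurable_fun lf (\1_S : Omega -> R).
Proof. by apply: measurable_funTS; apply: measurable_indic; case: SK. Qed.

Lemma pair_moment C C' n : measurable C -> measurable C' ->
  C `<=` K -> C' `<=` K -> 0 <= n <= 1 ->
  let a := lambda * fine (muZ R C) in let b := lambda * fine (muZ R C') in
  let c := lambda * fine (muZ R (C `&` C')) in
  (\int[P]_(w in lf) (\1_S w * (1 - n) ^+ cnt R (mk w) C' * (cnt R (mk w) C)%:R)%:E =
   (p * ((a - c * n) * expR (- (b * n))))%:E)%E.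
Proof.
move=> mC mC' CK CK' n01 a b c.
have Cm : C `<=` cyl m by move=> z /CK; exact: Km.
have Cm' : C' `<=` cyl m by move=> z /CK'; exact: Km.
have n0 : 0 <= 1 - n by move: n01; lra.
apply: (@mean_of_generating_function _ _ _ P lf measurable_lf
  (fun w => \1_S w * (1 - n) ^+ cnt R (mk w) C') (fun w => cnt R (mk w) C) _ _ _
  (fun e => p * expR (- (a * e + b * n - c * (e * n))))).
- by move=> w; rewrite mulr_ge0// exprn_ge0.
- apply: measurable_funM; first exact: measurable_indicS.
  by apply: measurable_expn_count => //; [exact: measurable_lf|exact: measurable_cnt Cm'].
- exact: measurable_cnt Cm.
- by move=> e e01; exact: pair_generating_function.
apply: trigger_derive.
have -> : - (a * 0 + b * n - c * (0 * n)) = - (b * n) by ring.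
move: (expR _) => E.
by rewrite /GRing.scale /=; ring.
Qed.

(** Two successive differentiations of the joint generating function, at e = 0 and then at
n = 0. *)
Lemma product_moment C C' : measurable C -> measurable C' -> C `<=` K -> C' `<=` K ->
  let a := lambda * fine (muZ R C) in let b := lambda * fine (muZ R C') in
  let c := lambda * fine (muZ R (C `&` C')) in
  (\int[P]_(w in lf) (\1_S w * (cnt R (mk w) C)%:R * (cnt R (mk w) C')%:R)%:E =
   (p * (a * b + c))%:E)%E.
Proof.
move=> mC mC' CK CK' a b c.
have Cm : C `<=` cyl m by move=> z /CK; exact: Km.
have Cm' : C' `<=` cyl m by move=> z /CK'; exact: Km.
apply: (@mean_of_generating_function _ _ _ P lf measurable_lf
  (fun w => \1_S w * (cnt R (mk w) C)%:R) (fun w => cnt R (mk w) C') _ _ _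
  (fun n => p * ((a - c * n) * expR (- (b * n))))).
- by move=> w; rewrite mulr_ge0.
- by apply: measurable_funM; [exact: measurable_indicS|exact: measurable_cnt Cm].
- exact: measurable_cnt Cm'.
- move=> e e01; rewrite -(pair_moment mC mC' CK CK' e01).
  by apply: eq_integral => w _; congr EFin; rewrite mulrAC.
apply: trigger_derive.
have -> : expR (- (b * 0)) = 1 by rewrite mulr0 oppr0 expR0.
by rewrite /GRing.scale /=; ring.
Qed.

Lemma single_moment C : measurable C -> C `<=` K ->
  (\int[P]_(w in lf) (\1_S w * (cnt R (mk w) C)%:R)%:E =
   (p * (lambda * fine (muZ R C)))%:E)%E.
Proof.
move=> mC CK.
have z01 : (0 <= (0 : R) <= 1) by rewrite lexx ler01.
transitivity (\int[P]_(w in lf)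
    (\1_S w * (1 - 0) ^+ cnt R (mk w) C * (cnt R (mk w) C)%:R)%:E)%E.
  by apply: eq_integral => w _; congr EFin; rewrite subr0 expr1n mulr1.
rewrite (pair_moment mC mC CK CK z01); congr (p * _)%:E.
move: (fine (muZ R (C `&` C))) (fine (muZ R C)) => y x.
by rewrite !mulr0 oppr0 expR0 mulr1 addr0.
Qed.

Lemma measurable_pair i j : measurable_fun setT (fun w => (mk w i, mk w j)).
Proof. by apply: measurable_fun_pair; exact: measurable_marked. Qed.

Lemma measurable_pair_count E : measurable E ->
  measurable_fun setT (fun w => pair_count R (mk w) E).
Proof.
move=> mE; apply: ge0_emeasurable_sum => [i w _ _|i _].
  by apply: nneseries_ge0 => j _ _; case: ifP.
apply: ge0_emeasurable_sum => [j w _ _|j _]; first by case: ifP.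
case: (i == j); first exact: measurable_cst.
apply/measurable_EFinP.
exact: (measurableT_comp (measurable_indic mE : measurable_fun setT (\1_E : _ -> R)) (measurable_pair i j)).
Qed.

(** The diagonal contribution c in the product moment is exactly the mean number of points
in the intersection, which [pair_count_rectangle] removes. *)
Lemma decoupled_pairs_rectangle C C' : measurable C -> measurable C' ->
  C `<=` K -> C' `<=` K ->
  (\int[P]_(w in lf) ((\1_S w)%:E * pair_count R (mk w) (C `*` C')) =
   (p * lambda ^+ 2)%:E * (muZ R C * muZ R C'))%E.
Proof.
move=> mC mC' CK CK'.
have mCC : measurable (C `&` C') by exact: measurableI.
have CCK : C `&` C' `<=` K by move=> z [/CK].
have Cm : C `<=` cyl m by move=> z /CK; exact: Km.
have Cm' : C' `<=` cyl m by move=> z /CK'; exact: Km.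
have CCm : C `&` C' `<=` cyl m by move=> z [/Cm].
have H1 := product_moment mC mC' CK CK'.
have H2 := single_moment mCC CCK.
have : (\int[P]_(w in lf) ((\1_S w)%:E * pair_count R (mk w) (C `*` C')) +
    \int[P]_(w in lf) (\1_S w * (cnt R (mk w) (C `&` C'))%:R)%:E =
    \int[P]_(w in lf) (\1_S w * (cnt R (mk w) C)%:R * (cnt R (mk w) C')%:R)%:E)%E.
  rewrite -ge0_integralD//.
  - apply: eq_integral => w /set_mem lfw; rewrite -mulrA !EFinM.
    rewrite -!(ncount_lf lfw Cm) -!(ncount_lf lfw Cm') -!(ncount_lf lfw CCm).
    rewrite -pair_count_rectangle ge0_muleDr//; [exact: pair_count_ge0|exact: ncount_ge0].
  - exact: measurable_lf.
  - by move=> w _; rewrite mule_ge0 ?lee_fin// pair_count_ge0.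
  - apply: emeasurable_funM; first by apply/measurable_EFinP; exact: measurable_indicS.
    by apply: measurable_funTS; apply: measurable_pair_count; exact: measurableX.
  - apply/measurable_EFinP; apply: measurable_funM; first exact: measurable_indicS.
    exact: measurable_cnt CCm.
rewrite H1 H2.
have I0 : (0 <= \int[P]_(w in lf) ((\1_S w)%:E * pair_count R (mk w) (C `*` C')))%E.
  by apply: integral_ge0 => w _; rewrite mule_ge0 ?lee_fin// pair_count_ge0.
move: (muZ_fin mC Cm) (muZ_fin mC' Cm') I0.
move: (\int[P]_(w in lf) _)%E (muZ R C) (muZ R C') => [x| |]// [a| |]// [b| |]// _ _ _.
rewrite /= -EFinD -!EFinM => -[h]; congr EFin.
rewrite -(addrK (p * (lambda * fine (muZ R (C `&` C')))) x) h; ring.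
Qed.

(** Second factorial moment measure on an event S decoupled from K.  Both sides are finite
measures in E inside K x K, and they agree on rectangles. *)
Theorem decoupled_pairs E : measurable E -> E `<=` K `*` K ->
  (\int[P]_(w in lf) ((\1_S w)%:E * pair_count R (mk w) E) =
   (p * lambda ^+ 2)%:E * muZZ R E)%E.
Proof.
move=> mE EK.
have mS : measurable S by case: SK.
have mLS : measurable (lf `&` S) by apply: measurableI => //; exact: measurable_lf.
have mKK : measurable (K `*` K) by exact: measurableX.
pose V i j w := (mk w i, mk w j).
pose PLS : {measure set Omega -> \bar R} := mrestr P mLS.
pose m0 i j : {measure set ((R * (R * R)) * (R * (R * R)))%type -> \bar R} :=
  measure_function_pushforward__canonical__measure_function_Measure PLS (measurable_pair i j).
pose m00 i j : {measure set ((R * (R * R)) * (R * (R * R)))%type -> \bar R} :=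
  mrestr (m0 i j) mKK.
pose mz : {measure set ((R * (R * R)) * (R * (R * R)))%type -> \bar R} := mzero.
pose m1 i j := if i == j then mz else m00 i j.
pose M : {measure set ((R * (R * R)) * (R * (R * R)))%type -> \bar R} := mseries (fun i => mseries (m1 i) 0) 0.
have ME A : measurable A -> M A =
    (\int[P]_(w in lf) ((\1_S w)%:E * pair_count R (mk w) (A `&` K `*` K)))%E.
  move=> mA; have mAK : measurable (A `&` K `*` K) by exact: measurableI.
  pose t i j w : \bar R := ((\1_S w)%:E * (if i == j then 0 else (\1_(A `&` K `*` K) (V i j w))%:E))%E.
  have t0 i j w : (0 <= t i j w)%E by rewrite /t mule_ge0 ?lee_fin//; case: ifP.
  have mt i j : measurable_fun lf (t i j).
    apply: emeasurable_funM; first by apply/measurable_EFinP; exact: measurable_indicS.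
    case: (i == j); first exact: measurable_cst.
    apply/measurable_EFinP/measurable_funTS.
    exact: (measurableT_comp (measurable_indic mAK : measurable_fun setT (\1_(A `&` K `*` K) : _ -> R)) (measurable_pair i j)).
  transitivity (\int[P]_(w in lf) \sum_(i <oo) \sum_(j <oo) t i j w)%E; last first.
    apply: eq_integral => w _; rewrite -ge0_nneseriesZl//.
      apply: eq_eseriesr => i _; rewrite -ge0_nneseriesZl// => j.
      by case: ifP.
    by move=> i; apply: nneseries_ge0 => j _ _; case: ifP.
  rewrite integral_nneseries//; last 3 first.
  - exact: measurable_lf.
  - by move=> i; apply: ge0_emeasurable_sum.
  - by move=> i w _; apply: nneseries_ge0.
  apply: eq_eseriesr => i _.
  rewrite integral_nneseries//; last exact: measurable_lf.
  apply: eq_eseriesr => j _.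
  rewrite /m1 /t; case: (eqVneq i j) => ij.
    by rewrite integral0_eq// => w _; rewrite mule0.
  rewrite (eq_integral (fun w => (\1_(S `&` V i j @^-1` (A `&` K `*` K)) w)%:E)); last first.
    by move=> w _; rewrite -EFinM !indicE -natrM mulnb [in RHS]in_setI.
  have mV : measurable (V i j @^-1` (A `&` K `*` K)).
    by rewrite -[X in measurable X]setTI; exact: (measurable_pair i j).
  rewrite integral_indic//; [|exact: measurable_lf|exact: measurableI].
  rewrite /m00 /= /mrestr /m0 /= /pushforward /PLS /= /mrestr; congr (P _).
  by rewrite (setIC S) -setIA (setIC S).
have pl0 : 0 <= p * lambda ^+ 2 by rewrite mulr_ge0// exprn_ge0.
pose M' : {measure set ((R * (R * R)) * (R * (R * R)))%type -> \bar R} := mscale (NngNum pl0) (mrestr (muZZ R) mKK).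
have M'E A : M' A = ((p * lambda ^+ 2)%:E * muZZ R (A `&` K `*` K))%E by [].
have rect A B : measurable A -> measurable B -> M (A `*` B) = M' (A `*` B).
  move=> mA mB; rewrite ME; last exact: measurableX.
  rewrite -setXI decoupled_pairs_rectangle//; try exact: measurableI.
  by rewrite M'E -setXI muZZX//; exact: measurableI.
suff : M E = M' E.
  by rewrite ME// M'E (setIidl EK).
apply: (@measure_unique _ R _ [set C | exists A B, [/\ measurable A, measurable B & C = A `*` B]]
  (fun=> setT)) => //.
- rewrite measurable_prod_measurableType; congr (<<s _ >>).
  apply/seteqP; split => C /=.
    by move=> [A mA [B mB <-]]; exists A, B.
  by move=> [A [B [mA mB ->]]]; exists A => //; exists B.
- move=> _ _ [A1 [B1 [mA1 mB1 ->]]] [A2 [B2 [mA2 mB2 ->]]].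
  exists (A1 `&` A2), (B1 `&` B2); split; [exact: measurableI|exact: measurableI|].
  by rewrite setXI.
- by move=> _; exists setT, setT; split => //; rewrite setXTT.
- by rewrite bigcup_const//; exists 0%N.
- by move=> _ [A [B [mA mB ->]]]; exact: rect.
- move=> _; rewrite -setXTT rect// M'E setXTT setTI muZZX//.
  have := muZ_fin mK Km; case: (muZ R K) => [x| |]// _.
  by rewrite -!EFinM ltry.
Qed.

End moments.

End second_moment.

(** * A two-point Mecke formula *)

(** Counting pairs is additive in the indicator of the set of pairs, with nonnegative weights
that may depend on the configuration. *)
Lemma pair_count_sum (R : realType) (T : Type) (z : nat -> T) (E : set (T * T))
    (b : nat -> \bar R) (F : nat -> set (T * T)) :
  (forall k, 0 <= b k)%E ->
  (forall p, (\1_E p)%:E = \sum_(k <oo) (b k * (\1_(F k) p)%:E))%E ->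
  (pair_count R z E = \sum_(k <oo) (b k * pair_count R z (F k)))%E.
Proof.
move=> b0 EF; rewrite /pair_count.
pose t k i j : \bar R := (b k * (if i == j then 0 else (\1_(F k) (z i, z j))%:E))%E.
have t0 k i j : (0 <= t k i j)%E by rewrite /t mule_ge0//; case: ifP => // _; rewrite lee_fin.
transitivity (\sum_(i <oo) \sum_(j <oo) \sum_(k <oo) t k i j)%E.
  apply: eq_eseriesr => i _; apply: eq_eseriesr => j _; rewrite /t.
  case: ifP => _; last exact: EF.
  by rewrite eseries0// => k _ _; rewrite mule0.
transitivity (\sum_(i <oo) \sum_(k <oo) \sum_(j <oo) t k i j)%E.
  by apply: eq_eseriesr => i _; rewrite nneseries_interchange.
rewrite nneseries_interchange//; last by move=> i k; apply: nneseries_ge0.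
apply: eq_eseriesr => k _; rewrite -ge0_nneseriesZl//; last first.
  by move=> i; apply: nneseries_ge0 => j _ _; case: ifP => // _; rewrite lee_fin.
apply: eq_eseriesr => i _; rewrite -ge0_nneseriesZl//.
by move=> j; case: ifP => // _; rewrite lee_fin.
Qed.

Lemma single_term_series (R : realType) (f : nat -> \bar R) c :
  (forall k, 0 <= f k)%E -> (forall k, k <> c -> f k = 0%E) ->
  (\sum_(k <oo) f k = f c)%E.
Proof.
move=> f0 h; rewrite (@nneseriesD1 _ _ c xpredT (fun k _ => f0 k))//.
by rewrite eseries0 ?adde0// => k _ /= /eqP; exact: h.
Qed.

(** The probability that a Poisson variable of parameter x equals 1. *)
Definition poisson1 (R : realType) (x : R) : R := x * expR (- x).

Lemma poisson1_ge0 (R : realType) (x : R) : 0 <= x -> 0 <= poisson1 x.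
Proof. by move=> x0; rewrite mulr_ge0// expR_ge0. Qed.

Lemma poisson1_le1 (R : realType) (x : R) : poisson1 x <= 1.
Proof.
rewrite /poisson1 expRN ler_pdivrMr ?expR_gt0// mul1r.
by rewrite (le_trans _ (expR_ge1Dx x))// lerDr.
Qed.

Section mecke.
Context {d : measure_display} {Omega : measurableType d} {R : realType}.
Variables (P : probability Omega R) (lambda : R) (X : nat -> {RV P >-> (R * R)%type})
  (Theta : nat -> {RV P >-> R}).
Hypotheses (lambda_ge0 : 0 <= lambda) (Phi_poisson : homogeneous_poisson lambda X)
  (Theta_uniform : forall i, uniform_angle (Theta i))
  (Theta_indep : mutually_independent Theta)
  (X_Theta_indep : independent_families X Theta).

Local Notation lf := (locally_finite X).
Local Notation mk := (marked X Theta).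
Local Notation T := (R * (R * R))%type.

Variables (m : nat) (F : set (T * T)) (A : T * T -> set T).
Variables (D : nat -> nat -> set T) (label : nat -> T * T -> nat) (a : T * T -> R).
Hypotheses (mF : measurable F) (Fm : F `<=` cyl m `*` cyl m).
Hypotheses (Am : forall p, F p -> A p `<=` cyl m).
Hypotheses (mD : forall n k, measurable (D n k)) (Dm : forall n k, D n k `<=` cyl m).
Hypothesis (mlabel : forall n k, measurable (F `&` label n @^-1` [set k])).
Hypothesis (label_out : forall n p, F p ->
  ~ D n (label n p) p.1 /\ ~ D n (label n p) p.2).
Hypothesis (D_cvg : forall p z, F p ->
  \forall n \near \oo, D n (label n p) z <-> A p z).
Hypothesis (a_cvg : forall p, F p ->
  fine (muZ R (D n (label n p))) @[n --> \oo] --> a p).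

(** The pairs p in F for which exactly one point of the configuration lies in the set A p
attached to p; for handovers, A p consists of the stations nearer than the pair. *)
Definition lonely w : set (T * T) := F `&` [set p | ncount R (mk w) (A p) = 1%E].

(** The set A p is replaced by one of countably many sets D n k, selected by the label of p. *)
Let lonely_ n w : set (T * T) :=
  F `&` [set p | ncount R (mk w) (D n (label n p)) = 1%E].

Let cell n k := F `&` label n @^-1` [set k].

Let hit n k : set Omega := [set w | ncount R (mk w) (D n k) = 1%E].

Let mhit n k : measurable (hit n k).
Proof.
rewrite -[X in measurable X]setTI.
exact: (@measurable_ncount_marked _ _ _ P X Theta _ (mD n k) measurableT _ (emeasurable_set1 1%E)).
Qed.

Let lonely_series n w : pair_count R (mk w) (lonely_ n w) =
  (\sum_(k <oo) ((\1_(hit n k) w)%:E * pair_count R (mk w) (cell n k)))%E.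
Proof.
apply: pair_count_sum => [k|p]; first by rewrite lee_fin.
rewrite (@single_term_series _ _ (label n p)).
- rewrite -EFinM !indicE -natrM mulnb; congr (nat_of_bool _)%:R%:E.
  apply/idP/andP => [/set_mem[Fp h]|[/set_mem h /set_mem[Fp _]]]; last exact: mem_set.
  by split; apply: mem_set.
- by move=> k; rewrite mule_ge0// lee_fin.
- move=> k kp; rewrite [X in (_ * X%:E)%E]indicE memNset ?mule0// => -[_ /= h].
  by apply: kp.
Qed.

Let mlonely_ n : measurable_fun setT (fun w => pair_count R (mk w) (lonely_ n w)).
Proof.
under eq_fun do rewrite lonely_series.
apply: ge0_emeasurable_sum => [k w _ _|k _].
  by rewrite mule_ge0 ?lee_fin// pair_count_ge0.
apply: emeasurable_funM; last by apply: measurable_pair_count; exact: mlabel.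
by apply/measurable_EFinP; exact: measurable_indic.
Qed.

Let tau n p := lambda * fine (muZ R (D n (label n p))).

Let tau_ge0 n p : 0 <= tau n p.
Proof. by rewrite mulr_ge0// fine_ge0. Qed.

Let measurable_tau_fun n (f : R -> R) : measurable_fun F (fun p => f (tau n p)).
Proof.
move=> _ B mB.
rewrite (_ : _ `&` _ = \bigcup_(k in [set k | B (f (lambda * fine (muZ R (D n k))))]) cell n k).
  by apply: bigcup_measurable => k _; exact: mlabel.
apply/seteqP; split => p /=.
  by move=> [Fp Bp]; exists (label n p).
by move=> [k Bk [Fp /= pk]]; split => //; rewrite /tau pk.
Qed.

(** On the pairs with a given label k the set D n k is deterministic and misses both members
of the pair, so the event of one point in D n k is decoupled from the pair. *)
Let expectation_lonely_ n :
  (\int[P]_(w in lf) pair_count R (mk w) (lonely_ n w) =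
   \int[muZZ R]_(p in F) (lambda ^+ 2 * poisson1 (tau n p))%:E)%E.
Proof.
under eq_integral do rewrite lonely_series.
rewrite integral_nneseries//; last 3 first.
- exact: measurable_lf.
- move=> k; apply: measurable_funTS; apply: emeasurable_funM.
    by apply/measurable_EFinP; exact: measurable_indic.
  by apply: measurable_pair_count; exact: mlabel.
- by move=> k w _; rewrite mule_ge0 ?lee_fin// pair_count_ge0.
have Fcell : F = \bigcup_k cell n k.
  apply/seteqP; split => p; first by move=> Fp; exists (label n p).
  by move=> [k _ []].
rewrite [in RHS]Fcell ge0_integral_bigcup//; last 4 first.
- by move=> k; exact: mlabel.
- rewrite -Fcell; apply/measurable_EFinP/measurable_funM => //; exact: (measurable_tau_fun n (@poisson1 R)).
- by move=> p _; rewrite lee_fin mulr_ge0 ?exprn_ge0// poisson1_ge0.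
- by move=> i j _ _ [p [[_ <-] [_ <-]]].
apply: eq_eseriesr => k _.
have K1 : cell n k `<=` (cyl m `\` D n k) `*` (cyl m `\` D n k).
  move=> p [Fp /= pk]; have [h1 h2] := label_out n Fp; rewrite pk in h1 h2.
  by have [? ?] := Fm Fp; split; split.
have mK : measurable (cyl m `\` D n k) by apply: measurableD => //; exact: measurable_cyl.
have Km : cyl m `\` D n k `<=` cyl m by move=> z [].
have := @decoupled_pairs _ _ _ P lambda X Theta lambda_ge0 (hit n k) (cyl m `\` D n k) _ m
  (decoupled_one_point lambda_ge0 Phi_poisson Theta_uniform Theta_indep X_Theta_indep (mD n k) (@Dm n k))
  mK Km.
set q := _ * expR _; move=> -> //; last 2 first.
- by rewrite mulr_ge0 ?expR_ge0// mulr_ge0// fine_ge0.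
- exact: mlabel.
rewrite (eq_integral (cst (lambda ^+ 2 * q)%:E)).
  by rewrite integral_cst 1?mulrC//; exact: mlabel.
by move=> p /set_mem[_ /= pk]; rewrite /tau pk.
Qed.

(** Only finitely many points are relevant, and for each triple of them the discretised
condition is eventually the exact one; so the count is eventually constant. *)
Let lonely_cvg w : lf w ->
  pair_count R (mk w) (lonely_ n w) @[n --> \oo] --> pair_count R (mk w) (lonely w).
Proof.
move=> lfw; have [M HM] := lf_tail Theta m lfw.
have E : \forall n \near \oo, forall i j l : 'I_M, F (mk w i, mk w j) ->
    (D n (label n (mk w i, mk w j)) (mk w l) <-> A (mk w i, mk w j) (mk w l)).
  apply: filter_forall => i; apply: filter_forall => j; apply: filter_forall => l.
  have [Fij|nF] := pselect (F (mk w i, mk w j)); last by apply: nearW => n /nF.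
  by have := D_cvg (mk w l) Fij; apply: filterS => n h _.
apply: cvg_near_cst; move: E; apply: filterS => n En.
apply: eq_eseriesr => i _; apply: eq_eseriesr => j _.
case: ifP => // _; congr (_%:E); rewrite !indicE; congr (nat_of_bool _)%:R.
have [Fij|nF] := pselect (F (mk w i, mk w j)); last first.
  by rewrite !memNset// => -[/nF].
have [/= mi mj] := Fm Fij.
have iM : (i < M)%N by rewrite ltnNge; apply/negP => /(HM _ (@subset_refl _ _)).
have jM : (j < M)%N by rewrite ltnNge; apply/negP => /(HM _ (@subset_refl _ _)).
have ncE : ncount R (mk w) (D n (label n (mk w i, mk w j))) =
    ncount R (mk w) (A (mk w i, mk w j)).
  rewrite (ncount_tail (HM _ (@Dm _ _))) (ncount_tail (HM _ (Am Fij))).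
  congr (_%:R%:E); apply: eq_bigr => l _; congr (nat_of_bool (asbool _)).
  by apply/propext; exact: (En (Ordinal iM) (Ordinal jM) l Fij).
by apply/idP/idP => /set_mem[? h]; apply: mem_set; split => //=; [rewrite -ncE|rewrite ncE].
Qed.

Let muZZ_F : (muZZ R F < +oo)%E.
Proof.
apply: (@le_lt_trans _ _ (muZZ R (cyl m `*` cyl m))).
  by apply: le_measure; rewrite ?inE//; apply: measurableX; exact: measurable_cyl.
rewrite muZZX; [|exact: measurable_cyl|exact: measurable_cyl].
by rewrite lte_mul_pinfty ?measure_ge0 ?muZ_cyl// ge0_fin_numE ?muZ_cyl.
Qed.

Lemma measurable_lonely : measurable_fun lf (fun w => pair_count R (mk w) (lonely w)).
Proof.
apply: (emeasurable_fun_cvg (fun n w => pair_count R (mk w) (lonely_ n w))).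
  by move=> n; apply: measurable_funTS.
by move=> w lfw; exact: lonely_cvg.
Qed.

Lemma pair_count_le z (E E' : set (T * T)) : E `<=` E' ->
  (pair_count R z E <= pair_count R z E')%E.
Proof.
move=> EE'; apply: lee_nneseries => [i _ _|i _].
  by apply: nneseries_ge0 => j _ _; case: ifP => // _; rewrite lee_fin.
apply: lee_nneseries => [j _ _|j _]; first by case: ifP => // _; rewrite lee_fin.
case: ifP => // _; rewrite lee_fin !indicE ler_nat.
case: (boolP (_ \in E)) => // /set_mem/EE' h; by rewrite mem_set.
Qed.

(** Used for null sets of pairs, which are therefore almost surely not hit. *)
Lemma expectation_pairs :
  (\int[P]_(w in lf) pair_count R (mk w) F = (lambda ^+ 2)%:E * muZZ R F)%E.
Proof.
have := @decoupled_pairs _ _ _ P lambda X Theta lambda_ge0 setT (cyl m) 1 m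
  (decoupled_setT lambda_ge0 Phi_poisson Theta_uniform Theta_indep X_Theta_indep m)
  (measurable_cyl m) (@subset_refl _ _) ler01 F mF Fm.
by rewrite mul1r => <-; apply: eq_integral => w _; rewrite indicT mul1e.
Qed.

(** The two-point Mecke formula for the event of one point in A p.  The discretised formula passes
to the limit on both sides by dominated convergence: the number of all pairs in F dominates
on the left, and poisson1 is at most 1 on the right. *)
Theorem expectation_lonely :
  measurable_fun lf (fun w => pair_count R (mk w) (lonely w)) /\
  (\int[P]_(w in lf) pair_count R (mk w) (lonely w) =
   \int[muZZ R]_(p in F) (lambda ^+ 2 * poisson1 (lambda * a p))%:E)%E.
Proof.
split; first exact: measurable_lonely.
have [] := @dominated_convergence _ _ _ P lf (measurable_lf X)
  (fun n w => pair_count R (mk w) (lonely_ n w)) (fun w => pair_count R (mk w) (lonely w))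
  (fun w => pair_count R (mk w) F).
- by move=> n; apply: measurable_funTS.
- exact: measurable_lonely.
- by apply: aeW => w lfw; exact: lonely_cvg.
- apply/integrableP; split; first by apply: measurable_funTS; exact: measurable_pair_count.
  under eq_integral do rewrite gee0_abs ?pair_count_ge0//.
  by rewrite expectation_pairs; apply: lte_mul_pinfty => //; rewrite lee_fin exprn_ge0.
- apply: aeW => w n _; rewrite gee0_abs ?pair_count_ge0//.
  by apply: pair_count_le => p [].
move=> _ _ /= c1.
have [] := @dominated_convergence _ _ _ (muZZ R) F mF
  (fun n p => (lambda ^+ 2 * poisson1 (tau n p))%:E)
  (fun p => (lambda ^+ 2 * poisson1 (lambda * a p))%:E) (cst (lambda ^+ 2)%:E).
- move=> n; apply/measurable_EFinP/measurable_funM => //; exact: (measurable_tau_fun n (@poisson1 R)).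
- apply/measurable_EFinP/measurable_funM => //.
  apply: (@measurable_fun_cvg _ _ _ _ (fun n p => poisson1 (tau n p))).
    by move=> n; exact: (measurable_tau_fun n (@poisson1 R)).
  move=> p Fp; have c : tau n p @[n --> \oo] --> lambda * a p.
    by apply: cvgM; [exact: cvg_cst|exact: a_cvg].
  apply: cvgM => //; apply: (@continuous_cvg _ _ _ _ _ _ expR); first exact: continuous_expR.
  exact: cvgN.
- apply: aeW => p Fp; apply: cvg_EFin; first exact: nearW.
  have c : tau n p @[n --> \oo] --> lambda * a p.
    by apply: cvgM; [exact: cvg_cst|exact: a_cvg].
  apply: cvgM; first exact: cvg_cst.
  apply: cvgM => //; apply: (@continuous_cvg _ _ _ _ _ _ expR); first exact: continuous_expR.
  exact: cvgN.
- apply/integrableP; split; first exact: measurable_cst.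
  rewrite (eq_integral (cst (lambda ^+ 2)%:E)); last first.
    by move=> p _ /=; rewrite ger0_norm// exprn_ge0.
  by rewrite integral_cst//; apply: lte_mul_pinfty => //; rewrite lee_fin exprn_ge0.
- apply: aeW => p n _.
  have l0 : 0 <= lambda ^+ 2 by rewrite exprn_ge0.
  have t0 : 0 <= poisson1 (tau n p) by exact: poisson1_ge0.
  rewrite abse_EFin lee_fin ger0_norm; last by rewrite mulr_ge0.
  by rewrite ler_piMr// poisson1_le1.
move=> _ _ /= c2.
apply: (cvg_unique _ c1) => //.
rewrite (_ : (fun n => _) = (fun n => \int[muZZ R]_(p in F) (lambda ^+ 2 * poisson1 (tau n p))%:E)%E)//.
by apply/funext => n; exact: expectation_lonely_.
Qed.

End mecke.

(** * Affine changes of variables, discs and level sets of angles *)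

Section affine.
Context {R : realType}.

Lemma measurable_affine (c a : R) : measurable_fun setT (fun x : R => c * x + a).
Proof. by apply: measurable_funD => //; apply: measurable_funM. Qed.

Lemma lebR_affine (c a : R) (A : set R) : 0 < c -> measurable A ->
  lebR R A = (c%:E * lebR R ((fun x => (c * x + a)%R) @^-1` A))%E.
Proof.
move=> c0 mA; rewrite !lebRE.
pose f : measurableTypeR R -> measurableTypeR R := fun x => (c * x + a)%R.
have mf : measurable_fun setT f by exact: measurable_affine.
pose m0 : {measure set (measurableTypeR R) -> \bar R} :=
  measure_function_pushforward__canonical__measure_function_Measure (@lebesgue_measure R) mf.
pose m : {measure set (measurableTypeR R) -> \bar R} := mscale (NngNum (ltW c0)) m0.
have mE B : m B = (c%:E * @lebesgue_measure R (f @^-1` B))%E by [].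
rewrite (@lebesgue_measure_unique R m) // => _ [[x y]] _ <-.
rewrite mE.
rewrite (_ : f @^-1` _ = `](x - a) / c, (y - a) / c]%classic); last first.
  apply/seteqP; split => z /=; rewrite !in_itv/= /f ltr_pdivrMr// ler_pdivlMr// ltrBlDr lerBrDr mulrC//.
rewrite !lebesgue_measure_itv/= !lte_fin ltr_pM2r ?invr_gt0// ltrD2r.
case: ifP => _; last by rewrite mule0.
by rewrite -!EFinD -EFinM; congr EFin; field; rewrite gt_eqF.
Qed.

Lemma mu2_affine (c a b : R) (A : set (R * R)) : 0 < c -> measurable A ->
  mu2 R A = ((c ^+ 2)%:E * mu2 R ((fun x => (c * x.1 + a, c * x.2 + b)%R) @^-1` A))%E.
Proof.
move=> c0 mA.
pose f : R * R -> R * R := fun x => (c * x.1 + a, c * x.2 + b)%R.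
have mf : measurable_fun setT f.
  apply: measurable_fun_pair; apply: measurable_funD => //; apply: measurable_funM => //.
pose m0 : {measure set (R * R)%type -> \bar R} :=
  measure_function_pushforward__canonical__measure_function_Measure (mu2 R) mf.
have c20 : 0 <= c ^+ 2 by rewrite exprn_ge0// ltW.
pose m : {measure set (R * R)%type -> \bar R} := mscale (NngNum c20) m0.
have mE B : m B = ((c ^+ 2)%:E * mu2 R (f @^-1` B))%E by [].
rewrite (@mu2_unique R m)// => B C mB mC.
rewrite mE.
have -> : f @^-1` (B `*` C) = ((fun x => (c * x + a)%R) @^-1` B) `*` ((fun x => (c * x + b)%R) @^-1` C).
  by [].
rewrite mu2X; last 2 first.
- by rewrite -[X in measurable X]setTI; exact: measurable_affine.
- by rewrite -[X in measurable X]setTI; exact: measurable_affine.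
rewrite (lebR_affine a c0 mB) (lebR_affine b c0 mC) expr2 EFinM.
by rewrite -!muleA; congr (_ * _)%E; rewrite muleCA.
Qed.

Lemma muZ_affine (c : R) (a b : R -> R) (E : set (R * (R * R))) : 0 < c ->
  measurable_fun setT a -> measurable_fun setT b -> measurable E ->
  muZ R E = ((c ^+ 2)%:E *
    muZ R ((fun z => (z.1, (c * z.2.1 + a z.1, c * z.2.2 + b z.1)%R)) @^-1` E))%E.
Proof.
move=> c0 ma mb mE.
pose f : R * (R * R) -> R * (R * R) := fun z => (z.1, (c * z.2.1 + a z.1, c * z.2.2 + b z.1)%R).
have mf : measurable_fun setT f.
  apply: measurable_fun_pair => //; apply: measurable_fun_pair.
    apply: measurable_funD; last exact: measurableT_comp.
    apply: measurable_funM => //; exact: (measurableT_comp measurable_fst measurable_snd).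
  apply: measurable_funD; last exact: measurableT_comp.
  apply: measurable_funM => //; exact: (measurableT_comp measurable_snd measurable_snd).
have mfE : measurable (f @^-1` E) by rewrite -[X in measurable X]setTI; exact: mf.
rewrite !muZ_section -ge0_integralZl//; last 2 first.
- exact: (@measurable_fun_xsection _ _ _ _ R (mu2 R) _ mfE).
- by rewrite lee_fin exprn_ge0// ltW.
apply: eq_integral => t _.
rewrite (mu2_affine (a t) (b t) c0); last exact: measurable_xsection.
congr (_ * mu2 R _)%E; apply/seteqP; split => x /=; rewrite /xsection/= !inE//.
Qed.

(** A dilation of the plane by c followed by a translation that depends on the angle
multiplies the measure on marks by c^2, hence the measure on pairs of marks by c^4. *)
Lemma muZZ_affine (c : R) (a b : R -> R) (E : set ((R * (R * R)) * (R * (R * R)))) : 0 < c ->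
  measurable_fun setT a -> measurable_fun setT b -> measurable E ->
  let f z := (z.1, (c * z.2.1 + a z.1, c * z.2.2 + b z.1)%R) in
  muZZ R E = ((c ^+ 4)%:E * muZZ R ((fun p => (f p.1, f p.2)) @^-1` E))%E.
Proof.
move=> c0 ma mb mE f.
have mf : measurable_fun setT f.
  apply: measurable_fun_pair => //; apply: measurable_fun_pair.
    apply: measurable_funD; last exact: measurableT_comp.
    apply: measurable_funM => //; exact: (measurableT_comp measurable_fst measurable_snd).
  apply: measurable_funD; last exact: measurableT_comp.
  apply: measurable_funM => //; exact: (measurableT_comp measurable_snd measurable_snd).
pose g (p : (R * (R * R)) * (R * (R * R))) := (f p.1, f p.2).
have mg : measurable_fun setT g by apply: measurable_fun_pair; apply: measurableT_comp.
pose m0 : {measure set ((R * (R * R)) * (R * (R * R)))%type -> \bar R} :=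
  measure_function_pushforward__canonical__measure_function_Measure (muZZ R) mg.
have c40 : 0 <= c ^+ 4 by rewrite exprn_ge0// ltW.
pose m : {measure set ((R * (R * R)) * (R * (R * R)))%type -> \bar R} := mscale (NngNum c40) m0.
have mgE B : m B = ((c ^+ 4)%:E * muZZ R (g @^-1` B))%E by [].
rewrite (@muZZ_unique R m)// => B C mB mC.
rewrite mgE.
have -> : g @^-1` (B `*` C) = (f @^-1` B) `*` (f @^-1` C) by [].
rewrite muZZX; last 2 first.
- by rewrite -[X in measurable X]setTI; exact: mf.
- by rewrite -[X in measurable X]setTI; exact: mf.
rewrite (muZ_affine c0 ma mb mB) (muZ_affine c0 ma mb mC).
rewrite (_ : c ^+ 4 = c ^+ 2 * c ^+ 2); last by rewrite -exprD.
by rewrite EFinM -!muleA; congr (_ * _)%E; rewrite muleCA.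
Qed.

End affine.

Section disc.
Context {R : realType}.
Local Notation mu := (@lebesgue_measure R).

(** The substitution x = sin t and the primitive (t + sin t cos t) / 2 of cos^2. *)
Lemma integral_half_disc :
  (\int[mu]_(x in `[(-1)%R, 1%R]) (Num.sqrt (1 - x ^+ 2))%:E = (pi / 2)%:E)%E.
Proof.
have pi0 : - (pi / 2) < pi / 2 :> R by have := pi_gt0 R; lra.
have dsin : (@sin R)^`()%classic = cos.
  by apply/funext => x; rewrite derive1E derive_val.
have h : derivable_oo_LRcontinuous (@sin R) (- (pi / 2)) (pi / 2).
  split.
  - by move=> x _; apply: ex_derive.
  - by apply: cvg_at_right_filter; exact: continuous_sin.
  - by apply: cvg_at_left_filter; exact: continuous_sin.
have := @integration_by_substitution_increasing R sin (fun x => Num.sqrt (1 - x ^+ 2))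
  (- (pi / 2)) (pi / 2) (ltW pi0).
rewrite sinN sin_pihalf dsin => ->//.
- pose G (t : R) : R := (t + sin t * cos t) / 2.
  have dG x : is_derive x (1 : R) G (cos x * cos x).
    apply: trigger_derive; rewrite /GRing.scale/=.
    by have := cos2Dsin2 x; rewrite !expr2 => cs1; rewrite mulr0; lra.
  transitivity (\int[mu]_(x in `[(- (pi / 2))%R, (pi / 2)%R]) (cos x * cos x)%:E)%E.
    apply: eq_integral => x /set_mem/=; rewrite in_itv/= => xI; congr EFin.
    rewrite /GRing.mul/= (_ : 1 - sin x ^+ 2 = cos x ^+ 2); last first.
      by rewrite -(cos2Dsin2 x) addrK.
    by rewrite sqrtr_sqr ger0_norm// cos_ge0_pihalf.
  rewrite (@continuous_FTC2 R _ G)//.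
  - rewrite /G sinN cosN sin_pihalf cos_pihalf -EFinB; congr EFin.
    by rewrite !mulr0 !addr0; field.
  - apply: continuous_subspaceT => x; apply: continuousM; exact: continuous_cos.
  - have cG x : {for x, continuous G}.
      by apply: differentiable_continuous; apply/derivable1_diffP; exact: ex_derive.
    split.
    + by move=> x _; apply: ex_derive.
    + by apply: cvg_at_right_filter; exact: cG.
    + by apply: cvg_at_left_filter; exact: cG.
  - by move=> x _; rewrite derive1E derive_val.
- by move=> x y xI yI xy; rewrite ltr_sin.
- by move=> x _; exact: continuous_cos.
- by apply/cvg_ex; exists (cos (- (pi / 2)) : R); apply: cvg_at_right_filter; exact: continuous_cos.
- by apply/cvg_ex; exists (cos (pi / 2) : R); apply: cvg_at_left_filter; exact: continuous_cos.
- apply: continuous_subspaceT => x; apply: continuous_comp; last exact: sqrt_continuous.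
  by apply: continuousB; [exact: cst_continuous|exact: exprn_continuous].
Qed.

Definition disc (r : R) : set (R * R) := [set x | x.1 ^+ 2 + x.2 ^+ 2 < r ^+ 2].

Lemma measurable_disc r : measurable (disc r).
Proof.
rewrite -[X in measurable X]setTI.
have mf : measurable_fun setT (fun x : R * R => x.1 ^+ 2 + x.2 ^+ 2).
  by apply: measurable_funD; apply: measurable_funX.
rewrite (_ : disc r = (fun x : R * R => x.1 ^+ 2 + x.2 ^+ 2) @^-1` `]-oo, r ^+ 2[).
  exact: mf.
by apply/seteqP; split => x /=; rewrite in_itv.
Qed.

Lemma ltr_norm_sqrt (y a : R) : (`|y| < Num.sqrt a) = (y ^+ 2 < a).
Proof.
rewrite -sqrtr_sqr; case: (ltP 0 a) => [a0|a0]; first by rewrite ltr_sqrt.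
rewrite (ler0_sqrtr a0) (ltNge (y ^+ 2)) (le_trans a0 (sqr_ge0 y)).
by apply/negbTE; rewrite -leNgt sqrtr_ge0.
Qed.

Lemma mu2_unit_disc : mu2 R (disc 1) = (pi : R)%:E.
Proof.
have secE (x : R) : xsection (disc 1) x = [set y | `|y| < Num.sqrt (1 - x ^+ 2)].
  by apply/seteqP; split => y; rewrite /xsection/= inE /disc/= ltr_norm_sqrt expr1n ltrBrDl.
have lenE (x : R) : lebR R (xsection (disc 1) x) = (2 * Num.sqrt (1 - x ^+ 2))%:E.
  rewrite secE lebRE.
  rewrite (_ : [set _ | _] = `]- Num.sqrt (1 - x ^+ 2), Num.sqrt (1 - x ^+ 2)[%classic).
    rewrite lebesgue_measure_itv/= lte_fin.
    have s0 := sqrtr_ge0 (1 - x ^+ 2).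
    case: ifPn => h; first by rewrite -EFinD; congr EFin; ring.
    by congr EFin; move: h; rewrite -leNgt; lra.
  by apply/seteqP; split => y /=; rewrite in_itv/= -ltr_norml.
have msqrt : measurable_fun setT (fun x : R => Num.sqrt (1 - x ^+ 2)).
  apply: continuous_measurable_fun => x; apply: continuous_comp; last exact: sqrt_continuous.
  by apply: continuousB; [exact: cst_continuous|exact: exprn_continuous].
have h0 (x : R) : (0 <= (2 * Num.sqrt (1 - x ^+ 2))%:E)%E by rewrite lee_fin mulr_ge0// sqrtr_ge0.
have mh : measurable_fun setT (fun x : R => (2 * Num.sqrt (1 - x ^+ 2))%:E).
  by apply/measurable_EFinP; apply: measurable_funM.
rewrite mu2_section; under eq_integral do rewrite lenE.
rewrite ge0_integral_lebR//.
transitivity (\int[mu]_(x in `[(-1)%R, 1%R]) (2 * Num.sqrt (1 - x ^+ 2))%:E)%E.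
  rewrite [RHS]integral_mkcond; apply: eq_integral => x _; rewrite patchE.
  case: ifPn => // /negP; rewrite inE/= in_itv/= -ler_norml => x1; congr EFin.
  rewrite ler0_sqrtr ?mulr0// subr_le0 -real_normK ?num_real//.
  by rewrite expr_ge1//; move/negP: x1; rewrite -ltNge => /ltW.
under eq_integral do rewrite EFinM.
rewrite ge0_integralZl//; last first.
  by apply/measurable_EFinP; apply: measurable_funTS; exact: msqrt.
by rewrite integral_half_disc -EFinM; congr EFin; field.
Qed.

Lemma mu2_disc r : 0 <= r -> mu2 R (disc r) = (pi * r ^+ 2)%:E.
Proof.
rewrite le_eqVlt => /predU1P[<-|r0].
  rewrite (_ : disc 0 = set0) ?measure0 ?expr0n ?mulr0// -subset0 => x /=.
  by rewrite /disc/= expr0n/=; have := sqr_ge0 x.1; have := sqr_ge0 x.2; lra.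
rewrite (mu2_affine 0 0 r0 (measurable_disc r)).
rewrite (_ : _ @^-1` _ = disc 1) ?mu2_unit_disc -?EFinM 1?mulrC//.
apply/seteqP; split => x; rewrite /disc/= !addr0 !exprMn -mulrDr expr1n.
  by rewrite -[ltRHS]mulr1 ltr_pM2l// exprn_gt0.
by move=> h; rewrite -[ltRHS]mulr1 ltr_pM2l// exprn_gt0.
Qed.

End disc.

Section angles.
Context {R : realType}.

Lemma unifR_countable (S : set R) : measurable S ->
  countable (S `&` `[- pi, pi]) -> unifR R S = 0%E.
Proof.
move=> mS cS; rewrite unifRE /uniform_prob.
pose J : set R := S `&` `[- pi, pi].
have mJ : measurable J by exact: measurableI.
rewrite (_ : (\int[lebesgue_measure]_(x in S) _ = \int[lebesgue_measure]_(x in J) (uniform_pdf (- pi) pi x)%:E)%E); last first.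
  rewrite integral_mkcondr; apply: eq_integral => x _; rewrite patchE mem_setE in_itv/= /uniform_pdf.
  by case: ifP.
apply: null_set_integral => //.
  by apply: measurable_funTS; apply/measurable_EFinP; exact: measurable_uniform_pdf.
exact: countable_lebesgue_measure0.
Qed.

(** The equation a cos t + b sin t = c leaves at most two values for cos t, hence at most four
angles. *)
Lemma unifR_level (a b c : R) : (a, b) <> (0, 0) ->
  unifR R [set t | a * cos t + b * sin t = c] = 0%E.
Proof.
move=> ab0.
have A0 : 0 < a ^+ 2 + b ^+ 2.
  rewrite lt_neqAle addr_ge0 ?sqr_ge0// andbT eq_sym paddr_eq0 ?sqr_ge0//.
  by rewrite !sqrf_eq0; apply/negP => /andP[/eqP a0 /eqP b0]; apply: ab0; rewrite a0 b0.
set A := a ^+ 2 + b ^+ 2.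
(* cos t is a root of A y^2 - 2 a c y + c^2 - b^2, with A = a^2 + b^2. *)
pose D := (a * c) ^+ 2 - A * (c ^+ 2 - b ^+ 2).
pose y1 := (a * c + Num.sqrt D) / A; pose y2 := (a * c - Num.sqrt D) / A.
apply: unifR_countable.
  rewrite -[X in measurable X]setTI.
  have mf : measurable_fun setT (fun t : R => a * cos t + b * sin t).
    apply: measurable_funD; apply: measurable_funM => //; apply: continuous_measurable_fun.
      exact: continuous_cos.
    exact: continuous_sin.
  exact: (mf measurableT [set c] (measurable_set1 c)).
apply: finite_set_countable.
apply: (@sub_finite_set _ _ [set` [:: acos y1; - acos y1; acos y2; - acos y2]]); last exact: finite_seq.
move=> t [/= tc]; rewrite in_itv/= => tpi.
have cosy : cos t = y1 \/ cos t = y2.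
  have e1 : (A * cos t - a * c) ^+ 2 = D.
    have := cos2Dsin2 t => cs.
    have bs : b * sin t = c - a * cos t by rewrite -tc; ring.
    have : b ^+ 2 * sin t ^+ 2 = (c - a * cos t) ^+ 2 by rewrite -bs exprMn.
    have -> : sin t ^+ 2 = 1 - cos t ^+ 2 by rewrite -cs; ring.
    rewrite /D /A => h; apply: subr0_eq.
    move/eqP: h; rewrite -subr_eq0 => /eqP h.
    transitivity (- (a ^+ 2 + b ^+ 2) * 0); last by rewrite mulr0.
    by rewrite -{}h; ring.
  have D0 : 0 <= D by rewrite -e1 sqr_ge0.
  have : `|A * cos t - a * c| = Num.sqrt D by rewrite -e1 sqrtr_sqr.
  case: (ler0P (A * cos t - a * c)) => _ e.
    by right; rewrite /y2 -e; field; rewrite gt_eqF.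
  by left; rewrite /y1 -e; field; rewrite gt_eqF.
have tabs y : cos t = y -> t = acos y \/ t = - acos y.
  move=> <-; case: (leP 0 t) => t0.
    by left; rewrite cosK// in_itv/= t0; case/andP: tpi.
  by right; rewrite cosKN ?opprK//; case/andP: tpi => -> _; rewrite ltW.
rewrite !inE; case: cosy => /tabs[->|->]; rewrite eqxx ?orbT//.
Qed.

End angles.

(** * Relative motion of two stations *)

(** Written through powers, 1/x = x * (x^2)^(-1) holds at 0 as well. *)
Lemma measurable_invr (R : realType) : measurable_fun setT (@GRing.inv R).
Proof.
rewrite (_ : @GRing.inv R = fun x => x * (x ^+ 2) `^ (-1)).
  by apply: measurable_funM => //; apply: measurableT_comp (measurable_powR _) _; exact: measurable_funX.
apply/funext => x; rewrite powR_inv1 ?sqr_ge0//.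
by have [->|x0] := eqVneq x 0; [rewrite invr0 mul0r|rewrite expr2 invfM mulrA divff// mul1r].
Qed.

Section kinematics.
Context {R : realType}.
Variable v : R.
Hypothesis v_gt0 : 0 < v.
Local Notation T := (R * (R * R))%type.
Implicit Types (z : T) (p : T * T) (s t : R).

(** The distance to the origin at time s of the station with mark z = (angle, initial point). *)
Definition dist z s : R :=
  Num.sqrt ((z.2.1 + v * s * cos z.1) ^+ 2 + (z.2.2 + v * s * sin z.1) ^+ 2).

(** The component of the initial point along the direction of motion; up to the factor 2v it is
the linear coefficient of the squared distance. *)
Definition radial z : R := z.2.1 * cos z.1 + z.2.2 * sin z.1.

Definition sqdist0 z : R := z.2.1 ^+ 2 + z.2.2 ^+ 2.

Lemma dist_ge0 z s : 0 <= dist z s. Proof. exact: sqrtr_ge0. Qed.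

Lemma dist_sqr z s : dist z s ^+ 2 = sqdist0 z + 2 * v * s * radial z + (v * s) ^+ 2.
Proof.
rewrite sqr_sqrtr ?addr_ge0 ?sqr_ge0// /sqdist0 /radial.
have -> : (v * s) ^+ 2 = (v * s) ^+ 2 * (cos z.1 ^+ 2 + sin z.1 ^+ 2) by rewrite cos2Dsin2 mulr1.
by ring.
Qed.

(** Cauchy-Schwarz for the initial point and the unit vector of the motion. *)
Lemma radial_sqr z : radial z ^+ 2 <= sqdist0 z.
Proof.
rewrite -subr_ge0 (_ : _ - _ = (z.2.1 * sin z.1 - z.2.2 * cos z.1) ^+ 2) ?sqr_ge0//.
have -> : sqdist0 z = sqdist0 z * (cos z.1 ^+ 2 + sin z.1 ^+ 2) by rewrite cos2Dsin2 mulr1.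
by rewrite /sqdist0 /radial; ring.
Qed.

(** A station moves with speed v.  The squared inequality reduces to
|radial z + v t| <= dist z t, which is Cauchy-Schwarz at time t. *)
Lemma dist_lipschitz z s t : dist z s <= dist z t + v * `|s - t|.
Proof.
have D0 := dist_ge0 z t.
have vs0 : 0 <= v * `|s - t| by rewrite mulr_ge0// ltW.
rewrite -(ler_pXn2r (_ : (0 < 2)%N)) ?nnegrE ?dist_ge0 ?addr_ge0//.
have D2 := dist_sqr z t.
rewrite sqrrD exprMn real_normK ?num_real// {1}D2 dist_sqr.
have rD : `|radial z + v * t| <= dist z t.
  rewrite -[leRHS]ger0_norm// -(ler_pXn2r (_ : (0 < 2)%N)) ?nnegrE//.
  rewrite !real_normK ?num_real// D2.
  have -> : (radial z + v * t) ^+ 2 = radial z ^+ 2 + 2 * v * t * radial z + (v * t) ^+ 2 by ring.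
  by rewrite !lerD2r radial_sqr.
have : (s - t) * (radial z + v * t) <= `|s - t| * dist z t.
  by rewrite (le_trans (ler_norm _))// normrM ler_wpM2l.
move=> h0; have h : 0 <= `|s - t| * dist z t - (s - t) * (radial z + v * t) by rewrite subr_ge0.
have {}h := mulr_ge0 (ltW v_gt0) h; rewrite -subr_ge0.
apply: le_trans (_ : 2 * (v * (`|s - t| * dist z t - (s - t) * (radial z + v * t))) <= _); first by rewrite mulr_ge0.
by rewrite le_eqVlt; apply/orP; left; apply/eqP; ring.
Qed.

Lemma dist_dist0 z s : dist z 0 <= dist z s + v * `|s|.
Proof. by have := dist_lipschitz z 0 s; rewrite sub0r normrN. Qed.

Lemma window_dist0 z m : dist z 0 <= m%:R -> cyl m z.
Proof.
rewrite /dist mulr0 !mul0r !addr0 => zm.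
rewrite /cyl/window/=; split.
  by rewrite (le_trans _ zm)// -sqrtr_sqr ler_wsqrtr// lerDl sqr_ge0.
by rewrite (le_trans _ zm)// -sqrtr_sqr ler_wsqrtr// lerDr sqr_ge0.
Qed.

Lemma measurable_radial : measurable_fun setT radial.
Proof.
apply: measurable_funD; apply: measurable_funM.
- exact: (measurableT_comp measurable_fst measurable_snd).
- by apply: measurableT_comp => //; apply: continuous_measurable_fun; exact: continuous_cos.
- exact: (measurableT_comp measurable_snd measurable_snd).
- by apply: measurableT_comp => //; apply: continuous_measurable_fun; exact: continuous_sin.
Qed.

Lemma measurable_sqdist0 : measurable_fun setT sqdist0.
Proof.
apply: measurable_funD; apply: measurable_funX.
- exact: (measurableT_comp measurable_fst measurable_snd).
- exact: (measurableT_comp measurable_snd measurable_snd).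
Qed.

Lemma measurable_dist d (S : measurableType d) (f : S -> T) (g : S -> R) :
  measurable_fun setT f -> measurable_fun setT g ->
  measurable_fun setT (fun x => dist (f x) (g x)).
Proof.
move=> mf mg.
rewrite (_ : (fun x => _) = fun x => Num.sqrt (sqdist0 (f x) + 2 * v * g x * radial (f x) + (v * g x) ^+ 2)); last first.
  by apply/funext => x; rewrite -dist_sqr sqrtr_sqr ger0_norm// dist_ge0.
apply: measurableT_comp; first by apply: continuous_measurable_fun; exact: sqrt_continuous.
apply: measurable_funD.
  apply: measurable_funD; first exact: measurableT_comp measurable_sqdist0 _.
  apply: measurable_funM; first exact: measurable_funM.
  exact: measurableT_comp measurable_radial _.
by apply: measurable_funX; apply: measurable_funM.
Qed.

(** At every time the stations still form, angle by angle, a translate of the initial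
configuration; hence the marks of the stations in a disc of radius h have measure pi h^2,
whatever the time. *)
Lemma muZ_ball s h : 0 <= h -> muZ R [set z | dist z s < h] = (pi * h ^+ 2)%:E.
Proof.
move=> h0.
have mE : measurable (setT `*` disc h : set T) by apply: measurableX => //; exact: measurable_disc.
have := @muZ_affine R 1 (fun t => v * s * cos t) (fun t => v * s * sin t) _ ltr01 _ _ mE.
rewrite expr1n mul1e muZX//; last exact: measurable_disc.
rewrite unifR_T mul1e mu2_disc// => ->.
- congr (muZ R _); apply/seteqP.
  have e z : (dist z s < h) = ((z.2.1 + v * s * cos z.1) ^+ 2 + (z.2.2 + v * s * sin z.1) ^+ 2 < h ^+ 2).
    by rewrite -(ltr_pXn2r (_ : (0 < 2)%N)) ?nnegrE ?dist_ge0// sqr_sqrtr// addr_ge0// sqr_ge0.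
  by split => z /=; rewrite e /disc/= !mul1r => // -[].
- by apply: measurable_funM => //; apply: continuous_measurable_fun; exact: continuous_cos.
- by apply: measurable_funM => //; apply: continuous_measurable_fun; exact: continuous_sin.
Qed.

Definition crossing : set (T * T) := [set p | radial p.1 != radial p.2].

(** The squared distances of two stations differ by an affine function of time with slope
2v (radial p.1 - radial p.2); this is its zero. *)
Definition ctime p : R := (sqdist0 p.2 - sqdist0 p.1) / (2 * v * (radial p.1 - radial p.2)).

Definition cdist p : R := dist p.1 (ctime p).

Lemma tieP p s : crossing p -> (dist p.1 s = dist p.2 s) <-> s = ctime p.
Proof.
rewrite /crossing/= -subr_eq0 => r0.
have e : (dist p.1 s = dist p.2 s) <-> (dist p.1 s ^+ 2 = dist p.2 s ^+ 2).
  split=> [->//|/eqP]; rewrite eqrXn2 ?dist_ge0// => /eqP//.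
rewrite e !dist_sqr /ctime; split.
  move=> h; have d0 : 2 * v * (radial p.1 - radial p.2) != 0 by rewrite mulf_neq0// gt_eqF// mulr_gt0.
  apply: (mulIf d0); rewrite divfK//; lra.
move=> ->; field.
by rewrite r0 gt_eqF.
Qed.

Lemma cdistE p : crossing p -> dist p.2 (ctime p) = cdist p.
Proof. by move=> cp; apply/esym; apply/(tieP _ cp). Qed.

Lemma measurable_crossing : measurable crossing.
Proof.
rewrite (_ : crossing = ~` ((fun p => radial p.1 - radial p.2) @^-1` [set 0])).
  apply: measurableC; rewrite -[X in measurable X]setTI.
  suff : measurable_fun setT (fun p => radial p.1 - radial p.2) by apply => //; exact: measurable_set1.
  by apply: measurable_funB; apply: measurableT_comp measurable_radial _.
by apply/seteqP; split => p /=; rewrite /crossing/= -subr_eq0 => /eqP.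
Qed.

Lemma measurable_ctime : measurable_fun setT ctime.
Proof.
apply: measurable_funM.
  by apply: measurable_funB; apply: measurableT_comp measurable_sqdist0 _.
apply: measurableT_comp; first exact: measurable_invr.
apply: measurable_funM => //.
by apply: measurable_funB; apply: measurableT_comp measurable_radial _.
Qed.

Lemma measurable_cdist : measurable_fun setT cdist.
Proof. by apply: measurable_dist => //; exact: measurable_ctime. Qed.

(** The pairs of stations that are equidistant from the user at a time in I and then at a distance
in J. *)
Definition ties (I J : set R) : set (T * T) :=
  crossing `&` (ctime @^-1` I `&` cdist @^-1` J).

Lemma measurable_ties I J : measurable I -> measurable J -> measurable (ties I J).
Proof.
move=> mI mJ; apply: measurableI; first exact: measurable_crossing.
apply: measurableI.
  by rewrite -[X in measurable X]setTI; exact: measurable_ctime.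
by rewrite -[X in measurable X]setTI; exact: measurable_cdist.
Qed.

Lemma ties_cyl I J (a r : R) m : (forall s, I s -> `|s| <= a) -> (forall h, J h -> h <= r) ->
  r + v * a <= m%:R -> ties I J `<=` cyl m `*` cyl m.
Proof.
move=> Ia Jr rm p [cp [/= Ip Jp]].
have va : v * `|ctime p| <= v * a by rewrite ler_pM2l// Ia.
by split; apply: window_dist0; apply: le_trans rm; apply: (le_trans (dist_dist0 _ (ctime p)));
  apply: lerD => //; rewrite ?cdistE//; exact: Jr.
Qed.

End kinematics.

(** * The mean number of ties with one nearer station *)

Section handover_mean.
Context {d : measure_display} {Omega : measurableType d} {R : realType}.
Variables (P : probability Omega R) (lambda v : R) (X : nat -> {RV P >-> (R * R)%type})
  (Theta : nat -> {RV P >-> R}).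
Hypotheses (lambda_ge0 : 0 <= lambda) (v_gt0 : 0 < v) (Phi_poisson : homogeneous_poisson lambda X)
  (Theta_uniform : forall i, uniform_angle (Theta i))
  (Theta_indep : mutually_independent Theta)
  (X_Theta_indep : independent_families X Theta).
Local Notation T := (R * (R * R))%type.
Local Notation lf := (locally_finite X).
Local Notation mk := (marked X Theta).

Definition nearer (p : T * T) : set T := [set z | dist v z (ctime v p) < cdist v p].

Let grid n (x : R) : nat := Num.truncn (x * n.+1%:R).

Let grid_le n (x : R) : 0 <= x -> (grid n x)%:R / n.+1%:R <= x :> R.
Proof.
move=> x0; rewrite ler_pdivrMr ?ltr0n//.
by rewrite truncn_le mulr_ge0.
Qed.

Let grid_gt n (x : R) : 0 <= x -> x < (grid n x)%:R / n.+1%:R + n.+1%:R^-1.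
Proof.
move=> x0; rewrite -[X in _ + X]mul1r -mulrDl ltr_pdivlMr ?ltr0n//.
by rewrite natr1 truncnS_gt.
Qed.

Let grid_dist n (x : R) : 0 <= x -> `|x - (grid n x)%:R / n.+1%:R| <= n.+1%:R^-1.
Proof.
move=> x0; rewrite ger0_norm ?subr_ge0 ?grid_le//.
by rewrite lerBlDl ltW ?grid_gt.
Qed.

Let rad n j : R := j%:R / n.+1%:R - v / n.+1%:R.

(** The nearer stations of a pair are discretised by rounding the crossing time and distance
down to the grid of mesh 1/(n+1).  The radius is reduced by v/(n+1): since distances are
v-Lipschitz in time, neither member of the pair is then counted as nearer than the pair. *)
Lemma expectation_handover (B : set R) (r : R) (m : nat) : measurable B ->
  (forall h, B h -> h <= r) -> r + v <= m%:R ->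
  measurable_fun lf (fun w => pair_count R (mk w) (lonely X Theta (ties v `[0, 1] B) nearer w)) /\
  (\int[P]_(w in lf) pair_count R (mk w) (lonely X Theta (ties v `[0%R, 1%R] B) nearer w) =
   \int[muZZ R]_(p in ties v `[0%R, 1%R] B)
     (lambda ^+ 2 * poisson1 (lambda * (pi * cdist v p ^+ 2)))%R%:E)%E.
Proof.
move=> mB Br rm.
have Fc (p : T * T) : ties v `[0%R, 1%R] B p -> [/\ crossing p, 0 <= ctime v p <= 1, B (cdist v p) & 0 <= cdist v p].
  by move=> [cp [/= + Bp]]; rewrite in_itv/= => Ip; split => //; exact: dist_ge0.
pose label (n : nat) (p : T * T) := choice.pickle (grid n (ctime v p), grid n (cdist v p)).
pose D (n k : nat) : set T := if (pickle_inv k : option (nat * nat)) is Some (i, j) then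
   [set z | dist v z (i%:R / n.+1%:R) < rad n j] `&` [set _ | i%:R / n.+1%:R <= 1 :> R /\ j%:R / n.+1%:R <= r]
  else set0.
have DE (n : nat) (p : T * T) : ties v `[0%R, 1%R] B p ->
    D n (label n p) = [set z | dist v z ((grid n (ctime v p))%:R / n.+1%:R) < rad n (grid n (cdist v p))].
  move=> /Fc[_ /andP[t0 t1] Bp h0]; rewrite /D /label pickleK_inv.
  apply/seteqP; split => [z []//|z zd]; split => //; split.
    by rewrite (le_trans _ t1)// grid_le.
  by rewrite (le_trans _ (Br _ Bp))// grid_le.
have N0 (n : nat) : 0 < n.+1%:R^-1 :> R by rewrite invr_gt0.
have small (e : R) : 0 < e -> \forall n \near \oo, n.+1%:R^-1 < e.
  move=> e0; have := @near_infty_natSinv_lt R (PosNum e0); exact.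
apply: (@expectation_lonely _ _ _ P lambda X Theta lambda_ge0 Phi_poisson Theta_uniform
  Theta_indep X_Theta_indep m (ties v `[0%R, 1%R] B) nearer D label (fun p => pi * cdist v p ^+ 2)).
- exact: measurable_ties.
- apply: (@ties_cyl _ v v_gt0 _ _ 1 r) => //; last by rewrite mulr1.
  by move=> s /=; rewrite in_itv/= => /andP[s0 s1]; rewrite ger0_norm.
- move=> p /Fc[_ /andP[t0 t1] Bp h0] z /= zp; apply: window_dist0.
  apply: le_trans rm; apply: (le_trans (dist_dist0 v_gt0 _ (ctime v p))); apply: lerD.
    by rewrite (le_trans (ltW zp))// Br.
  by rewrite ger0_norm// -[leRHS]mulr1 ler_pM2l.
- move=> n k; rewrite /D; case: pickle_inv => [[i j]|//].
  apply: measurableI; last first.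
    case: (pselect (i%:R / n.+1%:R <= 1 :> R /\ j%:R / n.+1%:R <= r)) => [h|h].
      by rewrite (_ : [set _ | _] = setT)//; apply/seteqP; split.
    by rewrite (_ : [set _ | _] = set0)//; apply/seteqP; split.
  rewrite -[X in measurable X]setTI.
  rewrite (_ : [set z | _] = (fun z => dist v z (i%:R / n.+1%:R)) @^-1` `]-oo, rad n j[%classic).
    by apply: measurable_dist.
  by apply/seteqP; split => z /=; rewrite in_itv.
- move=> n k z; rewrite /D; case: pickle_inv => [[i j]|//] [/= zd [i1 jr]].
  apply: window_dist0; apply: le_trans rm; apply: (le_trans (dist_dist0 v_gt0 _ (i%:R / n.+1%:R))).
  apply: lerD.
    rewrite (le_trans (ltW zd))// (le_trans _ jr)// /rad gerBl.
    by rewrite divr_ge0// ltW.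
  by rewrite ger0_norm ?divr_ge0// -[leRHS]mulr1 ler_pM2l.
- move=> n k; case e : (pickle_inv k : option (nat * nat)) => [[i j]|]; last first.
    rewrite (_ : _ `&` _ = set0)// -subset0 => p [_ /= h].
    by move: e; rewrite -h /label pickleK_inv.
  have kE : (choice.pickle (i, j) = k).
    by have := @pickle_invK (nat * nat)%type k; rewrite e.
  have mg (f : T * T -> R) i' : measurable_fun setT f ->
      measurable [set p | i'%:R <= f p * n.+1%:R < i'.+1%:R].
    move=> mf; rewrite -[X in measurable X]setTI.
    rewrite (_ : [set p | _] = (fun p => f p * n.+1%:R) @^-1` `[i'%:R, i'.+1%:R[%classic).
      by apply: measurable_funM.
    by apply/seteqP; split => p /=; rewrite in_itv.
  rewrite (_ : _ `&` _ = ties v `[0%R, 1%R] B `&` ([set p | i%:R <= ctime v p * n.+1%:R < i.+1%:R] `&`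
     [set p | j%:R <= cdist v p * n.+1%:R < j.+1%:R])); last first.
    apply/seteqP; split => p [Fp] /=.
      rewrite -kE /label => /(pcan_inj (@choice.pickleK _)) [<- <-]; split => //.
      have [_ /andP[t0 t1] _ h0] := Fc _ Fp.
      by split; apply: truncn_itv; rewrite mulr_ge0.
    move=> [hi hj]; split => //; rewrite -kE /label /grid.
    by rewrite (truncn_def hi) (truncn_def hj).
  apply: measurableI; first exact: measurable_ties.
  by apply: measurableI; apply: mg; [exact: measurable_ctime|exact: measurable_cdist].
- move=> n p Fp; rewrite (DE _ _ Fp).
  have [cp /andP[t0 t1] Bp h0] := Fc _ Fp.
  have out z : dist v z (ctime v p) = cdist v p ->
     ~ dist v z ((grid n (ctime v p))%:R / n.+1%:R) < rad n (grid n (cdist v p)).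
    move=> zc; apply/negP; rewrite -leNgt /rad lerBlDr.
    apply: (le_trans (grid_le n h0)); rewrite -zc.
    apply: (le_trans (dist_lipschitz v_gt0 z _ ((grid n (ctime v p))%:R / n.+1%:R))).
    by rewrite lerD2l ler_pM2l// grid_dist.
  by split; apply: out => //; exact: cdistE.
- move=> p z Fp; have [cp /andP[t0 t1] Bp h0] := Fc _ Fp.
  have [zp|zp] := ltP (dist v z (ctime v p)) (cdist v p); last first.
    apply: nearW => n; rewrite (DE _ _ Fp); split; last by rewrite /nearer/= ltNge zp.
    rewrite /= /rad ltrBrDr => h; exfalso; move: zp; apply/negP; rewrite -ltNge.
    apply: le_lt_trans (lt_le_trans h (grid_le n h0)).
    apply: (le_trans (dist_lipschitz v_gt0 z _ ((grid n (ctime v p))%:R / n.+1%:R))).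
    by rewrite lerD2l ler_pM2l// grid_dist.
  (* Rounding costs v/(n+1) in the distance of z and (v+1)/(n+1) in the radius. *)
  have e0 : 0 < (cdist v p - dist v z (ctime v p)) / (2 * v + 1).
    by rewrite divr_gt0 ?subr_gt0// addr_gt0// mulr_gt0.
  near=> n; rewrite (DE _ _ Fp); split => // _ /=.
  have : n.+1%:R^-1 < (cdist v p - dist v z (ctime v p)) / (2 * v + 1).
    by near: n; exact: small.
  rewrite ltr_pdivlMr ?addr_gt0 ?mulr_gt0// => hn.
  apply: (le_lt_trans (dist_lipschitz v_gt0 z _ (ctime v p))).
  have := grid_gt n h0; have := grid_dist n t0; rewrite distrC -(ler_pM2l v_gt0) /rad.
  move: hn; rewrite mulrDr mulr1 (mulrCA _ 2) (mulrC _ v).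
  move: (n.+1%:R^-1) (v / n.+1%:R) ((grid n (cdist v p))%:R / n.+1%:R) (v * `|_|) => a b c e; lra.
- move=> p Fp; have [cp /andP[t0 t1] Bp h0] := Fc _ Fp.
  pose rho n := Num.max 0 (rad n (grid n (cdist v p))).
  (* A negative radius gives the empty ball, like the radius 0. *)
  have rhoE n : fine (muZ R (D n (label n p))) = pi * rho n ^+ 2.
    rewrite (DE _ _ Fp) (_ : [set z | _] = [set z | dist v z ((grid n (ctime v p))%:R / n.+1%:R) < rho n]).
      by rewrite muZ_ball// le_max lexx.
    apply/seteqP; split => z /=; rewrite /rho lt_max; first by move=> ->; rewrite orbT.
    by case/orP => //; rewrite ltNge dist_ge0.
  have rhoc : rho n @[n --> \oo] --> cdist v p.
    apply/cvgrPdist_lt => e e0; near=> n.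
    have : n.+1%:R^-1 < e / (1 + v) by near: n; apply: small; rewrite divr_gt0// addr_gt0.
    rewrite ltr_pdivlMr ?addr_gt0// => hn.
    apply: le_lt_trans hn; have := grid_dist n h0; have := grid_le n h0; rewrite /rho /rad.
    have := mulr_gt0 v_gt0 (N0 n).
    rewrite mulrDr mulr1 (mulrC _ v).
    move: (n.+1%:R^-1) (v / n.+1%:R) ((grid n (cdist v p))%:R / n.+1%:R) => a b c b0 cp'.
    rewrite (ger0_norm (_ : 0 <= _ - c)) ?subr_ge0// => ca.
    by case: (lerP 0 (c - b)) => bc; rewrite ger0_norm; lra.
  under eq_fun do rewrite rhoE.
  by apply: cvgMl_tmp; apply: cvgM.
Unshelve. all: by end_near.
Qed.

End handover_mean.

(** * The intensity of ties, by scaling *)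

Section image_density.
Local Open Scope ereal_scope.
Context d1 d2 (X : measurableType d1) (Y : measurableType d2) (R : realType).
Variables (mu : {measure set X -> \bar R}) (nu : {measure set Y -> \bar R}).
Variables (E : set X) (phi : X -> Y) (w : Y -> \bar R).
Hypotheses (mE : measurable E) (mphi : measurable_fun setT phi).
Hypotheses (mw : measurable_fun setT w) (w0 : forall y, 0 <= w y)
  (wfin : forall y, w y \is a fin_num).
Hypothesis density : forall B, measurable B -> mu (E `&` phi @^-1` B) = \int[nu]_(y in B) w y.
Import HBNNSimple.

Let density_simple (f : {nnsfun Y >-> R}) :
  \int[mu]_(x in E) (f (phi x))%:E = \int[nu]_y ((f y)%:E * w y).
Proof.
have mpre k : measurable (phi @^-1` (f @^-1` [set k])).
  by rewrite -[X in measurable X]setTI; exact: mphi.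
have k0 (k : R) : k \in range f -> (0 <= k)%R by move=> /set_mem[y _ <-].
transitivity (\sum_(k \in range f) k%:E * mu (E `&` phi @^-1` (f @^-1` [set k]))).
  under eq_integral do rewrite fimfunE -fsumEFin//.
  rewrite ge0_integral_fsum//; last 2 first.
  - move=> k; apply/measurable_EFinP/measurable_funM => //.
    by apply: measurable_funTS; apply: (measurableT_comp _ mphi).
  - by move=> k x _; rewrite nnfun_muleindic_ge0.
  apply: eq_fsbigr => k /k0 kr.
  under eq_integral do rewrite EFinM.
  rewrite ge0_integralZl//; last first.
    apply/measurable_EFinP; apply: measurable_funTS.
    by apply: (measurableT_comp _ mphi).
  by rewrite -[fun x => _]/(fun x => (\1_(phi @^-1` (f @^-1` [set k])) x)%:E) integral_indic// setIC.
transitivity (\sum_(k \in range f) \int[nu]_y (k%:E * ((\1_(f @^-1` [set k]) y)%:E * w y))).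
  apply: eq_fsbigr => k /k0 kr; rewrite density// ge0_integralZl//; last 2 first.
  - by apply: emeasurable_funM => //; apply/measurable_EFinP.
  - by move=> y _; rewrite mule_ge0// lee_fin.
  congr (_ * _); rewrite [LHS]integral_mkcond; apply: eq_integral => y _.
  by rewrite patchE indicE; case: ifP; rewrite ?mul1e ?mul0e.
rewrite -ge0_integral_fsum//; last 2 first.
- move=> k; apply: emeasurable_funM => //; apply: emeasurable_funM => //.
  by apply/measurable_EFinP.
- move=> k y _; rewrite muleA -EFinM mule_ge0//.
  by rewrite nnfun_muleindic_ge0.
apply: eq_integral => y _; rewrite [in RHS]fimfunE -fsumEFin// ge0_mule_fsuml//.
  by apply: eq_fsbigr => k _; rewrite muleA -EFinM.
by move=> k; rewrite nnfun_muleindic_ge0.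
Qed.

(** If the image of mu restricted to E under phi has density w with respect to nu, integrals of
functions of phi are integrals against w; by linearity and monotone convergence from the case
of indicators. *)
Lemma integral_image_density (g : Y -> \bar R) : measurable_fun setT g -> (forall y, 0 <= g y) ->
  \int[mu]_(x in E) g (phi x) = \int[nu]_y (g y * w y).
Proof.
move=> mg g0; pose f_ := nnsfun_approx measurableT mg.
transitivity (limn (fun n => \int[mu]_(x in E) (f_ n (phi x))%:E)).
  rewrite -monotone_convergence//.
  - apply: eq_integral => x _; apply/esym/cvg_lim => //.
    by apply: cvg_nnsfun_approx => //.
  - move=> n; apply/measurable_EFinP; apply: measurable_funTS.
    by apply: (measurableT_comp _ mphi).
  - by move=> n y _; rewrite lee_fin.
  - by move=> y _ m n mn; rewrite lee_fin; exact/lefP/nd_nnsfun_approx.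
rewrite [X in limn X](_ : _ = fun n => \int[nu]_y ((f_ n y)%:E * w y)); last first.
  by apply/funext => n; exact: density_simple.
rewrite -monotone_convergence//.
- apply: eq_integral => y _; apply/cvg_lim => //.
  apply: cvgeZr; first exact: wfin.
  by apply: cvg_nnsfun_approx.
- by move=> n; apply: emeasurable_funM => //; apply/measurable_EFinP.
- by move=> n y _; rewrite mule_ge0// lee_fin.
- by move=> y _ m n mn; rewrite lee_wpmul2r// lee_fin; exact/lefP/nd_nnsfun_approx.
Qed.

End image_density.

(** Cauchy's equation on the nonnegative half-line: an additive nonnegative function is monotone,
and comparing with the neighbouring integers of n a gives n |f a - a f 1| <= f 1 for
every n. *)
Lemma additive_linear (R : realType) (f : R -> R) : (forall a, 0 <= a -> 0 <= f a) ->
  (forall a b, 0 <= a -> 0 <= b -> f (a + b) = f a + f b) ->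
  forall a, 0 <= a -> f a = a * f 1.
Proof.
move=> f0 fD a a0.
have f00 : f 0 = 0 by have := fD 0 0 (lexx _) (lexx _); rewrite addr0; lra.
have fM b n : 0 <= b -> f (n%:R * b) = n%:R * f b.
  move=> b0; elim: n => [|n IH]; first by rewrite !mul0r.
  by rewrite -natr1 !mulrDl !mul1r fD ?IH// mulr_ge0.
have mono b c : 0 <= b -> b <= c -> f b <= f c.
  by move=> b0 bc; rewrite -(subrK b c) addrC fD ?subr_ge0// lerDl f0// subr_ge0.
have f10 : 0 <= f 1 by exact: f0.
(* j = floor (n a) satisfies j <= n a < j + 1. *)
have key n : n%:R * `|f a - a * f 1| <= f 1.
  have na0 : 0 <= n%:R * a by rewrite mulr_ge0.
  have /andP[l u] := truncn_itv na0; move: (Num.truncn _) l u => j l u.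
  have h1 : j%:R * f 1 <= n%:R * f a.
    by rewrite -!fM// mulr1; apply: mono.
  have h2 : n%:R * f a <= (j%:R + 1) * f 1.
    by rewrite natr1 -!fM// mulr1; apply: mono => //; exact: ltW.
  have h3 : j%:R * f 1 <= n%:R * a * f 1 by rewrite ler_wpM2r.
  have h4 : n%:R * a * f 1 <= (j%:R + 1) * f 1 by rewrite ler_wpM2r// natr1 ltW.
  rewrite -[X in X * `|_|]ger0_norm// -normrM ler_norml mulrBr mulrA.
  by rewrite mulrDl mul1r in h2 h4; apply/andP; split; lra.
apply/eqP; rewrite -subr_eq0 -normr_eq0; apply/negP => /negP e0.
have e1 : 0 < `|f a - a * f 1| by rewrite lt_neqAle eq_sym e0 normr_ge0.
have := key (Num.truncn (f 1 / `|f a - a * f 1|)).+1.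
by apply/negP; rewrite -ltNge -ltr_pdivrMr// truncnS_gt.
Qed.

Lemma null_bigcup d (T : measurableType d) (R : realType) (mu : {measure set T -> \bar R})
    (F : (set T)^nat) :
  (forall n, measurable (F n)) -> (forall n, mu (F n) = 0%E) -> mu (\bigcup_n F n) = 0%E.
Proof.
move=> mF F0; apply: measure_negligible; first exact: bigcup_measurable.
by apply: negligible_bigcup => n; exists (F n); split; [exact: mF|exact: F0|exact: subset_refl].
Qed.

Section parallel.
Context {R : realType}.
Local Notation T := (R * (R * R))%type.

Definition origin : set T := setT `*` [set (0, 0)].

Let originE : origin = setT `*` ([set 0] `*` [set 0]).
Proof.
rewrite /origin; congr (_ `*` _).
by apply/seteqP; split => [_ -> //|[x y] [/= -> ->]].
Qed.

Lemma measurable_origin : measurable origin.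
Proof. by rewrite originE; apply: measurableX => //; exact: measurableX. Qed.

Lemma muZ_origin : muZ R origin = 0%E.
Proof.
rewrite originE muZX//; last exact: measurableX.
by rewrite mu2X// lebRE lebesgue_measure_set1 mul0e mule0.
Qed.

(** For a fixed initial point other than the origin, the radial component is a nontrivial
trigonometric function of the angle, whose level sets are null. *)
Lemma muZ_radial_level (c : R) : muZ R [set z | radial z = c] = 0%E.
Proof.
have mL : measurable [set z : T | radial z = c].
  rewrite -[X in measurable X]setTI.
  exact: (measurable_radial measurableT (measurable_set1 c)).
have mO := measurable_origin; have O0 := muZ_origin; set O := origin in mO O0.
pose L := [set z : T | radial z = c] `\` O.
have mLO : measurable L by exact: measurableD.
apply/eqP; rewrite eq_le measure_ge0 andbT.
apply: (@le_trans _ _ (muZ R (O `|` L))).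
  apply: le_measure; rewrite ?inE//; first exact: measurableU.
  by move=> z zc; have [zO|zO] := pselect (O z); [left|right].
apply: (le_trans (measureU2 _ mO mLO)); rewrite [X in (X + _)%E]O0 add0e.
rewrite [X in (X <= _)%E](_ : _ = (\int[muZ R]_z (\1_L z)%:E)%E); last by rewrite integral_indic// setIT.
rewrite integral_muZ//; last by apply/measurable_EFinP.
rewrite integral0_eq// => x _.
have [x0|x0] := pselect (x = (0, 0)).
  apply: integral0_eq => t _; rewrite indicE memNset// => -[_]; apply; split => //=.
rewrite (_ : (fun t => _) = fun t => (\1_[set t | x.1 * cos t + x.2 * sin t = c] t)%:E); last first.
  apply/funext => t; rewrite !indicE; congr ((nat_of_bool _)%:R%:E).
  apply/idP/idP; rewrite !inE; first by case.
  by move=> h; split => // -[_ /= xx]; exact: x0.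
have mS : measurable [set t : R | x.1 * cos t + x.2 * sin t = c].
  rewrite -[X in measurable X]setTI.
  have mf : measurable_fun setT (fun t : R => x.1 * cos t + x.2 * sin t).
    apply: measurable_funD; apply: measurable_funM => //; apply: continuous_measurable_fun.
      exact: continuous_cos.
    exact: continuous_sin.
  exact: (mf measurableT _ (measurable_set1 c)).
rewrite integral_indic// setIT; apply: unifR_level.
by move: x0; case: x {mS}.
Qed.

(** By Fubini it suffices to fix one station of the pair. *)
Lemma parallel_null : muZZ R (~` crossing) = 0%E.
Proof.
have mC : measurable (~` @crossing R) by apply: measurableC; exact: measurable_crossing.
rewrite muZZ_section// integral0_eq// => z _.
apply: etrans (muZ_radial_level (radial z)); congr (muZ R _).
apply/seteqP; split => y; rewrite /xsection/= inE /crossing/=.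
  by move=> /negP; rewrite negbK => /eqP.
by move=> ->; rewrite eqxx.
Qed.

End parallel.

Section power_rays.
Context {R : realType}.
Variables (a : R) (n : nat).
Hypothesis a_ge0 : 0 <= a.

Let dens (h : R) : R := a * n.+2%:R * Num.max 0 h ^+ n.+1.

Let dens_ge0 h : 0 <= dens h.
Proof. by rewrite !mulr_ge0// exprn_ge0// le_max lexx. Qed.

Let measurable_dens : measurable_fun setT dens.
Proof.
by apply: measurable_funM => //; apply: measurable_funX; exact: measurable_maxr.
Qed.

Let integral_dens_ray r :
  (\int[lebR R]_(h in `]-oo, r[) (dens h)%:E = (a * Num.max 0 r ^+ n.+2)%:E)%E.
Proof.
rewrite ge0_integral_lebR//; last 2 first.
- by apply: measurable_funTS; apply/measurable_EFinP; exact: measurable_dens.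
- by move=> h _; rewrite lee_fin.
have [r0|r0] := leP r 0.
  rewrite expr0n/= mulr0; apply: integral0_eq => h /=; rewrite in_itv/= => hr.
  by rewrite /dens (max_idPl (le_trans (ltW hr) r0)) expr0n/= mulr0.
transitivity (\int[lebesgue_measure]_(h in `[0%R, r[) (a * n.+2%:R * h ^+ n.+1)%:E)%E.
  rewrite integral_mkcond [RHS]integral_mkcond; apply: eq_integral => h _.
  rewrite !patchE !mem_setE !in_itv/= /dens.
  have [h0//|h0] := leP 0 h.
  by rewrite expr0n/= mulr0; case: ifP.
rewrite integral_itv_bndo_bndc; last first.
  by apply: measurable_funTS; apply/measurable_EFinP; apply: measurable_funM.
pose F (y : R) : R := a * y ^+ n.+2.
have dF (x : R) : is_derive x (1 : R) F (a * n.+2%:R * x ^+ n.+1).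
  have -> : F = a *: (@id R ^+ n.+2) by rewrite exprfctE.
  by apply: is_derive_eq; rewrite /= /GRing.scale/= mulr1 mulrA.
have cF (x : R) : {for x, continuous F}.
  by apply: differentiable_continuous; apply/derivable1_diffP; exact: ex_derive.
rewrite (@continuous_FTC2 R _ F)//.
- by rewrite /F -EFinB expr0n/= mulr0 subr0.
- have cf : continuous (fun x : R => a * n.+2%:R * x ^+ n.+1).
    by move=> x; apply: cvgM; [exact: cvg_cst|exact: exprn_continuous].
  exact: continuous_subspaceT cf.
- split.
  + by move=> x _; apply: ex_derive.
  + by apply: cvg_at_right_filter; exact: cF.
  + by apply: cvg_at_left_filter; exact: cF.
- by move=> x _; rewrite derive1E derive_val.
Qed.

(** A measure of the rays proportional to a power of the right end determines a density; the
rays form a generating pi-system of sets of finite measure. *)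
Lemma density_of_power_rays (m1 : {measure set R -> \bar R}) :
  (forall r, m1 `]-oo, r[%classic = (a * Num.max 0 r ^+ n.+2)%:E) ->
  forall B, measurable B ->
  m1 B = (\int[lebR R]_(h in B) (a * n.+2%:R * Num.max 0 h ^+ n.+1)%:E)%E.
Proof.
move=> m1_ray B mB.
pose m2 (C : set R) := (\int[lebR R]_(h in C) (dens h)%:E)%E.
have m20 : m2 set0 = 0%E by rewrite /m2 integral_set0.
have m2ge0 C : (0 <= m2 C)%E by apply: integral_ge0 => h _; rewrite lee_fin.
have m2sigma : semi_sigma_additive m2.
  move=> F mF tF mUF; rewrite /m2 ge0_integral_bigcup//.
  - apply: is_cvg_nneseries => k _ _; exact: m2ge0.
  - by apply: measurable_funTS; apply/measurable_EFinP; exact: measurable_dens.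
  - by move=> h _; rewrite lee_fin.
pose m2m : {measure set R -> \bar R} := HB.pack m2 (isMeasure.Build _ _ _ m2 m20 m2ge0 m2sigma).
rewrite -[RHS]/(m2m B).
apply: (measure_unique (@RGenInftyO.G R) (fun k => `]-oo, k%:R[%classic)) => //.
- exact: RGenInftyO.measurableE.
- move=> _ _ [x ->] [y ->]; exists (Num.min x y).
  by apply/seteqP; split => z /=; rewrite !in_itv/= lt_min; [move=> [-> ->]|move=> /andP[]].
- by move=> k; exists k%:R.
- rewrite -subTset => x _; exists (Num.truncn x).+1 => //=.
  by rewrite in_itv/= truncnS_gt.
- by move=> _ [r ->]; rewrite m1_ray -integral_dens_ray.
- by move=> k; rewrite m1_ray ltry.
Qed.

End power_rays.

Section tie_intensity.
Context {R : realType}.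
Variable v : R.
Hypothesis v_gt0 : 0 < v.
Local Notation T := (R * (R * R))%type.
Local Notation ties := (ties v).

(** Dilating the plane by c and advancing every station along its trajectory by time t
transforms distances by dist z s -> c dist z ((s + t) / c). *)
Lemma ties_affine (c t : R) (I J : set R) : 0 < c -> measurable I -> measurable J ->
  muZZ R (ties I J) =
  ((c ^+ 4)%:E * muZZ R (ties ((fun x => c * x - t)%R @^-1` I) ((fun x => c * x)%R @^-1` J)))%E.
Proof.
move=> c0 mI mJ.
rewrite (@muZZ_affine R c (fun a => v * t * cos a) (fun a => v * t * sin a))//; last 3 first.
- by apply: measurable_funM => //; apply: continuous_measurable_fun; exact: continuous_cos.
- by apply: measurable_funM => //; apply: continuous_measurable_fun; exact: continuous_sin.
- exact: measurable_ties.
congr (_ * muZZ R _)%E.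
pose f (z : T) : T := (z.1, (c * z.2.1 + v * t * cos z.1, c * z.2.2 + v * t * sin z.1)).
have distf z s : dist v (f z) (c * s - t) = c * dist v z s.
  rewrite -[RHS]ger0_norm; last by rewrite mulr_ge0 ?dist_ge0// ltW.
  rewrite -sqrtr_sqr exprMn sqr_sqrtr ?addr_ge0 ?sqr_ge0//.
  by rewrite /dist/=; congr Num.sqrt; ring.
have radf z : radial (f z) = c * radial z + v * t.
  transitivity (c * radial z + v * t * (cos z.1 ^+ 2 + sin z.1 ^+ 2)); last by rewrite cos2Dsin2 mulr1.
  by rewrite /radial/=; ring.
have crossf p : crossing (f p.1, f p.2) <-> crossing p.
  rewrite /crossing/= !radf (inj_eq (addIr _)) (inj_eq (mulfI _))//.
  by rewrite gt_eqF.
have ctf p : crossing p -> ctime v (f p.1, f p.2) = c * ctime v p - t.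
  move=> cp; apply/esym/tieP => //; first exact/crossf.
  by rewrite /= !distf; congr (c * _); apply/(tieP v_gt0 _ cp).
have cdf p : crossing p -> cdist v (f p.1, f p.2) = c * cdist v p.
  by move=> cp; rewrite /cdist/= ctf// distf.
apply/seteqP; split => p; rewrite /ties/= -!/(f _).
  by move=> [/crossf cp]; rewrite ctf// cdf.
by move=> [cp]; rewrite -ctf// -cdf// => -[? ?]; split => //; exact/crossf.
Qed.

Lemma ties_translate (t : R) (I J : set R) : measurable I -> measurable J ->
  muZZ R (ties I J) = muZZ R (ties ((fun x => x - t)%R @^-1` I) J).
Proof.
move=> mI mJ; rewrite (@ties_affine 1 t)// expr1n mul1e.
by congr (muZZ R (ties _ _)); apply/funext => x /=; rewrite /preimage/= mul1r.
Qed.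

Lemma ties_fin (I J : set R) (a r : R) : measurable I -> measurable J ->
  (forall s, I s -> `|s| <= a) -> (forall h, J h -> h <= r) ->
  muZZ R (ties I J) \is a fin_num.
Proof.
move=> mI mJ Ia Jr.
pose m := (Num.truncn (r + v * a)).+1.
rewrite ge0_fin_numE//.
apply: (@le_lt_trans _ _ (muZZ R (cyl m `*` cyl m))).
  apply: le_measure; rewrite ?inE; [exact: measurable_ties| |].
    by apply: measurableX; exact: measurable_cyl.
  by apply: (ties_cyl v_gt0 Ia Jr); exact/ltW/truncnS_gt.
rewrite muZZX; [|exact: measurable_cyl|exact: measurable_cyl].
by rewrite lte_mul_pinfty// ?muZ_cyl// ge0_fin_numE ?muZ_cyl.
Qed.

(** The measure of the pairs crossing during a time interval of length a at a distance less
than r. *)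
Let G (a r : R) : R := fine (muZZ R (ties `[0, a[ `]-oo, r[)).

Let I0a (a s : R) : `[0, a[%classic s -> `|s| <= a.
Proof. by rewrite /= in_itv/= => /andP[s0 /ltW sa]; rewrite ger0_norm. Qed.

Let Jr (r h : R) : `]-oo, r[%classic h -> h <= r.
Proof. by rewrite /= in_itv/= => /ltW. Qed.

Let GE a r : muZZ R (ties `[0%R, a[ `]-oo, r[) = (G a r)%:E.
Proof. by rewrite fineK//; apply: (@ties_fin _ _ a r) => //; [exact: I0a|exact: Jr]. Qed.

Let G_ge0 a r : 0 <= G a r. Proof. by rewrite fine_ge0. Qed.

Let GD (r a b : R) : 0 <= a -> 0 <= b -> G (a + b) r = G a r + G b r.
Proof.
move=> a0 b0; apply: EFin_inj; rewrite EFinD -!GE.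
rewrite [in RHS](@ties_translate a `[0, b[)//.
rewrite -measureU; last 3 first.
- by apply: measurable_ties.
- apply: measurable_ties => //; rewrite -[X in measurable X]setTI.
  have mf : measurable_fun setT (fun x : R => x - a) by apply: measurable_funB.
  exact: mf.
- apply/seteqP; split => p //= -[[_ [+ _]] [_ [+ _]]].
  rewrite /preimage/= !in_itv/= => /andP[h1 h2] /andP[h3 h4]; lra.
congr (muZZ R _); apply/seteqP; split => p.
  move=> [cp [/= + hp]]; rewrite in_itv/= => /andP[t0 tab].
  have [ta|ta] := ltP (ctime v p) a; [left|right]; split => //; split => //=.
    by rewrite in_itv/= t0.
  by rewrite in_itv/=; apply/andP; split; lra.
by move=> [|] [cp [/= + hp]]; rewrite in_itv/= => /andP[t0 tab]; split => //; split => //=;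
  rewrite in_itv/=; apply/andP; split; lra.
Qed.

Let Gl (a r : R) : 0 <= a -> G a r = a * G 1 r.
Proof. by apply: (@additive_linear R (G^~ r)) => // *; exact: GD. Qed.

(** The coefficient of h^2 in the density of crossing distances per unit time: three times the
measure of the pairs crossing at distance less than 1. *)
Definition tie_rate : R := 3 * G 1 1.

Let Gcube (r : R) : 0 < r -> G 1 r = r ^+ 3 * G 1 1.
Proof.
move=> r0; apply: EFin_inj; rewrite -GE (@ties_affine r 0)//.
rewrite (_ : (fun x => _) @^-1` `[0, 1[ = `[0, r^-1[%classic); last first.
  apply/seteqP; split => x /=; rewrite !in_itv/= subr0 pmulr_rge0// mulrC.
    by move=> /andP[-> ]; rewrite -ltr_pdivlMr// mul1r.
  by move=> /andP[-> ]; rewrite -[_ < 1]ltr_pdivlMr// mul1r.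
rewrite (_ : _ @^-1` `]-oo, r[ = `]-oo, 1[%classic); last first.
  by apply/seteqP; split => x; rewrite /preimage/= !in_itv/= -{2}[r]mulr1 ltr_pM2l.
rewrite GE (@Gl r^-1) ?invr_ge0 ?(ltW r0)// -EFinM; congr EFin; field.
by rewrite gt_eqF.
Qed.

(** By translation the measure is that of crossings at time 0, which is at most the measure for an
arbitrarily short interval, and the latter is proportional to its length. *)
Lemma null_tie_time (t : R) (J : set R) : measurable J -> muZZ R (ties [set t] J) = 0%E.
Proof.
move=> mJ; pose J' n := J `&` `]-oo, n%:R[.
have mJ' n : measurable (J' n) by exact: measurableI.
have null n : muZZ R (ties [set t] (J' n)) = 0%E.
  rewrite (@ties_translate (- t))//.
  apply/eqP; rewrite eq_le measure_ge0 andbT; apply/lee_addgt0Pr => e e0.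
  rewrite add0e.
  have C0 : 0 < G 1 n%:R + 1 by rewrite ltr_pwDr.
  pose a := e / (G 1 n%:R + 1).
  have a0 : 0 < a by rewrite divr_gt0.
  apply: (@le_trans _ _ (muZZ R (ties `[0, a[ `]-oo, n%:R[))).
    apply: le_measure; rewrite ?inE.
    - apply: measurable_ties => //; rewrite -[X in measurable X]setTI.
      have mf : measurable_fun setT (fun x : R => x - - t) by apply: measurable_funB.
      exact: (mf measurableT _ (measurable_set1 t)).
    - exact: measurable_ties.
    - move=> p [cp [/= tp [Jp np]]]; split => //; split => //=.
      by rewrite in_itv/=; apply/andP; split; lra.
  rewrite GE (@Gl a)// ?(ltW a0)// lee_fin.
  rewrite -[leRHS](@divfK _ (G 1 n%:R + 1)) ?gt_eqF// -/a ler_pM2l//.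
  by rewrite lerDl.
rewrite (_ : ties [set t] J = \bigcup_n ties [set t] (J' n)); last first.
  apply/seteqP; split => p; last by move=> [n _ [cp [tp [Jp _]]]].
  move=> [cp [tp Jp]]; exists (Num.truncn (cdist v p)).+1 => //; split => //; split => //; split => //=.
  by rewrite in_itv/= truncnS_gt.
apply: null_bigcup => // n; exact: measurable_ties.
Qed.

Let muZZ_setT_neq0 : muZZ R setT <> 0%E.
Proof.
pose A := [set z | dist v z 0 < 1].
have mA : measurable A.
  rewrite -[X in measurable X]setTI (_ : A = (fun z => dist v z 0) @^-1` `]-oo, 1[%classic).
    by apply: measurable_dist.
  by apply/seteqP; split => z /=; rewrite in_itv.
move=> h.
have : (muZZ R (A `*` A) <= 0)%E.
  by rewrite -h; apply: le_measure; rewrite ?inE//; exact: measurableX.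
rewrite muZZX// muZ_ball// expr1n mulr1 -EFinM lee_fin.
by apply/negP; rewrite -ltNge mulr_gt0// pi_gt0.
Qed.

(** Otherwise, by scaling and translation, almost no pair would cross at all; but almost every pair
has different linear coefficients and therefore crosses. *)
Lemma tie_rate_gt0 : 0 < tie_rate.
Proof.
rewrite mulr_gt0// lt_neqAle G_ge0 andbT; apply/negP => /eqP G0.
apply: muZZ_setT_neq0; rewrite -(setvU crossing) measureU; last 3 first.
- by apply: measurableC; exact: measurable_crossing.
- exact: measurable_crossing.
- by rewrite setICl.
rewrite [X in (X + _)%E]parallel_null add0e.
rewrite (_ : crossing = \bigcup_n ties `[- n.+1%:R, n.+1%:R[ `]-oo, n.+1%:R[); last first.
  apply/seteqP; split => p; last by move=> [n _ []].
  move=> cp; pose M := Num.max `|ctime v p| (cdist v p).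
  have h : M < (Num.truncn M).+1%:R by exact: truncnS_gt.
  move: h; rewrite {1}/M gt_max => /andP[h1 h2]; exists (Num.truncn M) => //; split => //; split => /=.
    by rewrite in_itv/=; move: h1; rewrite ltr_norml => /andP[h3 h4]; rewrite (ltW h3).
  by rewrite in_itv.
apply: null_bigcup => n; first exact: measurable_ties.
apply: etrans (@ties_translate n.+1%:R _ _ _ _) _ => //.
rewrite (_ : (fun x => _) @^-1` _ = `[0, n.+1%:R + n.+1%:R[%classic); last first.
  by apply/seteqP; split => x /=; rewrite !in_itv/= lerBrDr addNr ltrBlDr.
by rewrite GE Gl ?addr_ge0// Gcube// -G0 !mulr0.
Qed.

Let ties_ray r : muZZ R (ties `[0, 1] `]-oo, r[) = (G 1 1 * Num.max 0 r ^+ 3)%:E.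
Proof.
rewrite (_ : ties _ _ = ties `[0, 1[ `]-oo, r[ `|` ties [set 1] `]-oo, r[); last first.
  apply/seteqP; split => p.
    move=> [cp [/= + hp]]; rewrite in_itv/= => /andP[t0].
    rewrite le_eqVlt => /orP[/eqP t1|t1]; [right|left]; split => //; split => //=.
    by rewrite in_itv/= t0.
  move=> [|] [cp [/= + hp]]; first rewrite in_itv/= => /andP[t0 t1].
    by split => //; split => //=; rewrite in_itv/= t0 ltW.
  by move=> t1; split => //; split => //=; rewrite in_itv/= t1 ler01 lexx.
rewrite measureU//; last 3 first.
- exact: measurable_ties.
- exact: measurable_ties.
- apply/seteqP; split => p //= -[[_ [h1 _]] [_ [h2 _]]].
  by move: h1; rewrite /preimage/= h2 in_itv/= ltxx andbF.
rewrite [X in (_ + X)%E]null_tie_time// adde0 [LHS]GE; congr EFin.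
have [r0|r0] := leP r 0; last first.
  rewrite (Gcube r0).
  by rewrite mulrC.
rewrite expr0n/= mulr0; apply: EFin_inj; rewrite -GE.
rewrite (_ : ties _ _ = set0) ?measure0// -subset0 => p [_ [_ /=]].
by rewrite in_itv/= ltNge (le_trans r0)// dist_ge0.
Qed.

Lemma tie_intensity (B : set R) : measurable B ->
  muZZ R (ties `[0, 1] B) = (\int[lebR R]_(h in B) (tie_rate * Num.max 0 h ^+ 2)%:E)%E.
Proof.
move=> mB.
have mcd : measurable_fun setT (cdist v) by exact: measurable_cdist.
have mtT : measurable (ties `[0, 1] setT) by exact: measurable_ties.
pose m1 : {measure set R -> \bar R} :=
  measure_function_pushforward__canonical__measure_function_Measure
    (mrestr (muZZ R) mtT) mcd.
have m1E C : m1 C = muZZ R (ties `[0, 1] C).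
  rewrite [LHS](_ : _ = muZZ R (cdist v @^-1` C `&` ties `[0, 1] setT))//.
  congr (muZZ R _); apply/seteqP; split => p; first by move=> [? [? []]].
  by move=> [? []].
rewrite -m1E (@density_of_power_rays R (G 1 1) 1 (G_ge0 1 1) m1 _ _ mB).
  by apply: eq_integral => h _; rewrite /tie_rate mulrC (mulrC 3) mulrC.
by move=> r; rewrite m1E ties_ray.
Qed.

End tie_intensity.

(** * Handovers along one configuration *)

Lemma ncount_eq1 (R : realType) (T : Type) (z : nat -> T) (C : set T) :
  ncount R z C = 1%E <-> exists! l, C (z l).
Proof.
have f0 k : (0 <= (\1_C (z k))%:E :> \bar R)%E by rewrite lee_fin.
split=> [n1|[l [Cl lC]]]; last first.
  rewrite /ncount (@single_term_series _ _ l)//.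
    by rewrite indicE mem_set.
  by move=> k kl; rewrite indicE memNset// => /lC lk; apply: kl.
have [l Cl] : exists l, C (z l).
  apply: contrapT => h; move: n1; rewrite /ncount eseries0; last first.
    by move=> k _ _; rewrite indicE memNset// => Ck; apply: h; exists k.
  by move=> /eqP; rewrite eqe eq_sym oner_eq0.
exists l; split => // k Ck; apply: contrapT => lk; move: n1; rewrite /ncount.
rewrite (@nneseriesD1 _ _ l xpredT (fun k _ => f0 k))//.
rewrite (@nneseriesD1 _ _ k _ (fun k _ => f0 k))//=; last first.
  by apply/eqP => kl; apply: lk.
rewrite !indicE !mem_set//= => e.
have : (1%:E + (1%:E + 0%:E) <= 1%:E :> \bar R)%E.
  rewrite -[leRHS]e; apply: leeD => //; apply: leeD => //.
  exact: nneseries_ge0.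
by rewrite -!EFinD lee_fin; lra.
Qed.

Lemma pair_count_esum (R : realType) (T : Type) (z : nat -> T) (E : set (T * T)) :
  (pair_count R z E = \esum_(k in [set k : nat * nat | k.1 <> k.2 /\ E (z k.1, z k.2)]) 1)%E.
Proof.
have c0 i j : (0 <= (if i == j then 0 else (\1_E (z i, z j))%:E) :> \bar R)%E.
  by case: ifP => // _; rewrite lee_fin.
rewrite /pair_count nneseries_esumT; last by move=> i; apply: nneseries_ge0.
rewrite (eq_esum (b := fun i => \esum_(j in setT) (if i == j then 0 else (\1_E (z i, z j))%:E)))%E; last first.
  by move=> i _; rewrite nneseries_esumT.
rewrite (esum_esum (J := fun=> setT)) => [|i j _ _]; last exact: c0.
rewrite (_ : _ `*`` _ = setT); last by apply/seteqP; split.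
rewrite [RHS]esum_mkcond; apply: eq_esum => -[i j] _ /=.
case: eqVneq => [->|/eqP ij].
  by rewrite memNset// => -[].
rewrite indicE; case: ifPn => [|h].
  by rewrite inE => -[_ Eij]; rewrite mem_set.
by rewrite memNset// => Eij; move: h; rewrite notin_setE => h; apply: h.
Qed.

Section pathwise.
Context {R : realType}.
Variables (v : R) (z : nat -> R * (R * R)).
Hypothesis v_gt0 : 0 < v.
Hypothesis cross : forall i j, i <> j -> crossing (z i, z j).
Hypothesis no_triple : forall i j k (s : R), i <> j -> i <> k -> j <> k -> 0 <= s <= 1 ->
  dist v (z i) s = dist v (z j) s -> dist v (z k) s <> dist v (z i) s.

Definition handover s h :=
  (exists i j, [/\ i <> j, dist v (z i) s = h & dist v (z j) s = h]) /\
  (exists! l, dist v (z l) s < h).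

(** A pair at a smaller distance h would give two stations nearer than h'. *)
Lemma handover_unique s h h' : handover s h -> handover s h' -> h = h'.
Proof.
wlog hh : h h' / h < h'.
  move=> H H1 H2; have [lt|gt|//] := ltgtP h h'; first exact: H.
  by apply/esym; exact: H.
move=> [[i [j [ij hi hj]]] _] [_ [l [_ lu]]]; exfalso; apply: ij.
by rewrite -(lu i) ?hi// -(lu j) ?hj.
Qed.

Lemma handover_xget s h : handover s h -> xget 0 [set h | handover s h] = h.
Proof. by move=> sh; apply: xget_unique => // h' sh'; exact: handover_unique sh' sh. Qed.

Variable B : set R.

Definition handover_times := [set s | exists h, handover s h].
Definition handover_distance s := xget 0 [set h | handover s h].

Let lonely_pairs := ties v `[0, 1] B `&` [set p | ncount R z (nearer v p) = 1%E].
Let W := handover_times `&` `[0, 1] `&` [set s | B (handover_distance s)].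
Let Q := [set k : nat * nat | k.1 <> k.2 /\ lonely_pairs (z k.1, z k.2)].

Let QP k : Q k -> [/\ handover (ctime v (z k.1, z k.2)) (cdist v (z k.1, z k.2)),
  0 <= ctime v (z k.1, z k.2) <= 1 & B (cdist v (z k.1, z k.2))].
Proof.
move=> [ij [[cij [/= + Bh]] /ncount_eq1 l1]]; rewrite in_itv/= => s01; split => //.
split; last exact: l1.
by exists k.1, k.2; split => //; exact: (cdistE v_gt0 cij).
Qed.

Let bij (o : nat -> nat -> bool) : (forall i j, i <> j -> o i j = ~~ o j i) ->
  set_bij (Q `&` [set k | o k.1 k.2]) W (fun k => ctime v (z k.1, z k.2)).
Proof.
move=> oP; split.
- move=> k [/QP[hk s01 Bh] _]; split; first split; first by exists (cdist v (z k.1, z k.2)).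
  + by rewrite /= in_itv.
  + by rewrite /= /handover_distance (handover_xget hk).
- move=> [i j] [i' j'] /set_mem[Qk ok] /set_mem[Qk' ok'] /= e.
  have [hk s01 Bh] := QP Qk; have [hk' _ _] := QP Qk'.
  rewrite /= in hk hk' s01 Bh ok ok'.
  rewrite -e in hk'; have hh := handover_unique hk hk'.
  have [/= ij [/= cij _]] := Qk; have [/= ij' [/= cij' _]] := Qk'.
  have di : dist v (z i) (ctime v (z i, z j)) = cdist v (z i, z j) by [].
  have dj : dist v (z j) (ctime v (z i, z j)) = cdist v (z i, z j) by exact: (cdistE v_gt0 (cross ij)).
  have di' : dist v (z i') (ctime v (z i, z j)) = cdist v (z i, z j) by rewrite hh e.
  have dj' : dist v (z j') (ctime v (z i, z j)) = cdist v (z i, z j).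
    by rewrite hh e; exact: (cdistE v_gt0 (cross ij')).
  have mem k : dist v (z k) (ctime v (z i, z j)) = cdist v (z i, z j) -> k = i \/ k = j.
    move=> dk; have [->|/eqP ki] := eqVneq k i; first by left.
    have [->|/eqP kj] := eqVneq k j; first by right.
    exfalso; apply: (@no_triple i j k _ ij (nesym ki) (nesym kj) s01); first by rewrite di dj.
    by rewrite dk di.
  have [ii|ii] := mem _ di'; have [jj|jj] := mem _ dj'; subst i' j' => //.
  by move: ok; rewrite oP// ok'.
- move=> s [[[h hs] s01] Bs]; rewrite /= /handover_distance (handover_xget hs) in Bs.
  have [[i [j [ij hi hj]]] l1] := hs.
  have key a b : a <> b -> dist v (z a) s = h -> dist v (z b) s = h -> o a b ->
      exists2 k, (Q `&` [set k | o k.1 k.2]) k & ctime v (z k.1, z k.2) = s.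
    move=> ab ha hb oab; have cab := cross ab.
    have es : s = ctime v (z a, z b) by apply/(tieP v_gt0 _ cab); rewrite /= ha hb.
    have eh : cdist v (z a, z b) = h by rewrite /cdist -es.
    exists (a, b) => //; split => //; split => //; split => /=.
      by split => //; split => /=; rewrite -?es ?eh.
    by apply/ncount_eq1; rewrite /nearer /= -es eh.
  by have := oP _ _ ij; case oij: (o i j) => oji; [apply: (key i j)|apply: (key j i) => //; [exact: nesym|case: (o j i) oji]].
Qed.

(** Each handover time comes from exactly one unordered pair, because a second pair would make a
third station equidistant; it is counted once for each of the two orders of the pair. *)
Lemma pair_count_handovers :
  (pair_count R z lonely_pairs =
   2%:E * \esum_(t in handover_times `&` `[0%R, 1%R]) (\1_B (handover_distance t))%:E)%E.
Proof.
rewrite pair_count_esum (@esumID _ _ [set k : nat * nat | (k.1 < k.2)%N])//.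
have b1 : set_bij (Q `&` [set k | (k.1 < k.2)%N]) W (fun k => ctime v (z k.1, z k.2)).
  by apply: (@bij (fun i j => i < j)%N) => i j /eqP ij; rewrite ltn_neqAle ij leqNgt.
rewrite -(@reindex_esum R _ _ _ _ _ (fun=> 1%E) b1).
rewrite (_ : _ `&` ~` _ = Q `&` [set k | (k.2 < k.1)%N]); last first.
  apply/seteqP; split => -[i j] [[/= ij lij] /=].
    by move/negP; rewrite -leqNgt leq_eqVlt => /predU1P[/esym//|h]; split.
  by move=> h; split => //; apply/negP; rewrite -leqNgt ltnW.
have b2 : set_bij (Q `&` [set k | (k.2 < k.1)%N]) W (fun k => ctime v (z k.1, z k.2)).
  by apply: (@bij (fun i j => j < i)%N) => i j /eqP ij; rewrite ltn_neqAle eq_sym ij leqNgt.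
rewrite -(@reindex_esum R _ _ _ _ _ (fun=> 1%E) b2).
have -> : (\esum_(t in W) 1 =
    \esum_(t in handover_times `&` `[0%R, 1%R]) (\1_B (handover_distance t))%:E :> \bar R)%E.
  rewrite /W esum_mkcondr; apply: eq_esum => t _; rewrite indicE.
  by rewrite [t \in _](_ : _ = (handover_distance t \in B))//; case: (_ \in B).
by rewrite mule_natl mule2n.
Qed.

End pathwise.

(** * Almost sure regularity and the mean number of handovers *)

Section off_null.
Import HBNNSimple.

(** The integral of a nonnegative function is the supremum of the integrals of the simple functions
below it, so it ignores null sets even for functions that are not known to be measurable.  This is
needed for the sum over handover times, which is identified with a measurable function only
almost surely. *)
Lemma ge0_le_integral_off_null d (T : measurableType d) (R : realType)
    (mu : {measure set T -> \bar R}) (f g : T -> \bar R) :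
  (forall x, 0 <= f x)%E -> (forall x, 0 <= g x)%E ->
  (\forall x \ae mu, f x = g x) ->
  (\int[mu]_x f x <= \int[mu]_x g x)%E.
Proof.
move=> f0 g0 [N [mN N0 fgN]].
rewrite ge0_integralTE//; apply: ge_ereal_sup => _ [h hf <-].
pose h' := proj_nnsfun h (measurableC mN).
have h'E x : h' x = h x * \1_(~` N) x by rewrite /h' /= mindicE.
have -> : sintegral mu h = (\int[mu]_x (h' x)%:E)%E.
  rewrite -integralT_nnsfun; apply: ae_eq_integral => //; try by apply/measurable_EFinP.
  exists N; split => // x /= hx; apply: contrapT => Nx; apply: hx => _.
  by rewrite mindicE mem_set// mulr1.
rewrite integralT_nnsfun [leRHS]ge0_integralTE//; apply: ereal_sup_ubound.
exists h' => // x; rewrite h'E indicE.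
have [Nx|Nx] := pselect (N x); first by rewrite memNset ?mulr0// => /(_ Nx).
rewrite mem_set// mulr1 (le_trans (hf x))//.
have -> // : f x = g x.
by apply: contrapT => h1; apply: Nx; apply: fgN.
Qed.

Lemma ge0_integral_off_null d (T : measurableType d) (R : realType)
    (mu : {measure set T -> \bar R}) (f g : T -> \bar R) :
  (forall x, 0 <= f x)%E -> (forall x, 0 <= g x)%E ->
  (\forall x \ae mu, f x = g x) ->
  (\int[mu]_x f x = \int[mu]_x g x)%E.
Proof.
move=> f0 g0 fg; apply/eqP; rewrite eq_le !ge0_le_integral_off_null//.
by apply: filterS fg => x ->.
Qed.

End off_null.

Section handovers.
Context {d : measure_display} {Omega : measurableType d} {R : realType}.
Variables (P : probability Omega R) (lambda v : R) (X : nat -> {RV P >-> (R * R)%type})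
  (Theta : nat -> {RV P >-> R}).
Hypotheses (lambda_ge0 : 0 <= lambda) (v_gt0 : 0 < v) (Phi_poisson : homogeneous_poisson lambda X)
  (Theta_uniform : forall i, uniform_angle (Theta i))
  (Theta_indep : mutually_independent Theta)
  (X_Theta_indep : independent_families X Theta).
Local Notation T := (R * (R * R))%type.
Local Notation lf := (locally_finite X).
Local Notation mk := (marked X Theta).

(** The mean number of pairs in F and in a window vanishes, for every window. *)
Lemma ae_no_pair (F : set (T * T)) : measurable F -> muZZ R F = 0%E ->
  \forall w \ae P, forall i j, i <> j -> ~ F (mk w i, mk w j).
Proof.
move=> mF F0.
pose F_ m := F `&` (cyl m `*` cyl m).
have mF_ m : measurable (F_ m).
  by apply: measurableI => //; apply: measurableX; exact: measurable_cyl.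
have : \forall w \ae P, forall m, pair_count R (mk w) (F_ m) = 0%E.
  apply: ae_foralln => m.
  have mp : measurable_fun setT (fun w => pair_count R (mk w) (F_ m)) by exact: measurable_pair_count.
  have : (\int[P]_w `|pair_count R (mk w) (F_ m)| = 0)%E.
    under eq_integral do rewrite gee0_abs ?pair_count_ge0//.
    rewrite -(integral_locally_finite lambda_ge0 Phi_poisson)//; last first.
      by move=> w; exact: pair_count_ge0.
    rewrite (@expectation_pairs _ _ _ P lambda X Theta lambda_ge0 Phi_poisson Theta_uniform
      Theta_indep X_Theta_indep m)//; last by move=> p [].
    rewrite (_ : muZZ R _ = 0%E) ?mule0//; apply/eqP; rewrite eq_le measure_ge0 andbT -F0.
    by apply: le_measure; rewrite ?inE// => p [].
  by move=> /(ae_eq_integral_abs _ measurableT mp); apply: filterS => w; apply.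
apply: filterS => w h i j ij Fij.
have [m1 h1] := window_exhaust (X i w); have [m2 h2] := window_exhaust (X j w).
pose m := maxn m1 m2.
have : (1 <= pair_count R (mk w) (F_ m))%E.
  rewrite pair_count_esum; apply: esum_ge; exists [set (i, j)]; last by rewrite fsbig_set1.
  split; first exact: finite_set1.
  move=> _ ->; split => //=; split => //; split.
    exact: (window_nd (leq_maxl m1 m2) h1).
  exact: (window_nd (leq_maxr m1 m2) h2).
by rewrite h lee_fin ler10.
Qed.

Lemma ae_crossing : \forall w \ae P, forall i j, i <> j -> crossing (mk w i, mk w j).
Proof.
have mC : measurable (~` @crossing R) by apply: measurableC; exact: measurable_crossing.
apply: filterS (ae_no_pair mC parallel_null) => w h i j ij.
by apply: contrapT; exact: h.
Qed.

Lemma ae_point_neq0 : \forall w \ae P, forall i, X i w <> (0, 0).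
Proof.
have mF : measurable (@origin R `*` (setT : set T)) by apply: measurableX => //; exact: measurable_origin.
have F0 : muZZ R (@origin R `*` (setT : set T)) = 0%E.
  by rewrite muZZX ?muZ_origin ?mul0e//; exact: measurable_origin.
apply: filterS (ae_no_pair mF F0) => w h i Xi.
by apply: (h i i.+1); [exact/eqP/negbT/ltn_eqF|].
Qed.

Lemma ae_ctime_neq0 : \forall w \ae P, forall i j, i <> j -> ctime v (mk w i, mk w j) <> 0.
Proof.
have mF : measurable (ties v [set 0] setT) by exact: measurable_ties.
have := ae_no_pair mF (null_tie_time v_gt0 0 measurableT).
apply: filterS2 ae_crossing => w hc h i j ij t0; apply: (h i j ij).
by split; [exact: hc|split].
Qed.

(** Fix all the stations except for the angle of the k-th one.  If k joins the tie of i and j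
at the nonzero time ctime, its angle lies in a level set of a nontrivial trigonometric function,
which is null. *)
Let ae_no_triple_at i j k : i <> k -> j <> k ->
  \forall w \ae P, ~ [/\ crossing (mk w i, mk w j), ctime v (mk w i, mk w j) <> 0, X k w <> (0, 0) &
    dist v (mk w k) (ctime v (mk w i, mk w j)) = cdist v (mk w i, mk w j)].
Proof.
move=> ik jk.
pose S : set (other_algebra X Theta k * R) :=
  [set q | [/\ crossing (mk q.1 i, mk q.1 j), ctime v (mk q.1 i, mk q.1 j) <> 0, X k q.1 <> (0, 0) &
    dist v (q.2, X k q.1) (ctime v (mk q.1 i, mk q.1 j)) = cdist v (mk q.1 i, mk q.1 j)]].
have mmk l : l <> k -> measurable_fun setT (fun q : other_algebra X Theta k * R => mk q.1 l).
  move=> lk; apply: measurable_fun_pair.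
    have lk' : l != k by exact/eqP.
    by apply: (measurableT_comp (@measurable_other_Theta _ _ _ P X Theta k l lk')).
  by apply: (measurableT_comp (@measurable_other_X _ _ _ P X Theta k l)).
have mp : measurable_fun setT (fun q : other_algebra X Theta k * R => (mk q.1 i, mk q.1 j)).
  by apply: measurable_fun_pair; exact: mmk.
have mXk : measurable_fun setT (fun q : other_algebra X Theta k * R => X k q.1).
  by apply: (measurableT_comp (@measurable_other_X _ _ _ P X Theta k k)).
have mct : measurable_fun setT (fun q : other_algebra X Theta k * R => ctime v (mk q.1 i, mk q.1 j)).
  exact: (measurableT_comp (measurable_ctime v) mp).
have mpre (A : set (T * T)) : measurable A ->
    measurable [set q : other_algebra X Theta k * R | A (mk q.1 i, mk q.1 j)].
  by move=> mA; rewrite -[X in measurable X]setTI; exact: mp.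
have m00 : measurable [set ((0, 0) : R * R)].
  rewrite (_ : [set _] = [set 0] `*` [set 0]); first exact: measurableX.
  by apply/seteqP; split => [_ -> //|[x y] [/= -> ->]].
pose W := (other_algebra X Theta k * R)%type.
pose fC : set W := [set q | crossing (mk q.1 i, mk q.1 j)].
pose fT (q : W) : R := ctime v (mk q.1 i, mk q.1 j).
pose fX (q : W) : R * R := X k q.1.
pose fD (q : W) : R := dist v (q.2, X k q.1) (ctime v (mk q.1 i, mk q.1 j)) - cdist v (mk q.1 i, mk q.1 j).
have mS : measurable S.
  rewrite (_ : S = fC `&` (fT @^-1` (~` [set 0]) `&` (fX @^-1` (~` [set (0, 0)]) `&` fD @^-1` [set 0]))).
    apply: measurableI; first by apply: mpre; exact: measurable_crossing.
    apply: measurableI.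
      by rewrite -[X in measurable X]setTI; apply: mct => //; exact: measurableC.
    apply: measurableI.
      by rewrite -[X in measurable X]setTI; apply: mXk => //; exact: measurableC.
    rewrite -[X in measurable X]setTI.
    have mf : measurable_fun setT fD.
      apply: measurable_funB; last exact: (measurableT_comp (measurable_cdist v) mp).
      by apply: measurable_dist => //; exact: measurable_fun_pair.
    exact: (mf measurableT _ (measurable_set1 0)).
  apply/seteqP; split => q.
    by move=> [h1 h2 h3 h4]; split => //; split => //; split => //; rewrite /fD/= h4 subrr.
  by move=> [h1 [h2 [h3 /eqP]]]; rewrite subr_eq0 => /eqP h4; split.
have := @average_mark _ _ _ P X Theta Theta_uniform Theta_indep X_Theta_indep k (fun q => (\1_S q)%:E).
have -> : (\int[P]_w \int[unifR R]_t (\1_S ((w : other_algebra X Theta k), t))%:E = 0)%E.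
  rewrite integral0_eq// => w _.
  have [[cp s0 Xk]|bad] := pselect [/\ crossing (mk w i, mk w j), ctime v (mk w i, mk w j) <> 0 & X k w <> (0, 0)]; last first.
    by apply: integral0_eq => t _; rewrite indicE memNset// => -[? ? ? _]; apply: bad.
  set s := ctime v _ in s0; pose x := X k w.
  pose c := (cdist v (mk w i, mk w j) ^+ 2 - (v * s) ^+ 2 - (x.1 ^+ 2 + x.2 ^+ 2)) / (2 * v * s).
  have v0 : v != 0 by rewrite gt_eqF.
  have s0' : s != 0 by exact/eqP.
  rewrite (_ : (fun t => _) = fun t => (\1_[set t | x.1 * cos t + x.2 * sin t = c] t)%:E); last first.
    apply/funext => t; rewrite !indicE; congr ((nat_of_bool _)%:R%:E).
    have dE := dist_sqr v (t, x) s; rewrite /sqdist0 /radial/= in dE.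
    apply/idP/idP; rewrite !inE.
      move=> [_ _ _ /= h]; rewrite -/s -/x in h; rewrite h in dE; rewrite /c dE.
      by field; rewrite s0' v0.
    move=> /= h; split => //=; rewrite -/s -/x.
    apply/eqP; rewrite -(@eqrXn2 _ 2) ?dist_ge0//; apply/eqP; rewrite dE h /c.
    by field; rewrite s0' v0.
  have mL : measurable [set t : R | x.1 * cos t + x.2 * sin t = c].
    rewrite -[X in measurable X]setTI.
    have mf : measurable_fun setT (fun t : R => x.1 * cos t + x.2 * sin t).
      apply: measurable_funD; apply: measurable_funM => //; apply: continuous_measurable_fun.
        exact: continuous_cos.
      exact: continuous_sin.
    exact: (mf measurableT _ (measurable_set1 c)).
  rewrite integral_indic// setIT; apply: unifR_level.
  by rewrite -surjective_pairing.
move=> h.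
have mSw : measurable [set w | S (w, Theta k w)].
  have midl : measurable_fun setT (id : Omega -> other_algebra X Theta k).
    move=> _ A mA; rewrite setTI.
    apply: (smallest_sub _ (@measurable_other_cylinders _ _ _ P X Theta k)) mA.
    exact: sigma_algebra_measurable.
  have mW : measurable_fun setT (fun w : Omega => ((w : other_algebra X Theta k), Theta k w)).
    exact: measurable_fun_pair.
  by rewrite -[X in measurable X]setTI; exact: mW.
exists [set w | S (w, Theta k w)]; split => //.
  rewrite -[RHS]h//; last by apply/measurable_EFinP.
  transitivity (\int[P]_w (\1_[set w | S (w, Theta k w)] w)%:E)%E; last by [].
  by rewrite integral_indic// setIT.
by move=> w /contrapT [h1 h2 h3 h4]; split.
Qed.

Lemma ae_no_triple : \forall w \ae P, forall i j k s, i <> j -> i <> k -> j <> k -> 0 <= s <= 1 ->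
  dist v (mk w i) s = dist v (mk w j) s -> dist v (mk w k) s <> dist v (mk w i) s.
Proof.
have h : \forall w \ae P, forall i j k, i <> k -> j <> k ->
   ~ [/\ crossing (mk w i, mk w j), ctime v (mk w i, mk w j) <> 0, X k w <> (0, 0) &
    dist v (mk w k) (ctime v (mk w i, mk w j)) = cdist v (mk w i, mk w j)].
  apply: ae_foralln => i; apply: ae_foralln => j; apply: ae_foralln => k.
  have [->|/eqP ik] := eqVneq i k; first by apply: aeW.
  have [->|/eqP jk] := eqVneq j k; first by apply: aeW.
  by apply: filterS (ae_no_triple_at ik jk) => w ? _ _.
apply: filterS2 (filterI ae_crossing ae_ctime_neq0) (filterI ae_point_neq0 h).
move=> w [cr ct] [xn tr] i j k s ij ik jk _ dij dk.
have es : s = ctime v (mk w i, mk w j) by apply/(tieP v_gt0 _ (cr _ _ ij)).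
apply: (tr i j k ik jk); split; [exact: cr|exact: ct|exact: xn|].
by rewrite -es dk /cdist -es.
Qed.

(** Half of lambda^2 P(one nearer station) times the density of crossing distances: the mean
number of handovers per unit time and unit distance. *)
Definition handover_density (h : R) : R :=
  lambda ^+ 2 / 2 * tie_rate v * (poisson1 (lambda * (pi * h ^+ 2)) * Num.max 0 h ^+ 2).

Let ties01 := ties v `[0, 1].
Let handover_pairs B w := pair_count R (mk w) (lonely X Theta (ties01 B) (nearer v) w).

Let rate2 (h : R) : \bar R := (lambda ^+ 2 * poisson1 (lambda * (pi * h ^+ 2)))%:E.
Let dens (h : R) : \bar R := (tie_rate v * Num.max 0 h ^+ 2)%:E.

Let rate2_ge0 h : (0 <= rate2 h)%E.
Proof.
rewrite lee_fin mulr_ge0 ?exprn_ge0// poisson1_ge0// mulr_ge0// mulr_ge0 ?sqr_ge0//.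
by rewrite ltW// pi_gt0.
Qed.

Let dens_ge0 h : (0 <= dens h)%E.
Proof. by rewrite lee_fin mulr_ge0 ?sqr_ge0// ltW// tie_rate_gt0. Qed.

Let measurable_rate2 : measurable_fun setT rate2.
Proof.
apply/measurable_EFinP; apply: measurable_funM => //.
have m2 : measurable_fun setT (fun h : R => lambda * (pi * h ^+ 2)).
  by apply: measurable_funM => //; apply: measurable_funM.
apply: measurable_funM => //.
by apply: (measurableT_comp (@measurable_expR R)); exact: measurableT_comp.
Qed.

Let measurable_dens : measurable_fun setT dens.
Proof.
apply/measurable_EFinP; apply: measurable_funM => //; apply: measurable_funX; exact: measurable_maxr.
Qed.

Let handover_pairs_bounded (B : set R) (r : R) : measurable B -> (forall h, B h -> h <= r) ->
  measurable_fun lf (handover_pairs B) /\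
  (\int[P]_(w in lf) handover_pairs B w = \int[lebR R]_(h in B) (rate2 h * dens h))%E.
Proof.
move=> mB Br.
have rm : r + v <= (Num.truncn (r + v)).+1%:R by exact/ltW/truncnS_gt.
have [mh ->] := @expectation_handover _ _ _ P lambda v X Theta lambda_ge0 v_gt0 Phi_poisson
  Theta_uniform Theta_indep X_Theta_indep B r _ mB Br rm.
split => //.
pose g h := (rate2 h * (\1_B h)%:E)%E.
have mties C : measurable C -> measurable (ties01 C) by move=> mC; exact: measurable_ties.
transitivity (\int[muZZ R]_(p in ties01 setT) g (cdist v p))%E.
  rewrite integral_mkcond [RHS]integral_mkcond; apply: eq_integral => p _; rewrite !patchE /g.
  have [pB|pB] := pselect (ties01 B p).
    have [cp [tp Bp]] := pB.
    by rewrite !mem_set//= ?indicE ?mem_set// mule1.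
  rewrite memNset//; case: ifPn => //; rewrite inE => -[cp [tp _]].
  by rewrite indicE memNset ?mule0// => Bp; apply: pB; split.
have mg : measurable_fun setT g by apply: emeasurable_funM => //; apply/measurable_EFinP.
rewrite (@integral_image_density _ _ _ _ _ (muZZ R) (lebR R) (ties01 setT) (cdist v) dens) //.
- rewrite [RHS]integral_mkcond; apply: eq_integral => h _; rewrite patchE /g indicE.
  by case: ifP => _; rewrite ?mule1// mule0 mul0e.
- exact: mties.
- exact: measurable_cdist.
- move=> C mC; rewrite -(tie_intensity v_gt0 mC); congr (muZZ R _).
  by apply/seteqP; split => p; [move=> [[? [? _]] ?]; split|move=> [? [? ?]]; split].
- by move=> h; rewrite /g mule_ge0// lee_fin.
Qed.

(** An arbitrary B is cut into the pieces in [n, n+1[, each of them bounded. *)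
Let handover_pairs_mean (B : set R) : measurable B ->
  measurable_fun lf (handover_pairs B) /\
  (\int[P]_(w in lf) handover_pairs B w = \int[lebR R]_(h in B) (rate2 h * dens h))%E.
Proof.
move=> mB; pose B_ n := B `&` `[n%:R, n.+1%:R[.
have mB_ n : measurable (B_ n) by exact: measurableI.
have hn n : measurable_fun lf (handover_pairs (B_ n)) /\
  (\int[P]_(w in lf) handover_pairs (B_ n) w = \int[lebR R]_(h in B_ n) (rate2 h * dens h))%E.
  apply: (@handover_pairs_bounded (B_ n) n.+1%:R (mB_ n)).
  by move=> h [_ /=]; rewrite in_itv/= => /andP[_ /ltW].
have cell p n : `[n%:R, n.+1%:R[%classic (cdist v p) <-> n = Num.truncn (cdist v p).
  rewrite /= in_itv/=; split; first by move/truncn_def.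
  by move=> ->; apply: truncn_itv; exact: dist_ge0.
have sumE w : handover_pairs B w = (\sum_(n <oo) handover_pairs (B_ n) w)%E.
  rewrite /handover_pairs (@pair_count_sum _ _ _ _ (fun=> 1%E) (fun n => lonely X Theta (ties01 (B_ n)) (nearer v) w))//.
    by apply: eq_eseriesr => n _; rewrite mul1e.
  move=> p; rewrite (@single_term_series _ _ (Num.truncn (cdist v p))).
  - rewrite mul1e !indicE; congr ((nat_of_bool _)%:R%:E).
    apply/idP/idP; rewrite !inE => -[[cp [tp Bp]] np]; split => //; split => //; split => //.
      by split => //; apply/cell.
    by case: Bp.
  - by move=> k; rewrite mul1e lee_fin.
  - move=> k kp; rewrite mul1e indicE memNset// => -[[cp [tp [_ /cell Bp]]] _].
    exact: kp.
have mR : measurable_fun setT (fun h => rate2 h * dens h)%E by exact: emeasurable_funM.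
split.
  apply: (eq_measurable_fun (fun w => \sum_(n <oo) handover_pairs (B_ n) w)%E).
    by move=> w _; rewrite sumE.
  apply: ge0_emeasurable_sum => [k w _ _|k _]; first exact: pair_count_ge0.
  by have [] := hn k.
under eq_integral do rewrite sumE.
rewrite integral_nneseries//; last 3 first.
- exact: measurable_lf.
- by move=> n; have [] := hn n.
- by move=> n w _; exact: pair_count_ge0.
under eq_eseriesr => n _ do rewrite (hn n).2.
rewrite -ge0_integral_bigcup//; last 3 first.
- exact: measurable_funTS.
- by move=> h _; rewrite mule_ge0.
- move=> i j _ _ [h [[_ hi] [_ hj]]]; move: hi hj; rewrite /= !in_itv/= => hi hj.
  by rewrite -(truncn_def hi) (truncn_def hj).
rewrite integral_mkcond [RHS]integral_mkcond; apply: eq_integral => h _; rewrite !patchE.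
have [Bh|Bh] := pselect (B h); last first.
  by rewrite !memNset// => -[n _ []].
rewrite [h \in B]mem_set//; have [h0|h0] := leP 0 h.
  rewrite mem_set//; exists (Num.truncn h) => //; split => //=.
  by rewrite in_itv/= truncn_itv.
rewrite memNset; first by rewrite /dens (max_idPl (ltW h0)) expr0n/= mulr0 mule0.
move=> [n _ [_]] /=; rewrite in_itv/= => /andP[nh _].
by move: h0; rewrite ltNge (le_trans _ nh).
Qed.

Lemma expectation_handovers (B : set R) : measurable B ->
  (\int[P]_w (\esum_(t in V_I X Theta v w `&` `[0%R, 1%R]) (\1_B (H_I X Theta v t w))%:E) =
   \int[lebR R]_(h in B) (handover_density h)%:E)%E.
Proof.
move=> mB; have [mh eh] := handover_pairs_mean mB.
have mlf : measurable lf := measurable_lf X.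
transitivity (\int[P]_w (2^-1%:E * ((handover_pairs B) \_ lf) w))%E.
  apply: ge0_integral_off_null.
  - by move=> w; apply: esum_ge0 => t _; rewrite lee_fin.
  - move=> w; rewrite mule_ge0// ?lee_fin// patchE.
    by case: ifP => // _; exact: pair_count_ge0.
  have aelf : \forall w \ae P, lf w.
    exists (~` lf); split => //; first exact: measurableC.
    by rewrite probability_setC// (locally_finite_as lambda_ge0 Phi_poisson) subee.
  apply: filterS2 (filterI ae_crossing ae_no_triple) aelf => w [cr nt] lw.
  rewrite patchE mem_set// /handover_pairs.
  rewrite (@pair_count_handovers R v (mk w) v_gt0 cr nt B).
  by rewrite muleA -EFinM mulVf// mul1e.
rewrite ge0_integralZl//; last 2 first.
- by apply/(measurable_restrictT _ mlf).
- by move=> w _; rewrite patchE; case: ifP => // _; exact: pair_count_ge0.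
rewrite -integral_mkcond eh -ge0_integralZl//; last 2 first.
- by apply: measurable_funTS; exact: emeasurable_funM.
- by move=> h _; rewrite mule_ge0.
apply: eq_integral => h _; rewrite /rate2 /dens -!EFinM; congr EFin.
by rewrite /handover_density; field.
Qed.

End handovers.

(** * The Gamma integral and the Palm law *)

Section gamma.
Context {R : realType}.

Let p : R := 5 / 2 - 1.
Let f (x : R) : R := x `^ p * expR (- x).

Let f_ge0 (x : R) : 0 <= f x. Proof. by rewrite mulr_ge0 ?powR_ge0 ?expR_ge0. Qed.

Let measurable_f : measurable_fun setT f.
Proof.
apply: measurable_funM; first exact: measurable_powR.
by apply: (measurableT_comp (@measurable_expR R)).
Qed.

Let p_le2 : p <= 2. Proof. by rewrite /p; lra. Qed.
Let p_ge0 : 0 <= p. Proof. by rewrite /p; lra. Qed.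

Let powR_le (x : R) : 0 <= x -> x `^ p <= 17 * expR (x / 2).
Proof.
move=> x0.
have h1 : x `^ p <= 1 + x ^+ 2.
  have [x1|/ltW x1] := leP 1 x.
    rewrite (le_trans (ler_powR x1 p_le2))// powR_mulrn//.
    by rewrite lerDr.
  rewrite (le_trans (_ : _ <= 1 `^ p))//; first by apply: ge0_ler_powR => //; rewrite nnegrE.
  by rewrite powR1 lerDl sqr_ge0.
(* 1 + x^2 <= 17 (1 + x / 4)^2 <= 17 exp (x / 2) *)
have h2 : 1 + x / 4 <= expR (x / 4) by exact: expR_ge1Dx.
have h3 : expR (x / 2) = expR (x / 4) ^+ 2.
  by rewrite expr2 -expRD; congr expR; field.
have h4 : (1 + x / 4) ^+ 2 <= expR (x / 2).
  by rewrite h3 ler_pXn2r// nnegrE ?expR_ge0// addr_ge0// divr_ge0.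
have := sqr_ge0 x; move: h4; rewrite !expr2; nra.
Qed.

Definition gamma_integral : \bar R := (\int[lebesgue_measure]_(x in `]0%R, +oo[) (f x)%:E)%E.

Lemma gamma_integral_lty : (gamma_integral < +oo)%E.
Proof.
(* The bound below by 17 exp (x / 2) makes the integrand at most 17 exp (- x / 2), which is 34
   times the exponential density of rate 1/2. *)
pose g (x : R) : R := 34 * exponential_pdf 2^-1 x.
have mg : measurable_fun setT g.
  by apply: measurable_funM => //; exact: measurable_exponential_pdf.
have g0 x : 0 <= g x by rewrite mulr_ge0// exponential_pdf_ge0.
apply: (@le_lt_trans _ _ (\int[lebesgue_measure]_x (g x)%:E)%E).
  apply: (@le_trans _ _ (\int[lebesgue_measure]_(x in `]0%R, +oo[) (g x)%:E)%E).
    apply: ge0_le_integral => //.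
    - by move=> x _; rewrite lee_fin.
    - by apply: measurable_funTS; apply/measurable_EFinP.
    - by apply: measurable_funTS; apply/measurable_EFinP.
    - move=> x /=; rewrite in_itv/= andbT => x0; rewrite lee_fin /g /exponential_pdf patchE.
      rewrite mem_set/=; last by rewrite in_itv/= ltW.
      rewrite /f.
      have e : expR (x / 2) * expR (- x) = expR (- 2^-1 * x) by rewrite -expRD; congr expR; field.
      apply: (@le_trans _ _ (17 * expR (x / 2) * expR (- x))).
        by rewrite ler_wpM2r ?expR_ge0// powR_le// ltW.
      by rewrite -mulrA e; lra.
  apply: ge0_subset_integral => //; first by apply/measurable_EFinP.
  by move=> x _; rewrite lee_fin.
under eq_integral do rewrite EFinM.
rewrite ge0_integralZl//.
- by rewrite integral_exponential_pdf ?invr_gt0// mule1 ltry.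
- by apply/measurable_EFinP; exact: measurable_exponential_pdf.
- by move=> x _; rewrite lee_fin exponential_pdf_ge0.
Qed.

Lemma gamma_integral_gt0 : (0 < gamma_integral)%E.
Proof.
apply: (@lt_le_trans _ _ (expR (- 2))%:E); first by rewrite lte_fin expR_gt0.
apply: (@le_trans _ _ (\int[lebesgue_measure]_(x in `[1%R, 2%R]) (f x)%:E)%E); last first.
  apply: ge0_subset_integral => //.
  - by apply: measurable_funTS; apply/measurable_EFinP.
  - by move=> x _; rewrite lee_fin.
  - by move=> x /=; rewrite !in_itv/= andbT => /andP[x1 _]; rewrite (lt_le_trans ltr01).
(* On [1, 2] the integrand is at least exp (- 2). *)
apply: (@le_trans _ _ (\int[lebesgue_measure]_(x in `[1%R, 2%R]) (cst (expR (- 2))%:E x))%E).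
  rewrite integral_cst//= lebesgue_measure_itv/= lte_fin ltr1n -EFinD.
  by rewrite (_ : 2 - 1 = 1 :> R) ?mule1//; lra.
apply: ge0_le_integral => //.
- by move=> x _; rewrite lee_fin expR_ge0.
- by apply: measurable_funTS; apply/measurable_EFinP.
- move=> x /=; rewrite in_itv/= => /andP[x1 x2]; rewrite lee_fin /f.
  have h1 : 1 <= x `^ p by rewrite -[leLHS](powRr0 x); exact: ler_powR.
  have h2 : expR (- 2) <= expR (- x) by rewrite ler_expR lerN2.
  by rewrite (le_trans h2)// ler_peMl// expR_ge0.
Qed.

Lemma GammaE : Gamma (5 / 2) = fine gamma_integral.
Proof. by []. Qed.

Lemma Gamma_gt0 : 0 < Gamma (5 / 2 : R).
Proof. by rewrite GammaE fine_gt0// gamma_integral_gt0 gamma_integral_lty. Qed.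

Lemma gamma_integralE : gamma_integral = (Gamma (5 / 2))%:E.
Proof. by rewrite GammaE fineK// ge0_fin_numE ?gamma_integral_lty// ltW// gamma_integral_gt0. Qed.

Variable c : R.
Hypothesis c_gt0 : 0 < c.

Let phi (y : R) : R := Num.sqrt (y / c).
Let g (h : R) : R := Num.max 0 h ^+ 3 * expR (- (c * h ^+ 2)).
Let E : set R := `]0, +oo[.

Let measurable_phi : measurable_fun setT phi.
Proof.
rewrite /phi; apply: measurableT_comp.
  by apply: continuous_measurable_fun; exact: sqrt_continuous.
by apply: measurable_funM.
Qed.

Let phi_density (B : set R) : measurable B ->
  lebR R (E `&` phi @^-1` B) = (\int[lebR R]_(h in B) (c * 2%:R * Num.max 0 h ^+ 1)%:E)%E.
Proof.
move=> mB; have mE : measurable E by exact: measurable_itv.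
pose m1 : {measure set R -> \bar R} :=
  measure_function_pushforward__canonical__measure_function_Measure
    (mrestr (lebR R) mE) measurable_phi.
have m1E C : m1 C = lebR R (E `&` phi @^-1` C) by rewrite setIC.
rewrite -m1E (@density_of_power_rays R c 0 (ltW c_gt0) m1 _ _ mB)// => r.
rewrite m1E; have [r0|r0] := leP r 0.
  rewrite expr0n/= mulr0 (_ : _ `&` _ = set0) ?measure0// -subset0 => y [_] /=.
  by rewrite in_itv/= ltNge (le_trans r0)// sqrtr_ge0.
rewrite (_ : _ `&` _ = `]0, c * r ^+ 2[%classic).
  rewrite lebRE lebesgue_measure_itv/= lte_fin mulr_gt0// ?exprn_gt0//.
  by rewrite -EFinB subr0.
have key (y : R) : 0 < y -> (phi y < r) = (y < c * r ^+ 2).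
  move=> y0; rewrite -(ltr_pXn2r (_ : (0 < 2)%N)) ?nnegrE ?sqrtr_ge0 ?(ltW r0)//.
  by rewrite sqr_sqrtr ?divr_ge0 ?ltW// ltr_pdivrMr// mulrC.
apply/seteqP; split => y; rewrite /E/= !in_itv/= ?andbT.
  by move=> [y0]; rewrite key// y0.
by move=> /andP[y0 yr]; split => //; rewrite key.
Qed.

(** The substitution y = c h^2, as an image of Lebesgue measure: the half-line of the y with
sqrt(y / c) < r has length c r^2, so h = sqrt(y / c) has density 2 c h. *)
Lemma gamma_integral_substitution :
  gamma_integral =
  (\int[lebR R]_h (2 * c `^ (5 / 2) * (Num.max 0 h ^+ 4 * expR (- (c * h ^+ 2))))%:E)%E.
Proof.
have mg : measurable_fun setT g.
  apply: measurable_funM; first by apply: measurable_funX; exact: measurable_maxr.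
  apply: (measurableT_comp (@measurable_expR R)); apply: measurableT_comp => //.
  by apply: measurable_funM.
have g0 h : 0 <= g h by rewrite mulr_ge0 ?expR_ge0// exprn_ge0// le_max lexx.
have mE : measurable E by exact: measurable_itv.
have key := @integral_image_density _ _ _ _ _ (lebR R) (lebR R) E phi
  (fun h => (c * 2%:R * Num.max 0 h ^+ 1)%:E) mE measurable_phi _ _ _ phi_density
  (fun h => (c `^ p * g h)%:E).
transitivity (\int[lebR R]_(x in E) (c `^ p * g (phi x))%:E)%E.
  rewrite ge0_integral_lebR//; last 2 first.
  - apply: measurable_funTS; apply/measurable_EFinP; apply: measurable_funM => //.
    exact: measurableT_comp.
  - by move=> x _; rewrite lee_fin mulr_ge0 ?powR_ge0.
  apply: eq_integral => x; rewrite inE /E/= in_itv/= andbT => x0; congr EFin.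
  rewrite /f /g (max_idPr (sqrtr_ge0 _)) mulrA.
  have xc0 : 0 <= x / c by rewrite divr_ge0// ltW.
  rewrite /phi sqr_sqrtr//; congr (_ * expR (- _)); last by field; rewrite gt_eqF.
  rewrite -powR12_sqrt// -powR_mulrn ?powR_ge0// -powRrM.
  rewrite (_ : 2^-1 * 3%:R = p); last by rewrite /p; field.
  by rewrite -powRM// ?(ltW c_gt0)//; congr (_ `^ _); field; rewrite gt_eqF.
rewrite key//.
- apply: eq_integral => h _; rewrite -EFinM; congr EFin.
  have -> : c `^ (5 / 2) = c `^ p * c.
    (* The powers c^p from the integrand and c from the density combine. *)
    have -> : 5 / 2 = p + 1 :> R by rewrite /p; field.
    by rewrite powRD ?(gt_eqF c_gt0) ?implybT// powRr1// ltW.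
  by rewrite /g; ring.
- by apply/measurable_EFinP; apply: measurable_funM => //; apply: measurable_funX; exact: measurable_maxr.
- by move=> h; rewrite lee_fin !mulr_ge0// ?(ltW c_gt0)// exprn_ge0// le_max lexx.
- by apply/measurable_EFinP; apply: measurable_funM.
- by move=> h; rewrite lee_fin mulr_ge0 ?powR_ge0.
Qed.

End gamma.

Theorem proposition5 (R : realType) (d : measure_display)
    (Omega : measurableType d) (P : probability Omega R)
    (lambda v : R) (lambda_gt0 : 0 < lambda) (v_gt0 : 0 < v)
    (X : nat -> {RV P >-> (R * R)%type}) (Theta : nat -> {RV P >-> R})
    (Phi_poisson : homogeneous_poisson lambda X)
    (Theta_uniform : forall i, uniform_angle (Theta i))
    (Theta_indep : mutually_independent Theta)
    (X_Theta_indep : independent_families X Theta) :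
  (0 < intensity P (V_I X Theta v) < +oo)%E /\
  forall B : set R, measurable B ->
    palm_distribution P (V_I X Theta v) (H_I X Theta v) B =
    nakagami_prob (5 / 2) (5 / (2 * lambda * pi)) B.
Proof.
set c := lambda * pi; have c_gt0 : 0 < c by rewrite mulr_gt0// pi_gt0.
set m : R := 5 / 2; set omega := 5 / (2 * lambda * pi).
have omega_gt0 : 0 < omega by rewrite divr_gt0// !mulr_gt0// pi_gt0.
have mc : m = c * omega.
  have := pi_gt0 R; rewrite /m /c /omega; move: pi => q q0.
  have l0 := lt0r_neq0 lambda_gt0; have {}q0 := lt0r_neq0 q0.
  by field; rewrite ?l0 ?q0.
have G0 := @Gamma_gt0 R.
(* The Nakagami density, extended by 0 to the negative half-line without a case distinction. *)
pose n (h : R) : R := 2 * c `^ m / Gamma m * (Num.max 0 h ^+ 4 * expR (- (c * h ^+ 2))).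
have n_ge0 h : 0 <= n h.
  by rewrite mulr_ge0// ?divr_ge0 ?mulr_ge0 ?powR_ge0 ?expR_ge0 ?exprn_ge0 ?le_max ?lexx// ltW.
have mn : measurable_fun setT n.
  apply: measurable_funM => //; apply: measurable_funM.
    by apply: measurable_funX; exact: measurable_maxr.
  apply: (measurableT_comp (@measurable_expR R)); apply: measurableT_comp => //.
  by apply: measurable_funM.
have n_pdf h : nakagami_pdf m omega h = n h.
  rewrite /nakagami_pdf /n; have [h0|h0] := leP 0 h; last by rewrite expr0n/= mul0r mulr0.
  rewrite (_ : 2 * m - 1 = 4%:R); last by rewrite /m; field.
  have mm : m `^ m = c `^ m * omega `^ m by rewrite -powRM ?ltW// -mc.
  rewrite powR_mulrn// mm.
  rewrite (_ : m * h ^+ 2 / omega = c * h ^+ 2); last by rewrite mc; field; rewrite gt_eqF.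
  by field; rewrite !gt_eqF// powR_gt0.
have n_int : (\int[lebR R]_h (n h)%:E = 1)%E.
  transitivity ((Gamma m)^-1%:E * @gamma_integral R)%E.
    rewrite (gamma_integral_substitution c_gt0) -ge0_integralZl//; last 3 first.
    - apply/measurable_EFinP; apply: measurable_funM => //; apply: measurable_funM.
        by apply: measurable_funX; exact: measurable_maxr.
      apply: (measurableT_comp (@measurable_expR R)); apply: measurableT_comp => //.
      by apply: measurable_funM.
    - move=> h _; rewrite lee_fin mulr_ge0// ?mulr_ge0 ?powR_ge0 ?expR_ge0 ?exprn_ge0 ?le_max ?lexx//.
    - by rewrite lee_fin invr_ge0 ltW.
    by apply: eq_integral => h _; rewrite -EFinM; congr EFin; rewrite /n; field; rewrite gt_eqF.
  by rewrite gamma_integralE -EFinM mulVf// gt_eqF.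
(* The mean number of handovers per unit time. *)
pose kappa : R := lambda ^+ 2 / 2 * tie_rate v * c * Gamma m / (2 * c `^ m).
have kappa_gt0 : 0 < kappa.
  have t0 := tie_rate_gt0 v_gt0; have l0 : 0 < lambda ^+ 2 / 2 by rewrite divr_gt0 ?exprn_gt0.
  apply: divr_gt0; last by rewrite mulr_gt0 ?powR_gt0.
  by apply: mulr_gt0 => //; apply: mulr_gt0 => //; exact: mulr_gt0.
have densE h : handover_density lambda v h = kappa * n h.
  rewrite /handover_density /kappa /n /poisson1.
  have [h0|h0] := leP 0 h; last by rewrite !expr0n/= !(mul0r, mulr0).
  rewrite (mulrA lambda) -/c.
  by field; rewrite !gt_eqF// powR_gt0.
have main (B : set R) : measurable B ->
    (\int[P]_w (\esum_(t in V_I X Theta v w `&` `[0%R, 1%R]) (\1_B (H_I X Theta v t w))%:E) =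
     kappa%:E * \int[lebR R]_(h in B) (n h)%:E)%E.
  move=> mB; rewrite (expectation_handovers (ltW lambda_gt0) v_gt0 Phi_poisson Theta_uniform
    Theta_indep X_Theta_indep mB) -ge0_integralZl//.
  - by apply: eq_integral => h _; rewrite densE EFinM.
  - by apply: measurable_funTS; apply/measurable_EFinP.
  - by move=> h _; rewrite lee_fin.
  - by rewrite lee_fin ltW.
have int_kappa : intensity P (V_I X Theta v) = kappa%:E.
  rewrite /intensity -[RHS]mule1 -n_int -(main setT)//.
  by apply: eq_integral => w _; apply: eq_esum => t _; rewrite indicT.
rewrite int_kappa; split; first by rewrite lte_fin kappa_gt0 ltry.
move=> B mB; rewrite /palm_distribution /palm_expectation int_kappa/= main//.
rewrite muleA -EFinM mulVf ?gt_eqF// mul1e /nakagami_prob.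
rewrite ge0_integral_lebR//.
- by apply: eq_integral => h _; rewrite n_pdf.
- by apply: measurable_funTS; apply/measurable_EFinP.
- by move=> h _; rewrite lee_fin.
Qed.
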